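(* Let $\alpha$ be a composition of $n$. (1) $\mathbf{Y}_\alpha$ is an indecomposable $H_n(0)$-module whose image under the quasisymmetric characteristic is the Young quasisymmetric Schur function $\hat{\mathcal{S}}_\alpha$. (2) The $\phi$-twist $\phi[\mathbf{Y}_\alpha]$ of $\mathbf{Y}_\alpha$ is an indecomposable $H_n(0)$-module whose image under the quasisymmetric characteristic is the quasisymmetric Schur function $\mathcal{S}_{\alpha^{\mathrm r}}$.
   Context: Let $n$ be a nonnegative integer. A composition $\alpha=(\alpha_1,\dots,\alpha_l)$ of $n$ ($\alpha\models n$) is a finite sequence of positive integers with sum $n$; $\alpha^{\mathrm r}=(\alpha_l,\dots,\alpha_1)$; $\mathrm{set}(\alpha)=\{\alpha_1,\alpha_1+\alpha_2,\dots,\alpha_1+\cdots+\alpha_{l-1}\}\subseteq[n-1]$, and $\mathrm{comp}$ is the inverse bijection from subsets of $[n-1]$ to compositions of $n$. The composition diagram of $\alpha$ consists of left-justified rows with $\alpha_i$ cells in the $i$th row from the bottom; $(i,j)$ denotes the cell in the $i$th row from the bottom and $j$th column from the left. 0-Hecke algebra. $H_n(0)$ is the associative unital $\mathbb C$-algebra generated by $\pi_1,\dots,\pi_{n-1}$ with relations $\pi_i^2=\pi_i$, $\pi_i\pi_{i+1}\pi_i=\pi_{i+1}\pi_i\pi_{i+1}$, $\pi_i\pi_j=\pi_j\pi_i$ for $|i-j|\ge2$. Its irreducible modules are the one-dimensional $\mathbf F_\alpha=\mathbb C v_\alpha$ with $\pi_i v_\alpha=0$ if $i\in\mathrm{set}(\alpha)$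 and $\pi_iv_\alpha=v_\alpha$ otherwise. $F_\alpha=\sum x_{i_1}\cdots x_{i_n}$ over $1\le i_1\le\cdots\le i_n$ with $i_j<i_{j+1}$ whenever $j\in\mathrm{set}(\alpha)$. The quasisymmetric characteristic $\mathrm{ch}$ sends $[\mathbf F_\alpha]$ to $F_\alpha$ and is additive on short exact sequences. Let $\phi:H_n(0)\to H_n(0)$ be the algebra automorphism $\pi_i\mapsto\pi_{n-i}$; $\phi[M]$ is the module with the same underlying space as $M$ and action $h\cdot_\phi m=\phi(h)\cdot m$. Functions. A Young composition tableau of shape $\alpha$ is a filling $T$ of the composition diagram with positive integers such that rows weakly increase from left to right, the first column strictly increases from bottom to top, and for cells $(i,k+1),(j,k)$ with $i<j$: if $T(i,k+1)\ge T(j,k)$ then $(j,k+1)$ is a cell and $T(i,k+1)>T(j,k+1)$. $\mathrm{SYCT}(\alpha)$ is the set of those in which each of $1,\dots,n$ appears exactly once. $\hat{\mathcal S}_\alpha=\sum_{T\in\mathrm{SYCT}(\alpha)}F_{\mathrm{comp}(\mathrm{Des}(T))}$, $\mathrm{Des}(T)=\{i\in[n-1]\mid i\text{ is weakly right of }i+1\text{ in }T\}$. A standard composition tableau of shape $\alpha$ is a filling $T$ of the composition diagram with $1,\dots,n$, each once, such that rows decrease from left to right, the first column increases from top to bottom, and for cells $(i,k+1),(j,k)$ with $i<j$: if $T(i,k+1)\le T(j,k)$ then $(j,k+1)$ is a cell and $T(i,k+1)<T(j,k+1)$. With $\mathrm{SCT}(\alpha)$ the set of these, the quasisymmetric Schur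 function is $\mathcal S_\alpha=\sum_{T\in\mathrm{SCT}(\alpha^{\mathrm r})}F_{\mathrm{comp}(D(T))}$, $D(T)=\{i\in[n-1]\mid i+1\text{ is weakly right of }i\text{ in }T\}$. One has $\hat{\mathcal S}_\alpha=\rho(\mathcal S_{\alpha^{\mathrm r}})$, where $\rho(F_\beta)=F_{\beta^{\mathrm r}}$. Insertion. Permutations are written as words; $w_0\in\mathfrak S_n$ is the longest element, so $\sigma w_0$ is the reversed word of $\sigma$. For a Young composition tableau $T$ and a positive integer $k$, define $k\to T$: list the cells $(c_1,d_1),(c_2,d_2),\dots$ of $T$ (before insertion) by decreasing column index $d$ and, within a column, decreasing row index $c$. Set $k_0:=k$ and process $i=1,2,\dots$: if $(c_i,d_i+1)$ is not a cell and $T(c_i,d_i)\le k_0$, place $k_0$ in a new cell $(c_i,d_i+1)$ and stop; if $(c_i,d_i+1)$ is a cell and $T(c_i,d_i)\le k_0<T(c_i,d_i+1)$, interchange $k_0$ with the entry in $(c_i,d_i+1)$ and continue; otherwise continue. If no stop occurs, create a new row with a single cell containing $k_0$, positioned so that the first column strictly increases from bottom to top. For $\sigma\in\mathfrak S_n$, $\hat{\mathsf P}(\sigma)$ is obtained from the empty tableau by inserting $\sigma(1),\dots,\sigma(n)$ successively. $\hat{\mathsf Q}(\sigma)$ is built simultaneously from the empty filling: at step $k$, if the new cell of $\hat{\mathsf P}$ lies in column $c=1$, add to $\hat{\mathsf Q}$ a new row with a single cell containing $k$, positioned so that the first column increases from bottom to top; if $c>1$, append $k$ at the end of the topmost row of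 $\hat{\mathsf Q}$ having exactly $c-1$ cells. The module $\mathbf Y_\alpha$. $\mathcal T_\alpha$ is the filling of the composition diagram of $\alpha$ with $1,\dots,n$ from left to right in each row, starting with the bottommost row and going up. Let $\mathcal K_\alpha=\{\sigma\in\mathfrak S_n\mid \mathrm{sh}(\hat{\mathsf P}(\sigma w_0))=\alpha\text{ and }\hat{\mathsf Q}(\sigma w_0)=\mathcal T_{\alpha^{\mathrm r}}\}$, where $\mathrm{sh}$ denotes shape. For $\sigma\in\mathfrak S_n$ let $\mathrm{Des}_L(\sigma)=\{i\in[n-1]\mid i\text{ is to the right of }i+1\text{ in the word of }\sigma\}$ and $s_i=(i,i+1)$. $\mathbf Y_\alpha$ is the $\mathbb C$-span of $\mathcal K_\alpha$ with the $H_n(0)$-action: $\pi_i\cdot\sigma=\sigma$ if $i\in\mathrm{Des}_L(\sigma)$; $\pi_i\cdot\sigma=s_i\sigma$ if $i\notin\mathrm{Des}_L(\sigma)$ and $s_i\sigma\in\mathcal K_\alpha$; $\pi_i\cdot\sigma=0$ otherwise. (It is a quotient, by a submodule, of the weak Bruhat interval module realizing the 0-Hecke module of the dual immaculate quasisymmetric function indexed by $\alpha$, and this formula is a well-defined action.) *)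

(* Defs.v *)
From HB Require Import structures.
From mathcomp Require Import all_boot all_order all_algebra fingroup perm.
From mathcomp Require Import generic_quotient ring_quotient.
From mathcomp Require Import finmap boolp reals complex.
From mathcomp.multinomials Require Import monalg.

Set Implicit Arguments.
Unset Strict Implicit.
Unset Printing Implicit Defensive.

Import GRing.Theory.

Local Open Scope nat_scope.

Definition is_comp (n : nat) (alpha : seq nat) : bool :=
  all (leq 1) alpha && (sumn alpha == n).

Definition comp_set (alpha : seq nat) : seq nat :=
  [seq sumn (take k alpha) | k <- iota 1 (size alpha).-1].

(* [S] is an increasing sequence of elements of [1, n-1]. *)
Definition comp_of_set (n : nat) (S : seq nat) : seq nat :=
  if n is 0 then [::] else pairmap (fun a b => b - a) 0 (rcons S n).

(* A filling is the sequence of its rows, listed from bottom to top, each read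
   from left to right; its shape is [seq.shape].  Rows and columns are numbered
   from 0, so that the cell (i, j) of the diagram is (i.-1, j.-1) here. *)
Definition filling := seq (seq nat).

Definition is_cell (T : filling) (i j : nat) : bool := j < size (nth [::] T i).

Definition entry (T : filling) (i j : nat) : nat := nth 0 (nth [::] T i) j.

Definition column (T : filling) (k : nat) : nat :=
  index k (nth [::] T (find (fun r => k \in r) T)).

Definition standard_fillings (alpha : seq nat) : seq filling :=
  [seq reshape alpha w | w <- permutations (iota 1 (sumn alpha))].

Definition first_column (T : filling) : seq nat := [seq head 0 r | r <- T].

Definition is_SYCT (T : filling) : bool :=
  [&& all (sorted leq) T,
      sorted ltn (first_column T)
    & [forall j : 'I_(size T), forall i : 'I_j, forall k : 'I_(size (nth [::] T j)),
         (is_cell T i k.+1 && (entry T j k <= entry T i k.+1)) ==>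
         (is_cell T j k.+1 && (entry T j k.+1 < entry T i k.+1))]].

Definition SYCT (alpha : seq nat) : seq filling :=
  [seq T <- standard_fillings alpha | is_SYCT T].

(* The first column increases from top to bottom, i.e. decreases along the
   sequence of rows. *)
Definition is_SCT (T : filling) : bool :=
  [&& all (sorted geq) T,
      sorted gtn (first_column T)
    & [forall j : 'I_(size T), forall i : 'I_j, forall k : 'I_(size (nth [::] T j)),
         (is_cell T i k.+1 && (entry T i k.+1 <= entry T j k)) ==>
         (is_cell T j k.+1 && (entry T i k.+1 < entry T j k.+1))]].

Definition SCT (alpha : seq nat) : seq filling :=
  [seq T <- standard_fillings alpha | is_SCT T].

Definition Des (n : nat) (T : filling) : seq nat :=
  [seq i <- iota 1 n.-1 | column T i.+1 <= column T i].

Definition DesC (n : nat) (T : filling) : seq nat :=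
  [seq i <- iota 1 n.-1 | column T i <= column T i.+1].

Definition scan_cells (T : filling) : seq (nat * nat) :=
  [seq x <- [seq (c, d) | d <- rev (iota 0 (foldr maxn 0 (shape T))),
                          c <- rev (iota 0 (size T))] | is_cell T x.1 x.2].

Definition set_row (T : filling) (c : nat) (r : seq nat) : filling :=
  set_nth [::] T c r.

Definition add_row (k : nat) (T : filling) : filling :=
  let p := find (fun r => k < head 0 r) T in take p T ++ [:: k] :: drop p T.

(* The scan of the remaining cells [cells], carrying the entry [k]; the result
   is the new tableau together with the column (from 0) of the new cell. *)
Fixpoint insert_scan (k : nat) (T : filling) (cells : seq (nat * nat)) :
    filling * nat :=
  if cells is (c, d) :: cells' then
    let r := nth [::] T c in
    if ~~ is_cell T c d.+1 && (entry T c d <= k) then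
      (set_row T c (rcons r k), d.+1)
    else if is_cell T c d.+1 && (entry T c d <= k < entry T c d.+1) then
      insert_scan (entry T c d.+1) (set_row T c (set_nth 0 r d.+1 k)) cells'
    else insert_scan k T cells'
  else (add_row k T, 0).

Definition insertion (k : nat) (T : filling) : filling * nat :=
  insert_scan k T (scan_cells T).

(* Appends [k] to the topmost row with exactly [c] cells. *)
Definition append_top (c k : nat) (T : filling) : filling :=
  let p := (size T).-1 - find (fun r => size r == c) (rev T) in
  set_row T p (rcons (nth [::] T p) k).

Definition record_step (k c : nat) (Q : filling) : filling :=
  if c == 0 then add_row k Q else append_top c k Q.

Definition PQ_step (s : filling * filling) (ka : nat * nat) : filling * filling :=
  let: (P, c) := insertion ka.2 s.1 in (P, record_step ka.1 c s.2).

Definition PQ (w : seq nat) : filling * filling :=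
  foldl PQ_step ([::], [::]) (zip (iota 1 (size w)) w).

(* ['S_n] permutes {0, ..., n-1}, hence the shift of the letters. *)
Definition word (n : nat) (s : 'S_n) : seq nat := [seq (s i).+1 | i <- enum 'I_n].

Definition hatP (n : nat) (s : 'S_n) : filling := (PQ (word s)).1.
Definition hatQ (n : nat) (s : 'S_n) : filling := (PQ (word s)).2.

Definition longest (n : nat) : 'S_n := perm (@rev_ord_inj n).

Definition canonical_filling (alpha : seq nat) : filling :=
  reshape alpha (iota 1 (sumn alpha)).

(* The product of ['S_n] composes from left to right: the permutation written
   sigma w_0 in functional notation is [longest n * s]. *)
Definition Kset (n : nat) (alpha : seq nat) : {set 'S_n} :=
  [set s : 'S_n | (shape (hatP (longest n * s)%g) == alpha) &&
                  (hatQ (longest n * s)%g == canonical_filling (rev alpha))].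

(* [i : 'I_n.-1] stands for the index i+1 of a generator or of a simple
   transposition: it exchanges the letters i+1 and i+2, which are [lo_ord i]
   and [hi_ord i] in ['I_n]. *)
Lemma hi_ord_subproof (n : nat) (i : 'I_n.-1) : i.+1 < n.
Proof. by case: n i => [|n] i; [case: i | exact: ltn_ord i]. Qed.

Definition lo_ord (n : nat) (i : 'I_n.-1) : 'I_n := widen_ord (leq_pred n) i.
Definition hi_ord (n : nat) (i : 'I_n.-1) : 'I_n := Ordinal (hi_ord_subproof i).

Definition simple (n : nat) (i : 'I_n.-1) : 'S_n := tperm (lo_ord i) (hi_ord i).

(* [s^-1] maps a letter to its position in the word of [s]. *)
Definition DesL (n : nat) (s : 'S_n) : pred 'I_n.-1 :=
  fun i => (s^-1)%g (hi_ord i) < (s^-1)%g (lo_ord i).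

Local Open Scope ring_scope.

(* Formal power series over the integers in x_1, x_2, ...; a monomial maps the
   index i to the exponent of x_{i+1}. *)
Definition powser := {cmonom nat} -> int.

Definition monomial_word (m : {cmonom nat}) : seq nat :=
  flatten [seq nseq (m i) i | i <- finsupp m].

(* i_1 <= ... <= i_n, with i_j < i_{j+1} whenever j is in set(alpha). *)
Definition F_seq (alpha w : seq nat) : bool :=
  (size w == sumn alpha) &&
  all (fun j => if j \in comp_set alpha then (nth 0 w j.-1 < nth 0 w j)%N
                else (nth 0 w j.-1 <= nth 0 w j)%N)
      (iota 1 (sumn alpha).-1).

(* The coefficient of m in F_alpha is the number of sequences i_1, ..., i_n as
   above with x_{i_1} ... x_{i_n} = m; the sequences with this product are the
   distinct rearrangements of [monomial_word m]. *)
Definition fundamental (alpha : seq nat) : powser :=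
  fun m => (count (F_seq alpha) (permutations (monomial_word m)))%:Z.

Definition young_qschur (alpha : seq nat) : powser :=
  fun m => \sum_(T <- SYCT alpha)
    fundamental (comp_of_set (sumn alpha) (Des (sumn alpha) T)) m.

Definition qschur (alpha : seq nat) : powser :=
  fun m => \sum_(T <- SCT (rev alpha))
    fundamental (comp_of_set (sumn alpha) (DesC (sumn alpha) T)) m.

Lemma malg_scalerAr (K : monomType) (R : comNzRingType) (a : R)
  (u v : {malg R[K]}) : a *: (u * v) = u * (a *: v).
Proof.
have aC : a%:MP * u = u * a%:MP.
  rewrite !malgM_def fgmulUg fgmulgU; apply: eq_bigr => k _.
  by rewrite mulrC mul1m mulm1.
by rewrite -(mul_malgC a (u * v)) -(mul_malgC a v) mulrA aC mulrA.
Qed.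

Section RelatorValue.
Variables (A : pzRingType) (B : zmodType) (mul : B -> B -> B) (c : A -> B).
Hypothesis cB : {morph c : x y / x - y}.
Hypothesis cM : forall x y, c (x * y) = mul (c x) (c y).

Fact relator_idem x u : c x = u -> c (x * x - x) = mul u u - u.
Proof. by move=> <-; rewrite cB cM. Qed.

Fact relator_braid x y u v : c x = u -> c y = v ->
  c (x * y * x - y * x * y) = mul (mul u v) u - mul (mul v u) v.
Proof. by move=> <- <-; rewrite cB !cM. Qed.

Fact relator_comm x y u v : c x = u -> c y = v ->
  c (x * y - y * x) = mul u v - mul v u.
Proof. by move=> <- <-; rewrite cB !cM. Qed.

End RelatorValue.

Section HeckeAlgebra.
Variables (F : fieldType) (n : nat).

(* The free algebra on the symbols indexed by ['I_n.-1]; the index i stands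
   for pi_{i+1}. *)
Local Notation free_alg := {malg F[{fmonom 'I_n.-1}]}.

Definition free_gen (i : 'I_n.-1) : free_alg := << fmu i >>.

Variant hecke_relator : free_alg -> Prop :=
| RelIdem (i : 'I_n.-1) : hecke_relator (free_gen i * free_gen i - free_gen i)
| RelBraid (i j : 'I_n.-1) : j = i.+1 :> nat ->
    hecke_relator (free_gen i * free_gen j * free_gen i -
                   free_gen j * free_gen i * free_gen j)
| RelComm (i j : 'I_n.-1) : (i.+1 < j)%N ->
    hecke_relator (free_gen i * free_gen j - free_gen j * free_gen i).

(* The two-sided ideal generated by the relators. *)
Inductive hecke_ideal : free_alg -> Prop :=
| IdealRel x : hecke_relator x -> hecke_ideal x
| Ideal0 : hecke_ideal 0
| IdealB x y : hecke_ideal x -> hecke_ideal y -> hecke_ideal (x - y)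
| IdealMl a x : hecke_ideal x -> hecke_ideal (a * x)
| IdealMr a x : hecke_ideal x -> hecke_ideal (x * a).

Definition ideal_pred : {pred free_alg} := fun x => `[< hecke_ideal x >].

Lemma ideal_predP x : reflect (hecke_ideal x) (x \in ideal_pred).
Proof. exact: asboolP. Qed.

Lemma ideal_pred_zmod_closed : zmod_closed ideal_pred.
Proof.
split=> [|x y /ideal_predP hx /ideal_predP hy]; apply/ideal_predP.
  exact: Ideal0.
exact: IdealB.
Qed.

HB.instance Definition _ :=
  GRing.isZmodClosed.Build free_alg ideal_pred ideal_pred_zmod_closed.

Definition hecke : Type := Quotient.quot ideal_pred.
HB.instance Definition _ := Choice.on hecke.
HB.instance Definition _ := GRing.Zmodule.on hecke.

Definition hecke_pi (x : free_alg) : hecke := (\pi_(Quotient.quot ideal_pred) x)%qT.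

Lemma hecke_piP x y : hecke_pi x = hecke_pi y <-> hecke_ideal (x - y).
Proof.
split=> [/eqP|h]; first by rewrite -Quotient.idealrBE => /ideal_predP.
by apply/eqP; rewrite -Quotient.idealrBE; apply/ideal_predP.
Qed.

Lemma hecke_piD : {morph hecke_pi : x y / x + y}.
Proof. exact: Quotient.pi_add. Qed.

Lemma hecke_reprK (x : hecke) : hecke_pi (repr x) = x.
Proof. exact: reprK. Qed.

(* Locked, lest unification unfold products of the quotient. *)
Definition hecke_mul : hecke -> hecke -> hecke :=
  locked (fun x y => hecke_pi (repr x * repr y)).
Definition hecke_scale : F -> hecke -> hecke :=
  locked (fun c x => hecke_pi (c *: repr x)).

Lemma hecke_piM x y : hecke_pi (x * y) = hecke_mul (hecke_pi x) (hecke_pi y).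
Proof.
rewrite /hecke_mul -lock; apply/hecke_piP.
have [hx hy] : hecke_ideal (x - repr (hecke_pi x)) /\
               hecke_ideal (repr (hecke_pi y) - y).
  by split; apply/hecke_piP; rewrite hecke_reprK.
set x' := repr _ in hx *; set y' := repr _ in hy *.
have -> : x * y - x' * y' = (x - x') * y - x' * (y' - y).
  by rewrite mulrBl mulrBr opprB addrA subrK.
by apply: IdealB; [apply: IdealMr | apply: IdealMl].
Qed.

Lemma hecke_piZ c x : hecke_pi (c *: x) = hecke_scale c (hecke_pi x).
Proof.
rewrite /hecke_scale -lock; apply/hecke_piP.
rewrite -scalerBr -mul_malgC; apply: IdealMl.
by apply/hecke_piP; rewrite hecke_reprK.
Qed.

Lemma hecke_mulA : associative hecke_mul.
Proof.
by move=> x y z; rewrite -[x]hecke_reprK -[y]hecke_reprK -[z]hecke_reprK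
  -!hecke_piM mulrA.
Qed.

Lemma hecke_mul1 : left_id (hecke_pi 1) hecke_mul.
Proof. by move=> x; rewrite -[x]hecke_reprK -hecke_piM mul1r. Qed.

Lemma hecke_mulr1 : right_id (hecke_pi 1) hecke_mul.
Proof. by move=> x; rewrite -[x]hecke_reprK -hecke_piM mulr1. Qed.

Lemma hecke_mulDl : left_distributive hecke_mul +%R.
Proof.
by move=> x y z; rewrite -[x]hecke_reprK -[y]hecke_reprK -[z]hecke_reprK
  -!(hecke_piM, hecke_piD) mulrDl.
Qed.

Lemma hecke_mulDr : right_distributive hecke_mul +%R.
Proof.
by move=> x y z; rewrite -[x]hecke_reprK -[y]hecke_reprK -[z]hecke_reprK
  -!(hecke_piM, hecke_piD) mulrDr.
Qed.

Lemma hecke_ideal_morph (c : free_alg -> F) :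
    c 0 = 0 -> {morph c : x y / x - y} -> {morph c : x y / x * y} ->
    (forall i, c (free_gen i) = 0) ->
  forall x, hecke_ideal x -> c x = 0.
Proof.
move=> c0 cB cM g0 x; elim=> [y hy||y z _ hy _ hz|a y _ hy|a y _ hy] //.
- case: hy => [i|i j _|i j _].
  + by rewrite (relator_idem cB cM (g0 i)) mul0r subr0.
  + by rewrite (relator_braid cB cM (g0 i) (g0 j)) !mulr0 subr0.
  + by rewrite (relator_comm cB cM (g0 i) (g0 j)) mulr0 subr0.
- by rewrite cB hy hz subr0.
- by rewrite cM hy mulr0.
- by rewrite cM hy mul0r.
Qed.

Lemma hecke_ideal_coeff1 x : hecke_ideal x -> mcoeff (@mone _) x = 0.
Proof.
apply: hecke_ideal_morph x => [|||i]; first exact: mcoeff0.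
- exact: mcoeffB.
- exact: rmorphM.
- by rewrite mcoeffU1 -fdeg_eq0 fdegU.
Qed.

Lemma hecke_1_neq0 : hecke_pi 1 != 0.
Proof.
have <- : hecke_pi 0 = 0.
  by apply: (addrI (hecke_pi 0)); rewrite -hecke_piD !addr0.
apply/eqP => /hecke_piP; rewrite subr0 => /hecke_ideal_coeff1.
by rewrite rmorph1 => /eqP; rewrite oner_eq0.
Qed.

HB.instance Definition _ := GRing.Zmodule_isNzRing.Build hecke
  hecke_mulA hecke_mul1 hecke_mulr1 hecke_mulDl hecke_mulDr hecke_1_neq0.

Lemma hecke_scalerA a b v :
  hecke_scale a (hecke_scale b v) = hecke_scale (a * b) v.
Proof. by rewrite -[v]hecke_reprK -!hecke_piZ scalerA. Qed.

Lemma hecke_scale1r : left_id 1 hecke_scale.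
Proof. by move=> v; rewrite -[v]hecke_reprK -hecke_piZ scale1r. Qed.

Lemma hecke_scalerDr : right_distributive hecke_scale +%R.
Proof.
by move=> a u v; rewrite -[u]hecke_reprK -[v]hecke_reprK
  -!(hecke_piD, hecke_piZ) scalerDr.
Qed.

Lemma hecke_scalerDl v : {morph hecke_scale^~ v : a b / a + b}.
Proof.
by move=> a b; rewrite -[v]hecke_reprK -!(hecke_piD, hecke_piZ) scalerDl.
Qed.

HB.instance Definition _ := GRing.Zmodule_isLmodule.Build F hecke
  hecke_scalerA hecke_scale1r hecke_scalerDr hecke_scalerDl.

Lemma hecke_scalerAl (a : F) (u v : hecke) : a *: (u * v) = (a *: u) * v.
Proof.
change (hecke_scale a (hecke_mul u v) = hecke_mul (hecke_scale a u) v).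
by rewrite -[u]hecke_reprK -[v]hecke_reprK -!(hecke_piM, hecke_piZ) scalerAl.
Qed.

HB.instance Definition _ := GRing.Lmodule_isLalgebra.Build F hecke hecke_scalerAl.

Lemma hecke_scalerAr (a : F) (u v : hecke) : a *: (u * v) = u * (a *: v).
Proof.
change (hecke_scale a (hecke_mul u v) = hecke_mul u (hecke_scale a v)).
rewrite -[u]hecke_reprK -[v]hecke_reprK -!(hecke_piM, hecke_piZ).
by rewrite malg_scalerAr.
Qed.

HB.instance Definition _ := GRing.Lalgebra_isAlgebra.Build F hecke hecke_scalerAr.

Definition hecke_gen (i : 'I_n.-1) : hecke := hecke_pi (free_gen i).

Lemma hecke_pi_mul x y : hecke_pi x * hecke_pi y = hecke_pi (x * y).
Proof. by rewrite hecke_piM. Qed.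

Lemma hecke_gen_idem i : hecke_gen i * hecke_gen i = hecke_gen i.
Proof.
rewrite /hecke_gen hecke_pi_mul; apply/hecke_piP.
exact/IdealRel/RelIdem.
Qed.

Lemma hecke_gen_braid (i j : 'I_n.-1) : j = i.+1 :> nat ->
  hecke_gen i * hecke_gen j * hecke_gen i =
  hecke_gen j * hecke_gen i * hecke_gen j.
Proof.
move=> ij; rewrite /hecke_gen !hecke_pi_mul; apply/hecke_piP.
exact/IdealRel/RelBraid.
Qed.

Lemma hecke_gen_comm (i j : 'I_n.-1) : (i.+1 < j)%N ->
  hecke_gen i * hecke_gen j = hecke_gen j * hecke_gen i.
Proof.
move=> ij; rewrite /hecke_gen !hecke_pi_mul; apply/hecke_piP.
exact/IdealRel/RelComm.
Qed.

End HeckeAlgebra.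

Section Lift.
Variables (F : fieldType) (n : nat) (A : lmodType F).
Variables (mul : A -> A -> A) (one : A) (p : 'I_n.-1 -> A).
Hypothesis mulA : associative mul.
Hypothesis mul1 : left_id one mul.
Hypothesis mulr1 : right_id one mul.
Hypothesis mul_linear : forall a, linear (mul a).
Hypothesis mulr_linear : forall a, linear (mul^~ a).

Local Notation free_alg := {malg F[{fmonom 'I_n.-1}]}.

Let mulL a : {linear A -> A} :=
  HB.pack (mul a) (GRing.isLinear.Build F A A _ (mul a) (mul_linear a)).
Let mulR a : {linear A -> A} :=
  HB.pack (mul^~ a) (GRing.isLinear.Build F A A _ (mul^~ a) (mulr_linear a)).

Let mul0x a : mul 0 a = 0. Proof. exact: (raddf0 (mulR a)). Qed.
Let mulx0 a : mul a 0 = 0. Proof. exact: (raddf0 (mulL a)). Qed.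
Let mulZl c x y : mul (c *: x) y = c *: mul x y.
Proof. exact: (linearZZ (mulR y)). Qed.
Let mulZr c x y : mul x (c *: y) = c *: mul x y.
Proof. exact: (linearZZ (mulL x)). Qed.

Definition word_value (w : {fmonom 'I_n.-1}) : A :=
  foldr (fun k => mul (p k)) one w.

Definition free_lift (x : free_alg) : A :=
  \sum_(w <- msupp x) mcoeff w x *: word_value w.

Definition hecke_lift (x : hecke F n) : A := free_lift (generic_quotient.repr x).

Lemma word_value1 : word_value (@mone _) = one.
Proof. by rewrite /word_value fm1. Qed.

Lemma word_valueM u v :
  word_value (mmul u v) = mul (word_value u) (word_value v).
Proof.
rewrite /word_value fmM foldr_cat.
elim: (u : seq _) => [|k s IH] /=; first by rewrite mul1.
by rewrite IH mulA.
Qed.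

Lemma free_liftEw (E : {fset {fmonom 'I_n.-1}}) (x : free_alg) :
    (msupp x `<=` E)%fset ->
  free_lift x = \sum_(w <- E) mcoeff w x *: word_value w.
Proof.
move=> sxE; rewrite /free_lift (big_fset_incl _ sxE) //= => w _.
by move/mcoeff_outdom ->; rewrite scale0r.
Qed.

Lemma free_lift_linear : linear free_lift.
Proof.
move=> a x y.
pose E := (msupp x `|` msupp y)%fset.
have sx : (msupp x `<=` E)%fset by apply: fsubsetUl.
have sy : (msupp y `<=` E)%fset by apply: fsubsetUr.
have sxy : (msupp (a *: x + y) `<=` E)%fset.
  apply: (fsubset_trans (msuppD_le _ _)); rewrite fsubUset sy andbT.
  exact: (fsubset_trans (msuppZ_le _ _)).
rewrite (free_liftEw sx) (free_liftEw sy) (free_liftEw sxy).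
rewrite scaler_sumr -big_split /=; apply: eq_bigr => w _.
by rewrite mcoeffD mcoeffZ scalerDl scalerA.
Qed.

HB.instance Definition _ :=
  GRing.isLinear.Build F free_alg A _ free_lift free_lift_linear.

Lemma free_liftU c w : free_lift << c *g w >> = c *: word_value w.
Proof. by rewrite (free_liftEw msuppU_le) big_seq_fset1 mcoeffUU. Qed.

Lemma free_lift1 : free_lift 1 = one.
Proof. by rewrite [free_lift _]free_liftU scale1r word_value1. Qed.

Lemma free_lift_gen i : free_lift (free_gen F i) = p i.
Proof. by rewrite free_liftU scale1r /word_value fmU /= mulr1. Qed.

Lemma free_liftM x y : free_lift (x * y) = mul (free_lift x) (free_lift y).
Proof.
rewrite malgME raddf_sum [free_lift x in RHS]/free_lift.
rewrite [RHS](raddf_sum (mulR (free_lift y))); apply: eq_bigr => u _ /=.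
rewrite raddf_sum [free_lift y in RHS]/free_lift.
rewrite [RHS](raddf_sum (mulL _)); apply: eq_bigr => v _.
rewrite [LHS]free_liftU word_valueM.
by rewrite /= mulZl mulZr scalerA.
Qed.

Hypothesis p_idem : forall i, mul (p i) (p i) = p i.
Hypothesis p_braid : forall i j : 'I_n.-1, j = i.+1 :> nat ->
  mul (mul (p i) (p j)) (p i) = mul (mul (p j) (p i)) (p j).
Hypothesis p_comm : forall i j : 'I_n.-1, (i.+1 < j)%N ->
  mul (p i) (p j) = mul (p j) (p i).

Lemma free_lift_ideal x : hecke_ideal x -> free_lift x = 0.
Proof.
have liftB : {morph free_lift : x y / x - y} by exact: raddfB.
move: x; apply: hecke_ideal_ind => [x hx||x y _ hx _ hy|a x _ hx|a x _ hx].
- case: hx => [i|i j ij|i j ij].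
  + by rewrite (relator_idem liftB free_liftM (free_lift_gen i)) p_idem subrr.
  + rewrite (relator_braid liftB free_liftM (free_lift_gen i) (free_lift_gen j)).
    by rewrite p_braid // subrr.
  + rewrite (relator_comm liftB free_liftM (free_lift_gen i) (free_lift_gen j)).
    by rewrite p_comm // subrr.
- exact: raddf0.
- by rewrite raddfB /= hx hy subr0.
- by rewrite free_liftM hx mulx0.
- by rewrite free_liftM hx mul0x.
Qed.

Lemma hecke_lift_pi x : hecke_lift (hecke_pi x) = free_lift x.
Proof.
apply/eqP; rewrite -subr_eq0 -raddfB /=; apply/eqP/free_lift_ideal.
by apply/hecke_piP; rewrite hecke_reprK.
Qed.

Lemma hecke_lift_linear : linear hecke_lift.
Proof.
move=> a x y; rewrite -[x]hecke_reprK -[y]hecke_reprK.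
rewrite -[a *: _]hecke_piZ -hecke_piD !hecke_lift_pi.
exact: free_lift_linear.
Qed.

Lemma hecke_lift1 : hecke_lift 1 = one.
Proof. by rewrite [hecke_lift _]hecke_lift_pi free_lift1. Qed.

Lemma hecke_liftM x y : hecke_lift (x * y) = mul (hecke_lift x) (hecke_lift y).
Proof.
rewrite -[x]hecke_reprK -[y]hecke_reprK -[_ * _]hecke_piM !hecke_lift_pi.
exact: free_liftM.
Qed.

Lemma hecke_lift_gen i : hecke_lift (hecke_gen F i) = p i.
Proof. by rewrite hecke_lift_pi free_lift_gen. Qed.

End Lift.

Section Phi.
Variables (F : fieldType) (n : nat).
Local Notation H := (hecke F n).

(* [rev_ord] maps the index i of a generator pi_{i+1} to that of pi_{n-(i+1)}. *)
Definition hecke_phi : H -> H :=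
  @hecke_lift F n H (@GRing.mul H) 1 (fun i => hecke_gen F (rev_ord i)).

Let HmulA : associative (@GRing.mul H). Proof. exact: mulrA. Qed.
Let Hmul1 : left_id 1 (@GRing.mul H). Proof. exact: mul1r. Qed.
Let Hmulr1 : right_id 1 (@GRing.mul H). Proof. exact: mulr1. Qed.

Let gen_idem (i : 'I_n.-1) := hecke_gen_idem F (rev_ord i).

Let gen_braid (i j : 'I_n.-1) : j = i.+1 :> nat ->
  hecke_gen F (rev_ord i) * hecke_gen F (rev_ord j) * hecke_gen F (rev_ord i) =
  hecke_gen F (rev_ord j) * hecke_gen F (rev_ord i) * hecke_gen F (rev_ord j).
Proof.
move=> ij; symmetry; apply: hecke_gen_braid => /=.
by have := ltn_ord j; rewrite ij => h; rewrite subnSK.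
Qed.

Let gen_comm (i j : 'I_n.-1) : (i.+1 < j)%N ->
  hecke_gen F (rev_ord i) * hecke_gen F (rev_ord j) =
  hecke_gen F (rev_ord j) * hecke_gen F (rev_ord i).
Proof.
move=> ij; symmetry; apply: hecke_gen_comm => /=.
by rewrite subnSK // ltn_sub2l // (ltn_trans ij).
Qed.

Let Hmull (a : H) : linear (@GRing.mul H a).
Proof. by move=> c x y; rewrite mulrDr scalerAr. Qed.

Let Hmulr (a : H) : linear ((@GRing.mul H)^~ a).
Proof. by move=> c x y; rewrite mulrDl scalerAl. Qed.

Lemma hecke_phi_linear : linear hecke_phi.
Proof.
exact: (hecke_lift_linear HmulA Hmul1 Hmulr1 Hmull Hmulr gen_idem gen_braid
  gen_comm).
Qed.

Lemma hecke_phi_monoid_morphism : monoid_morphism hecke_phi.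
Proof.
split.
  exact: (hecke_lift1 HmulA Hmul1 Hmulr1 Hmull Hmulr gen_idem gen_braid gen_comm).
exact: (hecke_liftM HmulA Hmul1 Hmulr1 Hmull Hmulr gen_idem gen_braid gen_comm).
Qed.

HB.instance Definition _ :=
  GRing.isLinear.Build F H H _ hecke_phi hecke_phi_linear.
HB.instance Definition _ :=
  GRing.isMonoidMorphism.Build H H hecke_phi hecke_phi_monoid_morphism.

Lemma hecke_phi_gen (i : 'I_n.-1) :
  hecke_phi (hecke_gen F i) = hecke_gen F (rev_ord i).
Proof.
exact: (hecke_lift_gen HmulA Hmul1 Hmulr1 Hmull Hmulr gen_idem gen_braid
  gen_comm).
Qed.

End Phi.

Section Modules.
Variables (F : fieldType) (n : nat).
Local Notation H := (hecke F n).

(* The finite-dimensional H_n(0)-modules with underlying space V. *)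
Record hmodule (V : vectType F) := HModule {
  hact :> H -> 'End(V);
  hact_linear : linear hact;
  hact1 : hact 1 = \1%VF;
  hactM : forall g h, hact (g * h) = (hact g \o hact h)%VF
}.

Lemma hmodule_of_operators (V : vectType F) (p : 'I_n.-1 -> 'End(V)) :
    (forall i, (p i \o p i)%VF = p i) ->
    (forall i j : 'I_n.-1, j = i.+1 :> nat ->
       (p i \o p j \o p i)%VF = (p j \o p i \o p j)%VF) ->
    (forall i j : 'I_n.-1, (i.+1 < j)%N -> (p i \o p j)%VF = (p j \o p i)%VF) ->
  exists M : hmodule V, forall i, M (hecke_gen F i) = p i.
Proof.
move=> pI pB pC.
have cA : associative (@comp_lfun _ V V V) by exact: comp_lfunA.
have c1 : left_id \1%VF (@comp_lfun _ V V V) by exact: comp_lfun1l.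
have cr1 : right_id \1%VF (@comp_lfun _ V V V) by exact: comp_lfun1r.
have cl (a : 'End(V)) : linear (@comp_lfun _ V V V a).
  by move=> c x y; rewrite comp_lfunDr comp_lfunZr.
have cr (a : 'End(V)) : linear ((@comp_lfun _ V V V)^~ a).
  by move=> c x y; rewrite comp_lfunDl comp_lfunZl.
exists (HModule (hecke_lift_linear cA c1 cr1 cl cr pI pB pC)
                (hecke_lift1 cA c1 cr1 cl cr pI pB pC)
                (hecke_liftM cA c1 cr1 cl cr pI pB pC)) => i.
exact: (hecke_lift_gen cA c1 cr1 cl cr pI pB pC).
Qed.

Definition submodule (V : vectType F) (M : hmodule V) (U : {vspace V}) : Prop :=
  forall h : H, (M h @: U <= U)%VS.

Definition indecomposable (V : vectType F) (M : hmodule V) : Prop :=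
  {: V}%VS <> 0%VS /\
  forall U W : {vspace V}, submodule M U -> submodule M W ->
    (U + W)%VS = fullv -> (U :&: W)%VS = 0%VS -> U = 0%VS \/ W = 0%VS.

Definition hmorphism (V W : vectType F) (M : hmodule V) (N : hmodule W)
  (f : 'Hom(V, W)) : Prop := forall h v, f (M h v) = N h (f v).

Section Twist.
Variables (V : vectType F) (M : hmodule V).

Definition twist_act (h : H) : 'End(V) := M (hecke_phi h).

Fact twist_act_linear : linear twist_act.
Proof. by move=> c x y; rewrite /twist_act linearP hact_linear. Qed.

Fact twist_act1 : twist_act 1 = \1%VF.
Proof. by rewrite /twist_act rmorph1 hact1. Qed.

Fact twist_actM g h : twist_act (g * h) = (twist_act g \o twist_act h)%VF.
Proof. by rewrite /twist_act rmorphM hactM. Qed.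

Definition twist : hmodule V := HModule twist_act_linear twist_act1 twist_actM.

End Twist.

(* M is isomorphic to the simple module F_alpha = C v_alpha. *)
Definition simple_module (alpha : seq nat) (V : vectType F) (M : hmodule V) :
    Prop :=
  \dim {: V} = 1%N /\
  forall (i : 'I_n.-1) (v : V),
    M (hecke_gen F i) v = if i.+1 \in comp_set alpha then 0 else v.

(* [qchar M f]: the quasisymmetric characteristic of M is f.  This is the
   smallest relation that sends F_alpha to the fundamental quasisymmetric
   function of alpha and is additive on short exact sequences; see [qchar_fun]
   for the uniqueness of f. *)
Inductive qchar : forall V : vectType F, hmodule V -> powser -> Prop :=
| QcharZero (V : vectType F) (M : hmodule V) :
    \dim {: V} = 0%N -> qchar M (fun=> 0)
| QcharSimple (V : vectType F) (M : hmodule V) alpha :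
    is_comp n alpha -> simple_module alpha M -> qchar M (fundamental alpha)
| QcharExact (V' V V'' : vectType F)
    (M' : hmodule V') (M : hmodule V) (M'' : hmodule V'')
    (i : 'Hom(V', V)) (p : 'Hom(V, V'')) f g :
    hmorphism M' M i -> hmorphism M M'' p ->
    lker i = 0%VS -> limg i = lker p -> limg p = fullv ->
    qchar M' f -> qchar M'' g -> qchar M (fun m => f m + g m).

End Modules.

Section QcharFun.
Variables (F : numFieldType) (n : nat).
Local Notation H := (hecke F n).

Definition ltrace (V : vectType F) (f : 'End(V)) : F :=
  \sum_(i < \dim {: V}) coord (vbasis {: V}) i (f (vbasis {: V})`_i).

Lemma ltraceC (V W : vectType F) (f : 'Hom(V, W)) (g : 'Hom(W, V)) :
  ltrace (g \o f)%VF = ltrace (f \o g)%VF.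
Proof.
have tE (V1 W1 : vectType F) (f1 : 'Hom(V1, W1)) (g1 : 'Hom(W1, V1)) :
    ltrace (g1 \o f1)%VF =
    \sum_(i < \dim {: V1}) \sum_(j < \dim {: W1})
      coord (vbasis {: W1}) j (f1 (vbasis {: V1})`_i) *
      coord (vbasis {: V1}) i (g1 (vbasis {: W1})`_j).
  apply: eq_bigr => i _; rewrite lfunE /=.
  rewrite {1}[f1 _](coord_vbasis (memvf _)) !linear_sum /=.
  by apply: eq_bigr => j _; rewrite !linearZ.
rewrite !tE exchange_big; apply: eq_bigr => j _; apply: eq_bigr => i _.
exact: mulrC.
Qed.

Lemma ltraceD (V : vectType F) (f g : 'End(V)) :
  ltrace (f + g) = ltrace f + ltrace g.
Proof.
by rewrite -big_split /=; apply: eq_bigr => i _; rewrite lfunE /= linearD.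
Qed.

Lemma ltraceZ1 (V : vectType F) (c : F) :
  ltrace (c *: \1%VF : 'End(V)) = c * (\dim {: V})%:R.
Proof.
rewrite /ltrace (eq_bigr (fun=> c)); first by rewrite sumr_const card_ord mulr_natr.
move=> i _; rewrite lfunE /= lfunE /= linearZ /= coord_free ?eqxx ?mulr1 //.
exact: basis_free (vbasisP _).
Qed.

Lemma ltrace_exact (V' V V'' : vectType F) (i : 'Hom(V', V)) (p : 'Hom(V, V''))
    (f' : 'End(V')) (f : 'End(V)) (f'' : 'End(V'')) :
  lker i = 0%VS -> limg i = lker p -> limg p = fullv ->
  (f \o i = i \o f')%VF -> (p \o f = f'' \o p)%VF ->
  ltrace f = ltrace f' + ltrace f''.
Proof.
move=> /eqP/lker0P injI ip pV fi pf.
pose s := (p^-1)%VF; pose t := (i^-1 \o (\1 - (s \o p)))%VF.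
have psE v : p (s v) = v by rewrite limg_lfunVK // pV memvf.
have ps : (p \o s = \1)%VF by apply/lfunP => v; rewrite !lfunE /= psE.
have qE v : (\1 - (s \o p))%VF v = v - s (p v).
  by rewrite add_lfunE opp_lfunE comp_lfunE id_lfunE.
have it : (i \o t = \1 - (s \o p))%VF.
  apply/lfunP => v; rewrite 2!comp_lfunE limg_lfunVK // ip memv_ker qE.
  by rewrite linearB /= psE subrr.
have ti : (t \o i = \1)%VF.
  apply/lfunP => v; apply: injI; rewrite comp_lfunE.
  rewrite -[LHS]comp_lfunE it qE id_lfunE.
  suff /eqP -> : p (i v) == 0 by rewrite linear0 subr0.
  by rewrite -memv_ker -ip memv_img ?memvf.
have -> : f = ((f \o (i \o t)) + ((f \o s) \o p))%VF.
  by rewrite it -comp_lfunA -comp_lfunDr subrK comp_lfun1r.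
rewrite ltraceD comp_lfunA ltraceC fi comp_lfunA ti comp_lfun1l; congr (_ + _).
by rewrite ltraceC comp_lfunA pf -comp_lfunA ps comp_lfun1r.
Qed.

(* The element acting on F_alpha by 1 if set(alpha) = A and by 0 otherwise. *)
Definition probe (A : {set 'I_n.-1}) : H :=
  \prod_(i < n.-1) (if i \in A then 1 - hecke_gen F i else hecke_gen F i).

Definition fundamental_set (A : {set 'I_n.-1}) : powser := fun m =>
  (count (fun w : seq nat => (size w == n) &&
     [forall i : 'I_n.-1, if i \in A then (nth 0 w i < nth 0 w i.+1)%N
                          else (nth 0 w i <= nth 0 w i.+1)%N])
   (permutations (monomial_word m)))%:Z.

Definition ord_set (alpha : seq nat) : {set 'I_n.-1} :=
  [set i : 'I_n.-1 | i.+1 \in comp_set alpha].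

Lemma fundamental_ord_set alpha m : is_comp n alpha ->
  fundamental alpha m = fundamental_set (ord_set alpha) m.
Proof.
case/andP => _ /eqP an; congr (_%:Z); apply: eq_count => w.
rewrite /F_seq an; congr (_ && _); apply/allP/forallP => [h i|h j].
  have := h i.+1; rewrite mem_iota /= add1n ltnS ltn_ord inE => /(_ isT).
  by [].
rewrite mem_iota add1n ltnS; case: j => // j /= ltjn.
by have := h (Ordinal ltjn); rewrite inE.
Qed.

Lemma probe_simple alpha (V : vectType F) (M : hmodule n V) A :
  simple_module alpha M -> ltrace (M (probe A)) = (A == ord_set alpha)%:R.
Proof.
case=> dimV Mg.
pose c (i : 'I_n.-1) : F := ((i \in A) == (i \in ord_set alpha))%:R.
have MB x y : M (x - y) = M x - M y.
  by rewrite addrC -scaleN1r hact_linear scaleN1r addrC.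
have Mc i : M (if i \in A then 1 - hecke_gen F i else hecke_gen F i) = c i *: \1%VF.
  have Mi : M (hecke_gen F i) = (i \notin ord_set alpha)%:R *: \1%VF.
    apply/lfunP => v; rewrite Mg !lfunE /= lfunE /= inE.
    by case: ifP; rewrite ?scale0r ?scale1r.
  rewrite /c; case: (i \in A); rewrite ?MB ?hact1 Mi.
    by case: (i \in _); rewrite /= ?scale0r ?scale1r ?subr0 ?subrr.
  by case: (i \in _).
have -> : M (probe A) = (\prod_i c i) *: \1%VF.
  rewrite /probe; elim/big_ind2: _ => [|a x b y hx hy|i _]; last exact: Mc.
    by rewrite hact1 scale1r.
  by rewrite hactM hx hy -comp_lfunZl -comp_lfunZr comp_lfun1l scalerA.
rewrite ltraceZ1 dimV mulr1; have [eqA|neqA] := eqVneq A (ord_set alpha).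
  by rewrite big1 // => i _; rewrite /c eqA eqxx.
have [i ci|eqA] := pickP (fun i => (i \in A) != (i \in ord_set alpha)).
  by rewrite (bigD1 i) //= /c (negbTE ci) mul0r.
by case/eqP: neqA; apply/setP => i; apply/eqP; rewrite -[_ == _]negbK eqA.
Qed.

Lemma qchar_trace (V : vectType F) (M : hmodule n V) f : qchar M f ->
  forall m, (f m)%:~R = \sum_A ltrace (M (probe A)) * (fundamental_set A m)%:~R.
Proof.
elim=> {V M f} [V M dim0 m|V M alpha calpha sM m|].
- rewrite big1 // => A _; rewrite /ltrace big1 ?mul0r // => i _.
  by have := ltn_ord i; rewrite {2}dim0.
- rewrite (bigD1 (ord_set alpha)) //= (probe_simple _ sM) eqxx mul1r.
  rewrite big1 ?addr0 ?fundamental_ord_set // => A neqA.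
  by rewrite (probe_simple _ sM) (negbTE neqA) mul0r.
move=> V' V V'' M' M M'' i p f g hi hp ki ip pV _ IHf _ IHg m.
rewrite intrD IHf IHg -big_split /=; apply: eq_bigr => A _.
rewrite -mulrDl -(ltrace_exact (f := M (probe A)) ki ip pV) //.
  by apply/lfunP => v; rewrite !comp_lfunE hi.
by apply/lfunP => v; rewrite !comp_lfunE hp.
Qed.

Theorem qchar_fun (V : vectType F) (M : hmodule n V) f g :
  qchar M f -> qchar M g -> f = g.
Proof.
move=> /qchar_trace hf /qchar_trace hg; apply/funext => m.
by apply: (@intr_inj F); rewrite hf hg.
Qed.

End QcharFun.

Section Yalpha.
Variables (F : fieldType) (n : nat) (alpha : seq nat).

Definition Yspace : vectType F := {ffun {s : 'S_n | s \in Kset n alpha} -> F^o}.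

(* The basis vector sigma if sigma is in K_alpha, and 0 otherwise. *)
Definition Yvec (s : 'S_n) : Yspace := [ffun t => (val t == s)%:R].

(* The values on the basis determine Y, since the generators generate H_n(0).
   The product [s * simple i] is s_i sigma in functional notation. *)
Definition is_Y (Y : hmodule n Yspace) : Prop :=
  forall (i : 'I_n.-1) (s : 'S_n), s \in Kset n alpha ->
    Y (hecke_gen F i) (Yvec s) =
      if DesL s i then Yvec s
      else if (s * simple i)%g \in Kset n alpha then Yvec (s * simple i)%g
      else 0.

End Yalpha.

(* Main.v *)
From HB Require Import structures.
Require Import Defs.
From mathcomp Require Import all_boot all_order all_algebra fingroup perm.
From mathcomp Require Import reals complex.
From mathcomp Require Import zify boolp finmap.
From mathcomp.multinomials Require Import monalg.

Set Implicit Arguments.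
Unset Strict Implicit.
Unset Printing Implicit Defensive.

(* Inserting a letter moves letters of the tableau towards the first column, one
   column at a time; each move is a crystal operator and preserves the number of
   letters that k decreasing chains can cover.  This gives Greene's theorem: the
   numbers of cells of P(w) in the first k columns count the letters of w covered
   by k decreasing subsequences.  It follows that sigma is in K_alpha if and only
   if w = sigma w_0 is a concatenation of increasing segments of prescribed
   lengths, each starting with a letter smaller than all the previous ones, such
   that certain subwords have enough letters covered by decreasing subsequences.
   These conditions survive when an inversion between two different segments is
   created.  Hence K_alpha is the difference of two upper sets of the left weak
   order, and the 0-Hecke action on S_n induces Y_alpha.  The poset K_alpha has
   one source, from which every element is reached, and which is the only element
   of K_alpha whose descent set contains that of the source: so Y_alpha is cyclic
   and indecomposable.  Ordering K_alpha by inversions gives a composition series,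
   and P is a bijection from K_alpha to SYCT(alpha), since w can be recovered from
   the columns of the letters in P(w) and from the columns of the new cells; it
   preserves descents because each move does. *)

(** * Letters covered by decreasing chains *)

(** The obstacle is that equality of shapes is not visibly stable when letters of a word are
    exchanged: a shape bounds the covers by decreasing subsequences from both sides, and only lower
    bounds survive the creation of inversions. Together with the shape, the recording condition
    makes each segment x0 y fill a new bottom row. This is compared with the insertion of y without
    x0: once x0 is below the previous letters and x0 y increases, the shape is right exactly when no
    letter of y lands in column |y| or beyond (columns from 0). That is one lower bound on a
    truncated sum of row lengths, to which Greene's theorem applies. The scan may swap several
    letters within one column, but the set of letters of each column, the carried one included,
    changes only when the carried letter passes to the next column. So insertion is followed on
    columns alone, and rows come back at the end, since the columns of the letters determine a
    tableau. Before a letter is inserted its position serves as its column, so that a word and its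
    tableau are the two ends of one sequence of moves. *)

Definition upd (col : nat -> nat) (y d v : nat) := if v == y then d else col v.

(* A map [col] sends each letter to a column.  The letters of one colour below k
   form a chain: their columns weakly decrease as the letters increase.  For the
   positions of the letters in a word, chains are decreasing subsequences. *)
Definition colorable (V : seq nat) (col : nat -> nat) (k N : nat) : Prop :=
  exists f : nat -> nat,
    (forall u v, u \in V -> v \in V -> f u = f v -> f u < k -> v < u ->
       col u <= col v) /\
    N <= count (fun v => f v < k) V.

(* Given colours [gL] of the letters in the columns before d and [gR] of those
   after d.+1, the letters in the column d, or d.+1, that can be added to some
   colour; [tau i] separates, in the colour i, the columns up to d from those
   after d, so that the choices for different letters are independent. *)
Section Thresholds.
Variables (V : seq nat) (k d : nat).
Implicit Types (col gL gR tau : nat -> nat) (i v : nat).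

Definition left_cover col gL tau i v :=
  (tau i <= v) && all (fun u => (col u < d) && (gL u == i) ==> (v < u)) V.

Definition right_cover col gR tau i v :=
  (v < tau i) && all (fun u => (d.+1 < col u) && (gR u == i) ==> (u < v)) V.

Definition covered col gL gR tau v :=
  if col v < d then gL v < k else
  if d.+1 < col v then gR v < k else
  if col v == d then has (left_cover col gL tau ^~ v) (iota 0 k)
  else has (right_cover col gR tau ^~ v) (iota 0 k).

Lemma covered_left col gL gR tau v : col v = d ->
  covered col gL gR tau v = has (left_cover col gL tau ^~ v) (iota 0 k).
Proof. by move=> cv; rewrite /covered cv ltnn eqxx; case: ifP; lia. Qed.

Lemma covered_right col gL gR tau v : col v = d.+1 ->
  covered col gL gR tau v = has (right_cover col gR tau ^~ v) (iota 0 k).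
Proof. by move=> cv; rewrite /covered cv; do 3 (case: ifP; first by lia). Qed.

Lemma find_iota (p : pred nat) : has p (iota 0 k) -> p (find p (iota 0 k)).
Proof.
move=> hp; have := nth_find 0 hp; rewrite nth_iota //.
by move: hp; rewrite has_find size_iota.
Qed.

(** Letters to the right of the threshold lie below [tau i] and those to the left at or above it, so
    a pair of one colour separated by the threshold is always in chain order. Letters sharing a
    column never conflict. *)
Lemma colorable_covered col gL gR tau :
    (forall u v, u \in V -> v \in V -> col u < d -> col v < d ->
       gL u = gL v -> gL u < k -> v < u -> col u <= col v) ->
    (forall u v, u \in V -> v \in V -> d.+1 < col u -> d.+1 < col v ->
       gR u = gR v -> gR u < k -> v < u -> col u <= col v) ->
    (forall u, u \in V -> col u < d -> gL u < k -> tau (gL u) <= u) ->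
    (forall u, u \in V -> d.+1 < col u -> gR u < k -> u < tau (gR u)) ->
  colorable V col k (count (covered col gL gR tau) V).
Proof.
move=> vL vR tL tR.
pose h v := if col v < d then gL v else if d.+1 < col v then gR v else
  if col v == d then find (left_cover col gL tau ^~ v) (iota 0 k)
  else find (right_cover col gR tau ^~ v) (iota 0 k).
have hk v : (h v < k) = covered col gL gR tau v.
  rewrite /h /covered; case: ifP => // _; case: ifP => // _.
  by case: ifP => _; rewrite has_find size_iota.
exists h; split; last by rewrite (eq_count hk).
move=> u v uV vV huv; rewrite {1}huv => hvk vu.
rewrite leqNgt; apply/negP => cvu.
have huk : h u < k by rewrite huv.
have cL w : d <= col w -> col w <= d -> h w < k -> left_cover col gL tau (h w) w.
  move=> w1 w2; rewrite hk /covered /h (leq_gtF w1) (leq_gtF (leqW w2)).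
  have -> : col w == d by rewrite eqn_leq w1 w2.
  exact: find_iota.
have cR w : d < col w -> col w <= d.+1 -> h w < k -> right_cover col gR tau (h w) w.
  move=> w1 w2; rewrite hk /covered /h (leq_gtF (ltnW w1)) (leq_gtF w2).
  have -> : (col w == d) = false by apply/negbTE; rewrite neq_ltn w1 orbT.
  exact: find_iota.
have hL w : col w < d -> h w = gL w by rewrite /h => ->.
have hR w : d.+1 < col w -> h w = gR w.
  by move=> w1; rewrite /h w1 (leq_gtF (ltnW (ltnW w1))).
have tauge : col v <= d -> tau (h v) <= v.
  move=> cv; case: (ltnP (col v) d) => [cv'|cv'].
    by rewrite hL // tL // -hL.
  by case/andP: (cL v cv' cv hvk).
have taulr : d < col u -> u < tau (h u).
  move=> cu; case: (ltnP d.+1 (col u)) => [cu'|cu'].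
    by rewrite hR // tR // -hR.
  by case/andP: (cR u cu cu' huk).
case: (leqP (col v) d) => cv; last first.
  have cu : d.+1 < col u by apply: leq_ltn_trans cvu.
  case: (ltnP d.+1 (col v)) => cv'.
    by have := vR u v uV vV cu cv'; rewrite -!hR // huv => /(_ erefl hvk vu); lia.
  case/andP: (cR v cv cv' hvk) => _ /allP/(_ _ uV).
  by rewrite cu -hR // huv eqxx /=; lia.
case: (ltnP d (col u)) => cu.
  by have := taulr cu; rewrite huv; have := tauge cv; lia.
have cv' : col v < d by apply: leq_trans cu.
case: (ltnP (col u) d) => cu'.
  by have := vL u v uV vV cu' cv'; rewrite -!hL // huv => /(_ erefl hvk vu); lia.
case/andP: (cL u cu' cu huk) => _ /allP/(_ _ vV).
by rewrite cv' -hL // huv eqxx /=; lia.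
Qed.

End Thresholds.

(** Outside [I] nothing is lost; inside, at most the letters of [B] are given up and all those of
    [A] are gained. *)
Lemma count_exchange (V : seq nat) (I A B P P' : pred nat) :
    (forall v, v \in V -> ~~ I v -> P v -> P' v) ->
    (forall v, v \in V -> I v -> P v -> B v) ->
    (forall v, v \in V -> I v -> A v -> P' v) ->
    count (fun v => I v && B v) V <= count (fun v => I v && A v) V ->
  count P V <= count P' V.
Proof.
move=> hout hB hA hBA.
have split (Q : pred nat) :
    count Q V = count (fun v => I v && Q v) V + count (fun v => ~~ I v && Q v) V.
  by rewrite -size_filter -(count_predC I) !count_filter.
have sub (Q Q' : pred nat) : (forall v, v \in V -> Q v -> Q' v) -> count Q V <= count Q' V.
  move=> QQ'; rewrite -(@eq_in_count _ (predI Q Q')) => [|v vV /=].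
    by apply: sub_count => v /andP[].
  by case: (boolP (Q v)) => // /(QQ' _ vV) ->.
rewrite (split P) (split P'); apply: leq_add.
  apply: leq_trans (sub _ (fun v => I v && B v) _) _.
    by move=> v vV /andP[iv pv]; rewrite iv hB.
  apply: leq_trans hBA (sub _ _ _) => v vV /andP[iv av]; by rewrite iv hA.
by apply: sub => v vV /andP[iv pv]; rewrite iv hout.
Qed.

Lemma bigmaxS_ltn (V : seq nat) (p : pred nat) v :
  v \in V -> p v -> v < \max_(u <- V | p u) u.+1.
Proof. by move=> vV pv; rewrite (big_rem v) //= pv leq_max leqnn. Qed.

Lemma bigmaxS_leq (V : seq nat) (p : pred nat) m :
  (forall u, u \in V -> p u -> u < m) -> \max_(u <- V | p u) u.+1 <= m.
Proof. by move=> h; apply/bigmax_leqP_seq => u uV pu; apply: h. Qed.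

Lemma colorable_leq V col k N N' : N' <= N -> colorable V col k N -> colorable V col k N'.
Proof. by move=> NN' [f [h1 h2]]; exists f; split=> //; apply: leq_trans h2. Qed.

(* The ballot condition holds for the rightmost letter y of the column d.+1 that is
   unmatched when the columns d and d.+1 are bracketed: moving this letter is a
   crystal operator. *)
Lemma colorable_move (V : seq nat) (col : nat -> nat) (y d k N : nat) :
    y \in V -> col y = d.+1 ->
    (forall z, count (fun v => (y < v <= z) && (col v == d.+1)) V <=
               count (fun v => (y < v <= z) && (col v == d)) V) ->
  colorable V col k N -> colorable V (upd col y d) k N.
Proof.
move=> yV cy ballot [f [fP fN]].
(* The successor makes the bound strict, and a colour with no letter beyond column d gets the
   threshold 0. *)
pose tau i := \max_(v <- V | (f v == i) && (d < col v)) v.+1.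
have tauP v : v \in V -> d < col v -> v < tau (f v).
  by move=> vV cv; apply: bigmaxS_ltn => //; rewrite eqxx.
have tauL u : u \in V -> col u <= d -> f u < k -> tau (f u) <= u.
  move=> uV cu fu; apply: bigmaxS_leq => v vV /andP[/eqP fv cv].
  case: (ltngtP v u) => // [uv|vu]; last by move: cu; rewrite -vu; lia.
  by have := fP v u vV uV fv; rewrite fv => /(_ fu uv); lia.
set col' := upd col y d.
have c'E v : v != y -> col' v = col v by rewrite /col' /upd => /negbTE ->.
have c'y : col' y = d by rewrite /col' /upd eqxx.
pose P := covered V k d col f f tau.
have NP : N <= count P V.
  apply: leq_trans fN _; rewrite leqNgt; apply/negP => lt.
  have : count (fun v => f v < k) V <= count P V; last by rewrite leqNgt lt.
  apply: (@count_exchange _ xpred0 xpred0 xpred0) => //.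
  move=> v vV _ fv; rewrite /P /covered.
  case: ltnP => // c1; case: ltnP => // c2; case: eqP => c3; apply/hasP; exists (f v).
  - by rewrite mem_iota.
  - apply/andP; split; first by apply: tauL => //; rewrite c3.
    apply/allP => u uV; apply/implyP => /andP[cu /eqP fu].
    by case: (ltngtP u v) => // [uv|uv]; 
      [have := fP v u vV uV (esym fu) fv uv; lia | move: cu; rewrite uv; lia].
  - by rewrite mem_iota.
  have cv : col v = d.+1 by lia.
  apply/andP; split; first by apply: tauP => //; rewrite cv.
  apply/allP => u uV; apply/implyP => /andP[cu /eqP fu].
  by case: (ltngtP u v) => // [uv|uv]; 
    [have := fP u v uV vV fu; rewrite fu => /(_ fv uv); lia | move: cu; rewrite uv; lia].
(* It suffices to find new colours for the left elements and new thresholds. *)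
have fin (gL tau' : nat -> nat) (m : nat) :
    (forall u v, u \in V -> v \in V -> col u < d -> col v < d ->
       gL u = gL v -> gL u < k -> v < u -> col u <= col v) ->
    (forall u, u \in V -> col u < d -> gL u < k -> tau' (gL u) <= u) ->
    (forall u, u \in V -> d.+1 < col u -> f u < k -> u < tau' (f u)) ->
    (forall v, (gL v < k) = (f v < k)) ->
    (P y -> has (left_cover V d col' gL tau' ^~ y) (iota 0 k)) ->
    (forall a, a \in V -> col a = d -> y < a < m -> 
       ~~ has (left_cover V d col f tau ^~ a) (iota 0 k) /\
       has (left_cover V d col' gL tau' ^~ a) (iota 0 k)) ->
    (forall a, a \in V -> a != y -> col a = d -> ~~ (y < a < m) -> 
       has (left_cover V d col f tau ^~ a) (iota 0 k) ->
       has (left_cover V d col' gL tau' ^~ a) (iota 0 k)) ->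
    (forall b, b \in V -> b != y -> col b = d.+1 -> ~~ (y < b < m) -> 
       has (right_cover V d col f tau ^~ b) (iota 0 k) ->
       has (right_cover V d col' f tau' ^~ b) (iota 0 k)) ->
    colorable V col' k N.
  move=> h1 h2 h3 h4 h5 h6 h7 h8.
  apply: colorable_leq (NP) _.
  apply: (@colorable_leq _ _ _ (count (covered V k d col' gL f tau') V)).
    apply: (@count_exchange _ (fun v => (y < v <= m.-1) && ((col v == d) || (col v == d.+1)))
              (fun v => col v == d) (fun v => col v == d.+1)).
    - move=> v vV nI; rewrite /P /covered.
      have [->|vy] := eqVneq v y.
        by rewrite -/(covered V k d col' gL f tau' y) covered_left //; apply: h5.
      rewrite c'E // h4; case: ltnP => // c1; case: ltnP => // c2.
      case: eqP => c3; first by apply: h7 => //; move: nI; rewrite c3 eqxx andbT; clear; lia.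
      have cv : col v = d.+1 by lia.
      apply: h8 => //; move: nI; rewrite cv eqxx orbT andbT; clear; lia.
    - move=> v vV /andP[v1 cv]; have [//|cv'] := eqVneq (col v) d.+1.
      have {}cv : col v = d by move: cv v1; lia.
      rewrite /P covered_left //.
      have ym : y < v < m by lia.
      by have [/negbTE -> //] := h6 v vV cv ym.
    - move=> v vV /andP[v1 _] cv; rewrite covered_left; last by rewrite c'E ?(eqP cv) //; lia.
      have ym : y < v < m by lia.
      by have [] := h6 v vV (eqP cv) ym.
    apply: leq_trans (leq_trans (ballot m.-1) _); apply: sub_count => v /=; lia.
  apply: colorable_covered => //.
  - move=> u v uV vV; rewrite /col' /upd; case: eqP => [_|_]; first by rewrite ltnn.
    by case: eqP => [_|_]; [rewrite ltnn | apply: h1].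
  - move=> u v uV vV; rewrite /col' /upd; case: eqP => [_|_]; first by lia.
    by case: eqP => [_|_]; [lia | move=> _ _; apply: fP].
  - by move=> u uV; rewrite /col' /upd; case: eqP => [_|_]; [rewrite ltnn | apply: h2].
  - by move=> u uV; rewrite /col' /upd; case: eqP => [_|_]; [lia | apply: h3].
have lc' gL t i v : left_cover V d col' gL t i v = left_cover V d col gL t i v.
  congr (_ && _); apply: eq_in_all => u uV; rewrite /col' /upd.
  by case: eqP => // ->; rewrite ltnn cy; have -> : (d.+1 < d) = false by lia.
have rc' t i v : right_cover V d col' f t i v = right_cover V d col f t i v.
  congr (_ && _); apply: eq_in_all => u uV; rewrite /col' /upd.
  by case: eqP => // ->; rewrite cy ltnn; have -> : (d.+1 < d) = false by lia.
have fL u v : u \in V -> v \in V -> col u < d -> col v < d ->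
    f u = f v -> f u < k -> v < u -> col u <= col v by move=> ? ? _ _; apply: fP.
have P1 u : u \in V -> col u < d -> f u < k -> tau (f u) <= u.
  by move=> uV cu; apply: tauL => //; apply: ltnW.
have P2 u : u \in V -> d.+1 < col u -> f u < k -> u < tau (f u).
  by move=> uV cu _; apply: tauP => //; apply: ltnW.
(* If some colour admits [y] as a letter of column d, nothing else need change. Otherwise every
   colour that could contain [y] has its threshold above [y]. *)
have [Lc|nLc] := boolP (has (left_cover V d col f tau ^~ y) (iota 0 k)).
  apply: (fin f tau 0) => //.
  - by move=> _; rewrite (eq_has (lc' f tau ^~ y)).
  - by move=> a _ _ /andP[_]; rewrite ltn0.
  - by move=> a aV _ _ _; rewrite (eq_has (lc' f tau ^~ a)).
  - by move=> a aV _ _ _; rewrite (eq_has (rc' tau ^~ a)).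
have [Py|nPy] := boolP (P y); last first.
  apply: (fin f tau 0) => //; first by rewrite (negbTE nPy).
  - by move=> a _ _ /andP[_]; rewrite ltn0.
  - by move=> a aV _ _ _; rewrite (eq_has (lc' f tau ^~ a)).
  - by move=> a aV _ _ _; rewrite (eq_has (rc' tau ^~ a)).
(* [free i] : colour i could contain y. *)
pose free i := all (fun u => (col u < d) && (f u == i) ==> (y < u)) V &&
               all (fun u => (d.+1 < col u) && (f u == i) ==> (u < y)) V.
have freetau i : i < k -> free i -> y < tau i.
  move=> ik /andP[h1 _]; rewrite ltnNge; apply: contra nLc => h.
  by apply/hasP; exists i; rewrite ?mem_iota // /left_cover h.
have exfree : exists i, (i < k) && free i.
  move: Py; rewrite /P covered_right //.
  case/hasP => i; rewrite mem_iota /= => ik /andP[h1 h2]; exists i; rewrite ik /free h2 andbT.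
  apply/allP => u uV; apply/implyP => /andP[cu /eqP fu].
  by apply: leq_trans h1 _; rewrite -fu; apply: P1; rewrite ?fu.
(* Lowering the threshold of [i0] to [y] makes room for [y] in column d. As [tau i0] is minimal, any
   other free colour can take over the letters of column d.+1 above [y] that [i0] then gives up. *)
have [i0 /andP[i0k f0] i0min] : exists2 i, (i < k) && free i &
    forall j, j < k -> free j -> tau i <= tau j.
  case: exfree => i Hi; have exn : exists n, has (fun j => free j && (tau j == n)) (iota 0 k).
    by case/andP: Hi => ik fi; exists (tau i); apply/hasP; exists i; rewrite ?mem_iota ?fi ?eqxx.
  have [n /hasP[j]] := ex_minnP exn; rewrite mem_iota /= => jk /andP[fj /eqP tj] nmin.
  exists j; first by rewrite jk.
  move=> l lk fl; rewrite tj; apply: nmin; apply/hasP; exists l; first by rewrite mem_iota.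
  by rewrite fl eqxx.
have y0 := freetau i0 i0k f0.
have [/allP L0 /allP R0] := andP f0.
have {}L0 u : u \in V -> col u < d -> f u = i0 -> y < u.
  by move=> uV cu fu; have := L0 u uV; rewrite cu fu eqxx.
have {}R0 u : u \in V -> d.+1 < col u -> f u = i0 -> u < y.
  by move=> uV cu fu; have := R0 u uV; rewrite cu fu eqxx.
have lcP gL t v : reflect
      (exists2 i, i < k & t i <= v /\ forall u, u \in V -> col u < d -> gL u = i -> v < u)
      (has (left_cover V d col' gL t ^~ v) (iota 0 k)).
  rewrite (eq_has (lc' gL t ^~ v)); apply: (iffP hasP) => [[ i]|[i ik [h1 h2]]].
    rewrite mem_iota /= => ik /andP[h1 /allP h2]; exists i => //; split=> // u uV cu gu.
    by have := h2 u uV; rewrite cu gu eqxx.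
  exists i; rewrite ?mem_iota // /left_cover h1; apply/allP => u uV.
  by apply/implyP => /andP[cu /eqP gu]; apply: h2.
have lcP0 v : reflect
      (exists2 i, i < k & tau i <= v /\ forall u, u \in V -> col u < d -> f u = i -> v < u)
      (has (left_cover V d col f tau ^~ v) (iota 0 k)).
  by rewrite -(eq_has (lc' f tau ^~ v)); apply: lcP.
have rcP t v : reflect
      (exists2 i, i < k & v < t i /\ forall u, u \in V -> d.+1 < col u -> f u = i -> u < v)
      (has (right_cover V d col' f t ^~ v) (iota 0 k)).
  rewrite (eq_has (rc' t ^~ v)); apply: (iffP hasP) => [[ i]|[i ik [h1 h2]]].
    rewrite mem_iota /= => ik /andP[h1 /allP h2]; exists i => //; split=> // u uV cu gu.
    by have := h2 u uV; rewrite cu gu eqxx.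
  exists i; rewrite ?mem_iota // /right_cover h1; apply/allP => u uV.
  by apply/implyP => /andP[cu /eqP gu]; apply: h2.
have rcP0 v : reflect
      (exists2 i, i < k & v < tau i /\ forall u, u \in V -> d.+1 < col u -> f u = i -> u < v)
      (has (right_cover V d col f tau ^~ v) (iota 0 k)).
  by rewrite -(eq_has (rc' tau ^~ v)); apply: rcP.
have t0L u : u \in V -> col u < d -> f u = i0 -> tau i0 <= u.
  by move=> uV cu fu; rewrite -fu; apply: P1; rewrite ?fu.
have [[i1 /andP[i1k f1] i10]|uniq0] :
    (exists2 i, (i < k) && free i & i != i0) \/ (forall i, i < k -> i != i0 -> ~~ free i).
  have [/hasP[ i]|/hasPn h] := boolP (has (fun i => free i && (i != i0)) (iota 0 k)).
    by rewrite mem_iota /= => ik /andP[fi ii0]; left; exists i; rewrite ?ik.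
  right=> i ik ii0; apply/negP => fi; have := h i; rewrite mem_iota ik fi ii0 => /(_ isT).
  by [].
- have := i0min i1 i1k f1 => tt.
  have [/allP L1 /allP R1] := andP f1.
  pose tau' i := if i == i0 then y else tau i.
  apply: (fin f tau' 0) => //.
  - by move=> u uV cu fu; rewrite /tau'; case: eqP => [/(L0 u uV cu)/ltnW //|_]; apply: P1.
  - by move=> u uV cu fu; rewrite /tau'; case: eqP => [/(R0 u uV cu) //|_]; apply: P2.
  - by move=> _; apply/lcP; exists i0; rewrite // /tau' eqxx; split.
  - by move=> a _ _ /andP[_]; rewrite ltn0.
  - move=> a aV ay ca _ /lcP0[i ik [h1 h2]]; apply/lcP; exists i => //; rewrite /tau'.
    by split=> //; case: eqP h1 => // ->; lia.
  - move=> b bV by' cb _ /rcP0[i ik [h1 h2]]; apply/rcP.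
    have [bly|ybl] := leqP b y.
      by exists i => //; rewrite /tau'; split=> //; case: eqP => // _; lia.
    have [ii0|ii0] := eqVneq i i0.
      exists i1 => //; rewrite /tau' (negbTE i10); split; first by move: h1; rewrite ii0; lia.
      by move=> u uV cu fu; have := R1 u uV; rewrite cu fu eqxx /=; lia.
    by exists i => //; rewrite /tau' (negbTE ii0).
(* [rho j] bounds the right elements of colour j. *)
pose rho j := \max_(v <- V | (f v == j) && (d.+1 < col v)) v.+1.
have rhoP v : v \in V -> d.+1 < col v -> v < rho (f v).
  by move=> vV cv; apply: bigmaxS_ltn => //; rewrite eqxx.
have rhotau j : rho j <= tau j.
  apply: bigmaxS_leq => v vV /andP[/eqP <- cv]; exact: tauP (ltnW cv).
have nfree i a : i < k -> i != i0 -> rho i <= y.+1 -> y < a ->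
    (forall u, u \in V -> col u < d -> f u = i -> a < u) -> False.
  move=> ik ii0 ri ya h; case/negP: (uniq0 i ik ii0); apply/andP; split.
    apply/allP => u uV; apply/implyP => /andP[cu /eqP fu].
    by apply: ltn_trans (h u uV cu fu).
  apply/allP => u uV; apply/implyP => /andP[cu /eqP fu].
  have := rhoP u uV cu; rewrite fu => h1.
  have : u != y by apply: contraTneq cu => ->; rewrite cy ltnn.
  by lia.
have [small|[j [jk ji0 rj jt jmin]]] :
    (forall j, j < k -> j != i0 -> y.+1 < rho j -> tau i0 <= rho j) \/
    (exists j, [/\ j < k, j != i0, y.+1 < rho j, rho j < tau i0 &
       forall l, l < k -> l != i0 -> y.+1 < rho l -> rho j <= rho l]).
  pose q j := [&& j != i0, y.+1 < rho j & rho j < tau i0].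
  have [hq|nq] := boolP (has q (iota 0 k)); last first.
    left=> j jk ji0 rj; rewrite leqNgt; apply: contra nq => rt.
    by apply/hasP; exists j; rewrite ?mem_iota // /q ji0 rj.
  have exn : exists n, has (fun j => q j && (rho j == n)) (iota 0 k).
    case/hasP: hq => j jk qj; exists (rho j); apply/hasP.
    by exists j => //; rewrite qj eqxx.
  have [n /hasP[j]] := ex_minnP exn.
  rewrite mem_iota /= => jk /andP[/and3P[ji0 rj jt] /eqP tj] nmin.
  right; exists j; split=> // l lk li0 rl; case: (ltnP (rho l) (tau i0)) => [rlt|]; last by lia.
  rewrite tj; apply: nmin; apply/hasP; exists l; first by rewrite mem_iota.
  by rewrite /q li0 rl rlt eqxx.
- pose tau' i := if i == i0 then y else tau i.
  apply: (fin f tau' (tau i0)) => //.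
  - by move=> u uV cu fu; rewrite /tau'; case: eqP => [/(L0 u uV cu)/ltnW //|_]; apply: P1.
  - by move=> u uV cu fu; rewrite /tau'; case: eqP => [/(R0 u uV cu) //|_]; apply: P2.
  - by move=> _; apply/lcP; exists i0; rewrite // /tau' eqxx; split.
  - move=> a aV ca /andP[ya at0]; split.
      apply/lcP0 => -[i ik [h1 h2]]; have [ii0|ii0] := eqVneq i i0.
        by move: h1; rewrite ii0; lia.
      apply: (nfree i a ik ii0 _ ya h2); rewrite leqNgt; apply/negP => ri.
      by have := small i ik ii0 ri; have := rhotau i; lia.
    apply/lcP; exists i0 => //; rewrite /tau' eqxx; split; first exact: ltnW.
    by move=> u uV cu fu; have := t0L u uV cu fu; lia.
  - move=> a aV ay ca _ /lcP0[i ik [h1 h2]]; apply/lcP; exists i => //; rewrite /tau'.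
    by split=> //; case: eqP h1 => // ->; lia.
  - move=> b bV by' cb nI /rcP0[i ik [h1 h2]]; apply/rcP.
    exists i => //; rewrite /tau'; split=> //; case: eqP h1 => // ->; lia.
have ytj : y < tau j by have := rhotau j; lia.
have jfree a : (forall u, u \in V -> col u < d -> f u = i0 -> tau i0 <= u) ->
    y < a < rho j -> ~~ has (left_cover V d col f tau ^~ a) (iota 0 k).
  move=> _ /andP[ya aj]; apply/lcP0 => -[i ik [h1 h2]]; have [ii0|ii0] := eqVneq i i0.
    by move: h1; rewrite ii0; lia.
  apply: (nfree i a ik ii0 _ ya h2); rewrite leqNgt; apply/negP => ri.
  by have := jmin i ik ii0 ri; have := rhotau i; lia.
have Lj u : u \in V -> col u < d -> f u = j -> tau j <= u.
  by move=> uV cu fu; rewrite -fu; apply: P1; rewrite ?fu.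
have Rj u : u \in V -> d.+1 < col u -> f u = j -> u < rho j.
  by move=> uV cu <-; apply: rhoP.
have [jleft|] := boolP (all (fun u => (col u < d) && (f u == j) ==> (tau i0 <= u)) V).
- have {}jleft u : u \in V -> col u < d -> f u = j -> tau i0 <= u.
    by move=> uV cu fu; have /allP/(_ u uV) := jleft; rewrite cu fu eqxx.
  (* The letters of column d.+1 from [rho j] up to [tau i0] that [i0] gives up go to colour [j],
     whose right part ends below [rho j]. This raises the threshold of [j] to [tau i0] at least,
     which [jleft] allows. *)
  pose tau' i := if i == i0 then y else if i == j then maxn (tau i0) (tau j) else tau i.
  have t'j : tau' j = maxn (tau i0) (tau j) by rewrite /tau' (negbTE ji0) eqxx.
  have t'0 : tau' i0 = y by rewrite /tau' eqxx.
  have t'i i : i != i0 -> i != j -> tau' i = tau i by rewrite /tau' => /negbTE -> /negbTE ->.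
  have cov0 a : y < a < tau i0 -> has (left_cover V d col' f tau' ^~ a) (iota 0 k).
    move=> /andP[ya at0]; apply/lcP; exists i0 => //; rewrite t'0; split; first exact: ltnW.
    by move=> u uV cu fu; have := t0L u uV cu fu; lia.
  apply: (fin f tau' (rho j)) => //.
  - move=> u uV cu fu; have := P1 u uV cu fu.
    have [/eqP fi|fi] := boolP (f u == i0); first by rewrite fi t'0 => _; apply/ltnW/L0.
    have [/eqP fj|fj] := boolP (f u == j); last by rewrite t'i.
    by rewrite fj t'j geq_max (jleft u uV cu fj).
  - move=> u uV cu fu; have := P2 u uV cu fu.
    have [/eqP fi|fi] := boolP (f u == i0); first by rewrite fi t'0 => _; apply/R0.
    have [/eqP fj|fj] := boolP (f u == j); last by rewrite t'i.
    by rewrite fj t'j; lia.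
  - by move=> _; apply/lcP; exists i0; rewrite // t'0; split.
  - by move=> a aV ca yaj; split; [exact: jfree | apply: cov0; lia].
  - move=> a aV ay ca nI /lcP0[i ik [h1 h2]].
    have [ii0|ii0] := eqVneq i i0.
      by apply/lcP; exists i0; rewrite // t'0; split; [rewrite ii0 in h1; lia | rewrite -ii0].
    have [ij|ij] := eqVneq i j; last by apply/lcP; exists i => //; rewrite t'i.
    rewrite ij in h1 h2.
    have [at0|t0a] := ltnP a (tau i0); first by apply: cov0; lia.
    by apply/lcP; exists j => //; rewrite t'j; split=> //; lia.
  - move=> b bV by' cb nI /rcP0[i ik [h1 h2]]; apply/rcP.
    have [ii0|ii0] := eqVneq i i0.
      have [bly|ylb] := ltnP b y; first by exists i0; rewrite // t'0; split=> //; rewrite -ii0.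
      exists j => //; rewrite t'j; rewrite ii0 in h1; split; first by lia.
      by move=> u uV cu fu; have := Rj u uV cu fu; lia.
    have [ij|ij] := eqVneq i j; last by exists i => //; rewrite t'i.
    by exists j => //; rewrite t'j; rewrite ij in h1 h2; split=> //; lia.
(* The left parts of the chains [i0] and [j] are exchanged. *)
rewrite -has_predC => /hasP[u0 u0V]; rewrite /= negb_imply => /andP[/andP[cu0 /eqP fu0] u0t].
pose sw i := if i == i0 then j else if i == j then i0 else i.
have swK : involutive sw.
  move=> i; rewrite /sw; case: (eqVneq i i0) => [->|ii0].
    by rewrite (negbTE ji0) eqxx.
  case: (eqVneq i j) => [->|ij]; first by rewrite eqxx.
  by rewrite (negbTE ii0) (negbTE ij).
have sw0 : sw i0 = j by rewrite /sw eqxx.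
have swj : sw j = i0 by rewrite /sw (negbTE ji0) eqxx.
have swi i : i != i0 -> i != j -> sw i = i by rewrite /sw => /negbTE -> /negbTE ->.
have swk i : (sw i < k) = (i < k).
  by rewrite /sw; case: eqP => [->|_]; [lia | case: eqP => [->|//]; lia].
pose gL v := sw (f v).
have gLE u i : (gL u = i) <-> (f u = sw i) by rewrite /gL; split=> [<-|->]; rewrite swK.
pose tau' i := if i == i0 then y else if i == j then tau i0 else tau i.
have t'j : tau' j = tau i0 by rewrite /tau' (negbTE ji0) eqxx.
have t'0 : tau' i0 = y by rewrite /tau' eqxx.
have t'i i : i != i0 -> i != j -> tau' i = tau i by rewrite /tau' => /negbTE -> /negbTE ->.
have tj0 : tau j < tau i0 by have := Lj u0 u0V cu0 fu0; lia.
apply: (fin gL tau' (rho j)) => //.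
- by move=> u v uV vV cu cv /(can_inj swK) fuv; rewrite /gL swk; apply: fL.
- move=> u uV cu; rewrite /gL swk => fu; have := P1 u uV cu fu.
  have [/eqP fi|fi] := boolP (f u == i0); first by rewrite fi sw0 t'j.
  have [/eqP fj|fj] := boolP (f u == j); last by rewrite swi // t'i.
  by rewrite fj swj t'0; lia.
- move=> u uV cu fu; have := P2 u uV cu fu.
  have [/eqP fi|fi] := boolP (f u == i0); first by rewrite fi t'0 => _; apply/R0.
  have [/eqP fj|fj] := boolP (f u == j); last by rewrite t'i.
  by rewrite fj t'j; lia.
- by move=> v; rewrite /gL swk.
- move=> _; apply/lcP; exists i0; rewrite // t'0; split=> // u uV cu /gLE; rewrite sw0 => fu.
  by have := Lj u uV cu fu; lia.
- move=> a aV ca yaj; split; first exact: jfree.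
  apply/lcP; exists i0; rewrite // t'0; split; first by lia.
  move=> u uV cu /gLE; rewrite sw0 => fu.
  by have := Lj u uV cu fu; have := rhotau j; lia.
- move=> a aV ay ca nI /lcP0[i ik [h1 h2]]; apply/lcP.
  have [ii0|ii0] := eqVneq i i0.
    exists j; rewrite // t'j; split; first by rewrite -ii0.
    by move=> u uV cu /gLE; rewrite swj -ii0; apply: h2.
  have [ij|ij] := eqVneq i j.
    exists i0; rewrite // t'0; split; first by move: h1; rewrite ij; lia.
    by move=> u uV cu /gLE; rewrite sw0 -ij; apply: h2.
  exists i => //; rewrite t'i //; split=> // u uV cu /gLE; rewrite swi //; exact: h2.
- move=> b bV by' cb nI /rcP0[i ik [h1 h2]]; apply/rcP.
  have [ii0|ii0] := eqVneq i i0.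
    have [bly|ylb] := ltnP b y; first by exists i0; rewrite // t'0; split=> //; rewrite -ii0.
    exists j => //; rewrite t'j; rewrite ii0 in h1; split=> //.
    by move=> u uV cu fu; have := Rj u uV cu fu; lia.
  have [ij|ij] := eqVneq i j; last by exists i => //; rewrite t'i.
  by exists j => //; rewrite t'j; rewrite ij in h1 h2; split=> //; lia.
Qed.

Lemma eq_in_colorable V col col' k N : {in V, col =1 col'} ->
  colorable V col k N -> colorable V col' k N.
Proof.
move=> e [f [h1 h2]]; exists f; split=> // u v uV vV fuv fk vu.
by rewrite -!e //; apply: h1.
Qed.

Lemma eq_mem_colorable V V' col k N : perm_eq V V' ->
  colorable V col k N -> colorable V' col k N.
Proof.
move=> e [f [h1 h2]]; exists f; split; last by rewrite -(seq.permP e).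
by move=> u v; rewrite -!(perm_mem e); apply: h1.
Qed.

Lemma colorable_reverse V col k N B C :
    {in V, forall v, v <= B} -> {in V, forall v, col v <= C} -> colorable V col k N ->
  colorable [seq B - v | v <- V] (fun u => C - col (B - u)) k N.
Proof.
move=> hB hC [f [h1 h2]]; exists (fun u => f (B - u)); split.
  move=> _ _ /mapP[u uV ->] /mapP[v vV ->].
  have uB := hB u uV; have vB := hB v vV; rewrite !subKn // => fuv fk uv.
  apply: leq_sub2l; apply: h1 => //; [by rewrite -fuv | lia].
rewrite count_map; apply: leq_trans h2 _; apply: eq_leq; apply: eq_in_count => v vV /=.
by rewrite subKn // hB.
Qed.

(* The converse of [colorable_move], obtained by reversing both the order of
   the letters and that of the columns. *)
Lemma colorable_unmove (V : seq nat) (col : nat -> nat) (y d k N : nat) :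
    y \in V -> col y = d.+1 ->
    (forall z, count (fun v => (z <= v < y) && (col v == d)) V <=
               count (fun v => (z <= v < y) && (col v == d.+1)) V) ->
  colorable V (upd col y d) k N -> colorable V col k N.
Proof.
move=> yV cy ballot.
pose B := \max_(v <- V) v; pose C := \max_(v <- V) col v.
have hB : {in V, forall v, v <= B} by move=> v vV; exact: (@leq_bigmax_seq _ V xpredT id v).
have hC : {in V, forall v, col v <= C} by move=> v vV; exact: (@leq_bigmax_seq _ V xpredT col v).
have dC : d < C by have := hC y yV; rewrite cy.
have hC' : {in V, forall v, upd col y d v <= C}.
  by move=> v vV; rewrite /upd; case: eqP => _; [apply: ltnW | apply: hC].
move/(colorable_reverse hB hC'); set V' := map _ V => h.
have y'V : B - y \in V' by apply: map_f.
have yB := hB y yV.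
have hm : colorable V' (upd (fun u => C - upd col y d (B - u)) (B - y) (C - d.+1)) k N.
  apply: colorable_move y'V _ _ h => [|z].
    by rewrite subKn // {1}/upd eqxx subnSK.
  rewrite !count_map; apply: leq_trans (leq_trans _ (ballot (B - z))) _.
  + apply: eq_leq; apply: eq_in_count => v vV /=; rewrite subKn ?hB // /upd.
    have := hB v vV; have := hC v vV; case: (eqVneq v y) => [->|vy]; first by rewrite !ltnn ?andbF; lia.
    move=> c1 c2; have -> : (C - col v == (C - d.+1).+1) = (col v == d) by lia.
    by have -> : (B - y < B - v <= z) = (B - z <= v < y) by lia.
  + apply: eq_leq; apply: eq_in_count => v vV /=; rewrite subKn ?hB // /upd.
    have := hB v vV; have := hC v vV; case: (eqVneq v y) => [->|vy].
      by rewrite !ltnn andbF; lia.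
    move=> c1 c2; have -> : (C - col v == C - d.+1) = (col v == d.+1) by lia.
    by have -> : (B - y < B - v <= z) = (B - z <= v < y) by lia.
have hB' : {in V', forall v, v <= B} by move=> _ /mapP[v vV ->]; apply: leq_subr.
have hC'' : {in V', forall v, upd (fun u => C - upd col y d (B - u)) (B - y) (C - d.+1) v <= C}.
  by move=> v _; rewrite /upd; case: eqP => _; apply: leq_subr.
move: (colorable_reverse hB' hC'' hm); rewrite -map_comp => hr.
apply: eq_mem_colorable (eq_in_colorable _ hr).
  rewrite (_ : map _ V = V) // -[RHS]map_id; apply/eq_in_map => v vV /=.
  by rewrite subKn // hB.
move=> _ /mapP[v vV ->] /=; have vB := hB v vV; rewrite !(subKn vB).
rewrite /upd !(subKn vB); case: (eqVneq v y) => [->|vy].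
  by rewrite eqxx cy subKn.
have -> : (B - v == B - y) = false by lia.
by rewrite subKn // hC.
Qed.

(** * Insertion as a sequence of column moves *)

Section Counts.
Variable V : seq nat.
Hypothesis uV : uniq V.
Implicit Types (col : nat -> nat) (d e q y z k N : nat).

Definition cnt col e z := count (fun v => (col v == e) && (v <= z)) V.
Definition cntx col q e z :=
  count (fun v => (v != q) && ((col v == e) && (v <= z))) V.

Lemma cnt_cntx col q e z : q \in V ->
  cnt col e z = cntx col q e z + ((col q == e) && (q <= z)).
Proof.
move=> qV; rewrite /cnt /cntx !(seq.permP (perm_to_rem qV)) /= eqxx /= add0n addnC; congr (_ + _).
apply: eq_in_count => v; rewrite mem_rem_uniq // inE => /andP[-> _]; by [].
Qed.

Lemma cntx_upd col y d e z : cntx (upd col y d) y e z = cntx col y e z.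
Proof.
by apply: eq_count => v; rewrite /upd; case: (eqVneq v y).
Qed.

Lemma cntx_in col q e z (W : seq nat) : {subset V <= W} -> uniq W ->
    (forall v, v \in W -> v \notin V -> col v != e) ->
  forall p : pred nat,
  count (fun v => p v && (col v == e)) W = count (fun v => p v && (col v == e)) V.
Proof.
move=> VW uW h p; rewrite -!size_filter; apply/perm_size/uniq_perm; rewrite ?filter_uniq //.
move=> v; rewrite !mem_filter; case: (boolP (col v == e)) => [ce|]; last by rewrite andbF.
rewrite andbT; congr (_ && _); apply/idP/idP => [vW|/VW //].
by apply: contraTT ce => nV; apply: h.
Qed.

Lemma cntS col e z :
  cnt col e z.+1 = cnt col e z + ((z.+1 \in V) && (col z.+1 == e)).
Proof.
rewrite /cnt; have [zV|zV] /= := boolP (z.+1 \in V); last first.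
  rewrite addn0; apply: eq_in_count => v vV; congr (_ && _).
  by rewrite leq_eqVlt ltnS; case: (eqVneq v z.+1) => // vz; rewrite -vz vV in zV.
rewrite !(seq.permP (perm_to_rem zV)) /= leqnn andbT ltnn andbF add0n addnC; congr (_ + _).
apply: eq_in_count => v; rewrite mem_rem_uniq // inE => /andP[/= vz _].
by rewrite leq_eqVlt ltnS (negbTE vz).
Qed.

Lemma cnt0 col e : cnt col e 0 = ((0 \in V) && (col 0 == e)).
Proof.
rewrite /cnt; have [zV|zV] /= := boolP (0 \in V); last first.
  rewrite -[RHS](count_pred0 V); apply: eq_in_count => v vV.
  by rewrite leqn0; case: (eqVneq v 0) => [v0|]; rewrite ?andbF //; rewrite -v0 vV in zV.
rewrite !(seq.permP (perm_to_rem zV)) /= andbT -[RHS]addn0; congr (_ + _).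
rewrite -[RHS](count_pred0 (rem 0 V)); apply: eq_in_count => v.
by rewrite mem_rem_uniq // inE leqn0 => /andP[/= /negbTE -> _]; rewrite andbF.
Qed.

Lemma cnt_upd col y d e z : y \in V ->
  cnt (upd col y d) e z + ((col y == e) && (y <= z)) =
  cnt col e z + ((d == e) && (y <= z)).
Proof.
move=> yV; rewrite (cnt_cntx (upd col y d) _ _ yV) (cnt_cntx col _ _ yV) cntx_upd.
by rewrite {1}/upd eqxx; lia.
Qed.

(* The letters but [q] have as many entries in a column as in the next one, up
   to each threshold, with equality at [q], which sits in column [d]. *)
Definition carry col q d :=
  [/\ q \in V, col q = d,
      forall e z, cntx col q e.+1 z <= cntx col q e z
    & cntx col q d q = cntx col q d.+1 q].

(* The scan of the insertion, seen on columns: the letter [q] enters the column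
   [d]; it settles there if the columns stay ballot, and otherwise the least
   letter [y] violating this moves on to the next column on the left.  The last
   argument is the column of the new cell. *)
Inductive estep : (nat -> nat) -> nat -> nat -> (nat -> nat) -> nat -> Prop :=
| EstepStop col q d :
    (forall z, 0 < d -> cnt col d z <= cnt col d.-1 z) -> estep col q d col d
| EstepMove col q d col' D y :
    y \in V -> col y = d.+1 -> cnt col d y < cnt col d.+1 y ->
    (forall z, z < y -> cnt col d.+1 z <= cnt col d z) ->
    estep (upd col y d) y d col' D -> estep col q d.+1 col' D.

Lemma carry_le col q d y : carry col q d.+1 ->
  cnt col d y < cnt col d.+1 y -> q <= y.
Proof.
move=> [qV cq yam _]; rewrite !(@cnt_cntx _ q) // cq eqxx.
have := yam d y; case: (leqP q y) => //= _; lia.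
Qed.

(** Leaving out [y] instead of [q] changes the count of column d.+1 only at thresholds z with q <= z
    < y, where the minimality of [y] gives the inequality. At [y] the violation is by exactly one,
    hence equality once [y] has left. *)
Lemma carry_move col q d y : carry col q d.+1 ->
    y \in V -> col y = d.+1 -> cnt col d y < cnt col d.+1 y ->
    (forall z, z < y -> cnt col d.+1 z <= cnt col d z) ->
  carry (upd col y d) y d.
Proof.
move=> cq yV cy viol noviol; have qy := carry_le cq viol; case: cq => qV colq yam _.
have E e z : cntx (upd col y d) y e z + ((d.+1 == e) && (y <= z)) =
             cntx col q e z + ((d.+1 == e) && (q <= z)).
  by rewrite cntx_upd -cy -(cnt_cntx _ _ _ yV) (cnt_cntx _ _ _ qV) cy colq.
have Ed := E d; have Ed1 := E d.+1; have Ed2 := E d.+2.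
rewrite eqxx /= in Ed1.
have Cd z : cnt col d z = cntx col q d z.
  by rewrite (cnt_cntx _ _ _ qV) colq (gtn_eqF (ltnSn d)) addn0.
have Cd1 z : cnt col d.+1 z = cntx col q d.+1 z + (q <= z).
  by rewrite (cnt_cntx _ _ _ qV) colq eqxx.
have yam' e z : cntx (upd col y d) y e.+1 z <= cntx (upd col y d) y e z.
  have := yam e z; have := E e z; have := E e.+1 z.
  case: (ltngtP e d) => [lt|gt|->].
  - have -> : (d.+1 == e) = false by apply/negbTE; rewrite neq_ltn orbC ltnS ltnW.
    have -> : (d.+1 == e.+1) = false by apply/negbTE; rewrite eqSS neq_ltn lt orbT.
    by rewrite !addn0 => -> ->.
  - have -> : (d.+1 == e.+1) = false by apply/negbTE; rewrite eqSS neq_ltn gt.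
    case: (eqVneq e d.+1) => [->|ne]; last by rewrite !addn0 => -> ->.
    rewrite !addn0 /= => -> Ez yz.
    by move: Ez yz; case: (leqP y z) => yz; case: (leqP q z) => qz; clear -qy yz qz; lia.
  rewrite eqxx (gtn_eqF (ltnSn d)) /= !addn0 => E1 -> yz; move: E1 yz.
  case: (ltnP z y) => zy; last by clear -qy zy; case: (leqP q z); lia.
  by rewrite addn0 => ->; have := noviol z zy; rewrite Cd Cd1.
split=> //; first by rewrite /upd eqxx.
have := yam' d y; have := Ed y; have := Ed1 y; rewrite leqnn qy (gtn_eqF (ltnSn d)) /= !addn0.
by move: viol; rewrite Cd Cd1 qy; clear; lia.
Qed.

(** Without [y] the two columns have equal counts at [y] and ballot counts at [z]; the difference of
    the two is the claim. The same subtraction, on the other side of [y], gives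
    [carry_ballot_down]. *)
Lemma carry_ballot_up col y d z : carry (upd col y d) y d -> col y = d.+1 ->
  count (fun v => (y < v <= z) && (col v == d.+1)) V <=
  count (fun v => (y < v <= z) && (col v == d)) V.
Proof.
move=> [yV _ yam bal] cy.
have [yz|zy] := leqP y z; last first.
  by rewrite [X in X <= _](@eq_count _ _ pred0) ?count_pred0 // => v /=; lia.
have E e : cntx (upd col y d) y e z = cntx (upd col y d) y e y +
    count (fun v => (y < v <= z) && (col v == e)) V.
  rewrite !cntx_upd /cntx -size_filter -(count_predC (fun v => v <= y)) !count_filter.
  congr (_ + _); apply: eq_count => v /=; case: (eqVneq v y) => [->|] /=; lia.
by have := yam d z; rewrite !E; lia.
Qed.

Lemma carry_ballot_down col y d z : carry (upd col y d) y d -> col y = d.+1 ->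
  count (fun v => (z <= v < y) && (col v == d)) V <=
  count (fun v => (z <= v < y) && (col v == d.+1)) V.
Proof.
move=> [yV _ yam bal] cy.
case: z => [|z].
  have E e : cntx (upd col y d) y e y = count (fun v => (0 <= v < y) && (col v == e)) V.
    by rewrite !cntx_upd; apply: eq_count => v /=; case: (eqVneq v y) => [->|] /=; lia.
  by move: bal; rewrite !E => ->.
have [zy|yz] := ltnP z y; last first.
  by rewrite [X in X <= _](@eq_count _ _ pred0) ?count_pred0 // => v /=; lia.
have E e : cntx (upd col y d) y e y = cntx (upd col y d) y e z +
    count (fun v => (z < v < y) && (col v == e)) V.
  rewrite !cntx_upd /cntx -size_filter -(count_predC (fun v => v <= z)) !count_filter.
  congr (_ + _); apply: eq_count => v /=; case: (eqVneq v y) => [->|] /=; lia.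
by have := yam d z; move: bal; rewrite !E; lia.
Qed.

Lemma estep_outside col q d col' D v : estep col q d col' D -> v \notin V -> col' v = col v.
Proof.
elim=> // {}col {}q {}d {}col' {}D y yV _ _ _ _ IH vV; rewrite IH // /upd.
by case: eqP => // vy; rewrite vy yV in vV.
Qed.

(** The letters of [W] outside [V] sit beyond column d, so they are never in the two columns of a
    move. They will be the letters of a word that are still to be inserted. *)
Lemma estep_colorable col q d col' D W k N :
    estep col q d col' D -> carry col q d ->
    uniq W -> {subset V <= W} -> (forall v, v \in W -> v \notin V -> d < col v) ->
  colorable W col k N <-> colorable W col' k N.
Proof.
move=> st cq uW VW; elim: st cq => // {}col {}q {}d {}col' {}D y yV cy viol noviol _ IH cq big.
have cy' := carry_move cq yV cy viol noviol.
rewrite -IH //; last first.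
  move=> v vW vV; have := big v vW vV; rewrite /upd; case: eqP => [vy|_]; last by lia.
  by rewrite -vy (negbTE vV) in yV.
have cE e : e <= d.+1 -> forall p : pred nat,
    count (fun v => p v && (col v == e)) W = count (fun v => p v && (col v == e)) V.
  move=> ed; apply: (cntx_in 0 0) => // v vW vV.
  by have := big v vW vV; apply: contraTneq => ->; rewrite -leqNgt.
split.
  by apply: colorable_move; rewrite ?VW // => z; rewrite !cE //; apply: carry_ballot_up.
by apply: colorable_unmove; rewrite ?VW // => z; rewrite !cE //; apply: carry_ballot_down.
Qed.

Lemma estep_le col q d col' D : estep col q d col' D -> D <= d.
Proof. by elim=> // *; apply: leqW. Qed.

Definition yam col := forall e z, cnt col e.+1 z <= cnt col e z.

(** Of two candidates, the smaller makes column d exceed column d.+1 just below the larger, where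
    the larger requires equality. This is what makes an insertion reversible. *)
Lemma carry_unique col q q' d : carry col q d -> carry col q' d -> q = q'.
Proof.
have key p p' : carry col p d -> carry col p' d -> p < p' -> False.
  move=> [pV cp yamp balp] [p'V cp' yamp' balp'] pp'.
  have h1 : cnt col d.+1 p'.-1 < cnt col d p'.-1.
    rewrite !(cnt_cntx _ _ _ pV) cp eqxx (ltn_eqF (ltnSn d)) /=.
    by have := yamp d p'.-1; lia.
  have e1 e : cntx col p' e p' = cntx col p' e p'.-1.
    apply: eq_count => v; case: (eqVneq v p') => //= ?; congr (_ && _); lia.
  move: h1; rewrite !(cnt_cntx _ _ _ p'V) cp' eqxx (ltn_eqF (ltnSn d)) /=.
  by rewrite -!e1 balp'; lia.
by move=> h1 h2; case: (ltngtP q q') => // lt; [case: (key q q') | case: (key q' q)].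
Qed.

Lemma eq_carry col1 col2 q d : {in V, col1 =1 col2} -> carry col1 q d -> carry col2 q d.
Proof.
move=> e [qV cq y b].
have E f z : cntx col2 q f z = cntx col1 q f z by apply: eq_in_count => v /e ->.
split=> //; first by rewrite -e.
  by move=> f z; rewrite !E.
by rewrite !E.
Qed.

Lemma estep_case col q d col' D : estep col q d col' D ->
  (D = d /\ col' = col /\ forall z, 0 < d -> cnt col d z <= cnt col d.-1 z) \/
  exists y d0, d = d0.+1 /\ [/\ y \in V, col y = d0.+1, cnt col d0 y < cnt col d0.+1 y,
    forall z, z < y -> cnt col d0.+1 z <= cnt col d0 z
  & estep (upd col y d0) y d0 col' D].
Proof.
case=> [c p e h|c p e c' D' y yV cy h1 h2 h3]; first by left.
by right; exists y, e; split=> //; split.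
Qed.

Lemma estep_inj col1 q1 d col1' D col2 q2 col2' :
    estep col1 q1 d col1' D -> carry col1 q1 d ->
    estep col2 q2 d col2' D -> carry col2 q2 d ->
    {in V, col1' =1 col2'} -> q1 = q2 /\ {in V, col1 =1 col2}.
Proof.
move=> st1; elim: st1 col2 q2 col2' => {col1 q1 d col1' D}
  [col1 q1 d _|col1 q1 d col1' D y yV cy viol noviol st1 IH] col2 q2 col2' c1 st2 c2 e.
  case: (estep_case st2) => [[_ [e2 _]]|[y [d0 [dd [_ _ _ _ /estep_le]]]]].
    by rewrite e2 in e; split=> //; apply: carry_unique (eq_carry e c1) c2.
  by rewrite dd ltnn.
case: (estep_case st2) => [[Dd _]|[y' [d0 [[dd] [y'V cy' viol' noviol' st2']]]]].
  by have := estep_le st1; rewrite Dd ltnn.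
rewrite -dd in cy' viol' noviol' st2'.
have c1' := carry_move c1 yV cy viol noviol.
have c2' := carry_move c2 y'V cy' viol' noviol'.
have [yy' eq'] := IH _ _ _ c1' st2' c2' e.
have E : {in V, col1 =1 col2}.
  move=> v vV; have := eq' v vV; rewrite -yy' /upd; case: eqP => // -> _.
  by rewrite cy yy' cy'.
by split=> //; apply: carry_unique (eq_carry E c1) c2.
Qed.

Lemma cnt_max col e z z' : {in V, forall v, v <= z} -> {in V, forall v, v <= z'} ->
  cnt col e z = cnt col e z'.
Proof. by move=> h h'; apply: eq_in_count => v vV; rewrite h ?h'. Qed.

(** Reverse insertion, from a removable cell of column [D]: the carried letter goes back one column
    to the right at a time, and the letter carried before it is found there. *)
Lemma estep_surj col' D B : {in V, forall v, v <= B} -> yam col' ->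
    cnt col' D.+1 B < cnt col' D B ->
  forall d, D <= d -> exists col q, [/\ carry col q d, estep col q d col' D,
    forall e z, d < e -> cnt col e z = cnt col' e z
  & cnt col d B = cnt col' d B + (D < d)].
Proof.
move=> hB yam' corner.
(* The carry is the least [q] such that the excess stays positive from [q] on. *)
have pick col d : (forall z, cnt col d.+1 z <= cnt col d z) ->
    cnt col d.+1 B < cnt col d B ->
    exists q, [/\ q \in V, col q = d,
      forall z, q <= z -> cnt col d.+1 z < cnt col d z,
      cntx col q d q = cntx col q d.+1 q
    & forall p, (forall z, p <= z -> cnt col d.+1 z < cnt col d z) -> q <= p].
  move=> le lt.
  pose P y := all (fun z => (y <= z) ==> (cnt col d.+1 z < cnt col d z)) (iota 0 B.+1).
  have exP : exists y, P y.
    exists B; apply/allP => z; rewrite mem_iota /= => zB; apply/implyP => Bz.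
    by have -> : z = B by lia.
  have [q Pq qmin] := ex_minnP exP.
  have qB : q <= B.
    by apply: qmin; apply/allP => z; rewrite mem_iota => zB; apply/implyP => Bz; have -> : z = B by lia.
  have qz z : q <= z -> cnt col d.+1 z < cnt col d z.
    move=> qz; have [zB|Bz] := leqP z B.
      by have /allP/(_ z) := Pq; rewrite mem_iota qz; apply.
    have E e : cnt col e z = cnt col e B by apply: cnt_max => // v /hB; lia.
    by rewrite !E.
  have least p : (forall z, p <= z -> cnt col d.+1 z < cnt col d z) -> q <= p.
    by move=> hp; apply: qmin; apply/allP => z _; apply/implyP => /hp.
  have pre e : 0 < q -> cntx col q e q = cnt col e q.-1.
    move=> q0; apply: eq_count => v; case: (eqVneq v q) => /= [->|ne].
      by rewrite (_ : (q <= q.-1) = false) ?andbF //; lia.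
    by congr (_ && _); lia.
  have [q0|q0] := posnP q.
    subst q; have := qz 0 isT; rewrite !cnt0; case: (boolP (0 \in V)) => //= zV.
    case: (eqVneq (col 0) d) => // c0 _; exists 0; split=> //.
    have E e : cntx col 0 e 0 = 0.
      by apply/eqP; rewrite -leqn0 leqNgt -has_count -all_predC; apply/allP => v _ /=; lia.
    by rewrite !E.
  have nP : cnt col d.+1 q.-1 = cnt col d q.-1.
    apply/eqP; rewrite eqn_leq le /= leqNgt; apply/negP => lt'.
    suff : q <= q.-1 by lia.
    apply: qmin; apply/allP => z; rewrite mem_iota => zB; apply/implyP.
    by rewrite leq_eqVlt => /orP[/eqP <- //|]; rewrite prednK // => /qz.
  have Eq e : cnt col e q = cnt col e q.-1 + ((q \in V) && (col q == e)).
    by have := cntS col e q.-1; rewrite prednK.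
  have := qz q (leqnn q); rewrite !Eq nP.
  case: (boolP (q \in V)) => [qV|]; last by rewrite /= !addn0 ltnn.
  rewrite /=; case: (eqVneq (col q) d) => [cq|ne]; last by rewrite addn0; lia.
  by move=> _; exists q; split; rewrite // !pre.
elim=> [|d IH].
  rewrite leqn0 => /eqP D0; rewrite D0 in corner *.
  have [q [qV cq qz bal _]] := pick col' 0 (yam' 0) corner.
  exists col', q; split=> //; last by rewrite addn0.
    split=> // e z; have := yam' e z; rewrite !(cnt_cntx _ _ _ qV) cq /= addn0.
    case: e => [|e] /=; last by rewrite addn0.
    by have := qz z; rewrite !(cnt_cntx _ _ _ qV) cq /=; case: (leqP q z) => //=; lia.
  by apply: EstepStop => z; rewrite ltnn.
rewrite leq_eqVlt => /orP[/eqP Dd|Dd'].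
  rewrite Dd in corner *.
  have [q [qV cq qz bal _]] := pick col' d.+1 (yam' d.+1) corner.
  exists col', q; split=> //; last by rewrite ltnn addn0.
    split=> // e z; have := yam' e z; rewrite !(cnt_cntx _ _ _ qV) cq.
    case: (eqVneq d.+1 e) => [de|ne] /=; last by lia.
    have := qz z; rewrite !(cnt_cntx _ _ _ qV) cq -de eqxx (ltn_eqF (ltnSn _)) /=.
    by case: (leqP q z) => //=; lia.
  by apply: EstepStop => z _; apply: yam'.
have [col [q [cq st big tot]]] := IH Dd'.
have [qV colq yq bal] := cq.
(* The forward move out of column d.+1 must expel [q]; so [q] returns there, and the letter carried
   into that column is picked among the letters then present. *)
pose c1 := upd col q d.+1.
have Dd := Dd'.
have c1E e z : cnt c1 e z + ((d == e) && (q <= z)) = cnt col e z + ((d.+1 == e) && (q <= z)).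
  by have := cnt_upd col d.+1 e z qV; rewrite colq.
have ne1 : (d == d.+1) = false by lia.
have ne2 : (d.+1 == d) = false by lia.
have ne3 : (d == d.+2) = false by lia.
have ne4 : (d.+1 == d.+2) = false by lia.
have E0 z : cnt c1 d z + (q <= z) = cnt col d z by have := c1E d z; rewrite eqxx ne2 addn0.
have E1 z : cnt c1 d.+1 z = cnt col d.+1 z + (q <= z).
  by have := c1E d.+1 z; rewrite eqxx ne1 addn0.
have E2 z : cnt c1 d.+2 z = cnt col d.+2 z.
  by have := c1E d.+2 z; rewrite ne3 ne4 !addn0.
have F e z : cnt c1 e z = cntx col q e z + ((d.+1 == e) && (q <= z)).
  have := c1E e z; rewrite [cnt col e z](cnt_cntx _ _ _ qV) colq; lia.
have F0 z : cnt c1 d z = cntx col q d z by rewrite F ne2 addn0.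
have F1 z : cnt c1 d.+1 z = cntx col q d.+1 z + (q <= z) by rewrite F eqxx.
have F2 z : cnt c1 d.+2 z = cntx col q d.+2 z by rewrite F ne4 addn0.
have qB : q <= B by apply: hB.
have [||q' [q'V cq' q'z bal' q'min]] := pick c1 d.+1.
- by move=> z; rewrite F1 F2; have := yq d.+1 z; lia.
- by rewrite F1 F2 qB; have := yq d.+1 B; lia.
have q'q : q' <= q.
  by apply: q'min => z qz; rewrite F1 F2 qz; have := yq d.+1 z; lia.
exists c1, q'; split.
- split=> // e z.
  have G e' : cntx c1 q' e' z + ((d.+1 == e') && (q' <= z)) =
              cntx col q e' z + ((d.+1 == e') && (q <= z)).
    by rewrite -F (cnt_cntx _ _ _ q'V) cq'.
  have := yq e z; move: (G e) (G e.+1); rewrite eqSS.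
  case: (eqVneq d e) => [<-|ne] /=.
    rewrite ne2 /= !addn0 => -> Gd yz; move: Gd yz.
    by case: (leqP q z) => qz; case: (leqP q' z) => q'z1; clear -q'q qz q'z1; lia.
  rewrite !addn0; case: (eqVneq d.+1 e) => [de|ne'] /=; last by rewrite !addn0 => -> ->.
  move=> Ge -> yz; have := q'z z; rewrite -de F1 F2; move: Ge yz; rewrite -de.
  by case: (leqP q' z) => q'z1; case: (leqP q z) => qz //= ; clear -q'q qz q'z1; lia.
- apply: (@EstepMove _ _ _ _ _ q) => //.
  + by rewrite /c1 /upd eqxx.
  + by rewrite F0 F1 leqnn bal addn1.
  + by move=> z zq; rewrite F0 F1 (leqNgt q z) zq addn0; apply: yq.
  suff -> : upd c1 q d = col by [].
  by apply: funext => v; rewrite /c1 /upd; case: eqP => // ->.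
- move=> e z de; rewrite F; have -> : (d.+1 == e) = false by lia.
  have := cnt_cntx col e z qV; rewrite colq (_ : (d == e) = false); last by lia.
  by rewrite addn0 => <-; apply: big; apply: ltnW.
rewrite ltnS (Dd' : D <= d) F1 qB; have := cnt_cntx col d.+1 B qV; rewrite colq ne1 addn0 => <-.
by rewrite big.
Qed.

End Counts.

(** * Traces of insertions and row bumping *)

(* [k e] is the letter carried into the column [e]; [N e z] and [N' e z] count
   the entries at most [z] in the column [e] before and after the insertion. *)
Record ins_trace (N N' : nat -> nat -> nat) (q d D : nat) (k : nat -> nat) : Prop :=
  InsTrace {
    tr_start : k d = q;
    tr_le : D <= d;
    tr_viol : forall e, D <= e < d -> N e (k e) < N e.+1 (k e) + (k e.+1 <= k e);
    tr_min : forall e z, D <= e < d -> z < k e -> N e.+1 z + (k e.+1 <= z) <= N e z;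
    tr_stop : 0 < D -> forall z, N D z + (k D <= z) <= N D.-1 z;
    tr_final : forall e z,
      N' e z + ((D < e <= d) && (k e.-1 <= z)) = N e z + ((D <= e <= d) && (k e <= z));
    tr_unit : forall e z, D <= e <= d ->
      N e z.+1 + (k e <= z.+1) <= (N e z + (k e <= z)).+1
  }.

Lemma estep_trace V (uV : uniq V) col q d col' D :
    estep V col q d col' D -> carry V col q d ->
  exists k, ins_trace (cntx V col q) (cnt V col') q d D k.
Proof.
elim=> {col q d col' D} [col q d stop|col q d col' D y yV cy viol noviol st IH] cq.
  have [qV colq yam bal] := cq; exists (fun=> q).
  have C e z : cnt V col e z = cntx V col q e z + ((d == e) && (q <= z)).
    by rewrite (cnt_cntx uV col e z qV) colq.
  split=> // [e|e|d0 z|e z|e z]; try by rewrite leqNgt; case: (e < d).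
  - have := stop z d0; rewrite !C eqxx (_ : (d == d.-1) = false); last by lia.
    by rewrite addn0.
  - by rewrite [d < e]ltnNge andNb /= addn0 C eqn_leq.
  rewrite -eqn_leq => /eqP <-; have := C d z; have := C d z.+1; rewrite eqxx /= => <- <-.
  by rewrite cntS // -[X in _ <= X]addn1 leq_add2l leq_b1.
have c' := carry_move uV cq yV cy viol noviol; have [k tr] := IH c'.
have qy := carry_le uV cq viol.
have [qV colq yam bal] := cq.
have C e z : cnt V col e z = cntx V col q e z + ((d.+1 == e) && (q <= z)).
  by rewrite (cnt_cntx uV col e z qV) colq.
have E e z : cntx V (upd col y d) y e z + ((d.+1 == e) && (y <= z)) =
             cntx V col q e z + ((d.+1 == e) && (q <= z)).
  by rewrite cntx_upd -C (cnt_cntx uV col e z yV) cy.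
have E' e z : e <= d -> cntx V (upd col y d) y e z = cntx V col q e z.
  by move=> ed; have := E e z; rewrite (_ : (d.+1 == e) = false) ?addn0; lia.
have Cd z : cnt V col d z = cntx V col q d z by rewrite C (_ : (d.+1 == d) = false) ?addn0; lia.
have Cd1 z : cnt V col d.+1 z = cntx V col q d.+1 z + (q <= z) by rewrite C eqxx.
pose k' e := if e == d.+1 then q else k e.
have k'1 : k' d.+1 = q by rewrite /k' eqxx.
have k'E e : e <= d -> k' e = k e by rewrite /k'; case: eqP => // ->; rewrite ltnn.
have kd := tr_start tr; have Dd := tr_le tr.
exists k'; split=> //; first exact: leqW.
- move=> e /andP[De]; rewrite ltnS leq_eqVlt => /orP[/eqP ->|ed].
    by rewrite k'1 k'E // kd; have := viol; rewrite Cd Cd1.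
  rewrite !k'E //; last exact: ltnW.
  by rewrite -!E' //; [apply: tr_viol tr _ _; rewrite De | apply: ltnW].
- move=> e z /andP[De]; rewrite ltnS leq_eqVlt => /orP[/eqP ->|ed].
    by rewrite k'1 k'E // kd => zy; have := noviol z zy; rewrite Cd Cd1.
  rewrite !k'E //; last exact: ltnW.
  by move=> zk; rewrite -!E' //; [apply: (tr_min tr); rewrite ?De | apply: ltnW].
- move=> D0 z; rewrite k'E // -!E' //; last exact: leq_trans (leq_pred _) Dd.
  exact: (tr_stop tr).
- move=> e z; have := tr_final tr e z; have := E e z.
  have [ed|] := leqP e d.
    rewrite (_ : (d.+1 == e) = false) ?addn0; last by lia.
    move=> ->; rewrite (leqW ed) !k'E //; exact: leq_trans (leq_pred _) ed.
  rewrite leq_eqVlt => /orP[/eqP de|de]; last first.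
    rewrite (_ : (d.+1 == e) = false) ?addn0; last by lia.
    rewrite (_ : (e <= d.+1) = false); last by lia.
    by rewrite !andbF !addn0 => ->.
  rewrite -de eqxx leqnn ltnS Dd (leqW Dd) k'1 k'E //= kd.
  by rewrite !addn0 => h ->.
move=> e z /andP[De]; rewrite leq_eqVlt => /orP[/eqP ->|ed].
  by rewrite k'1 -!Cd1 cntS // -[X in _ <= X]addn1 leq_add2l leq_b1.
rewrite k'E // -!E' //; apply: (tr_unit tr); rewrite De; exact: ed.
Qed.

Lemma trace_pass N N' q d D k e z : ins_trace N N' q d D k -> D < e <= d ->
  N' e z + (k e.-1 <= z) = N e z + (k e <= z).
Proof.
by move=> tr h; have := tr_final tr e z; rewrite h; case/andP: h => /ltnW -> ->.
Qed.

Lemma trace_land N N' q d D k z : ins_trace N N' q d D k ->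
  N' D z = N D z + (k D <= z).
Proof. by move=> tr; have := tr_final tr D z; rewrite ltnn leqnn (tr_le tr) addn0. Qed.

Lemma trace_other N N' q d D k e z : ins_trace N N' q d D k -> e < D \/ d < e ->
  N' e z = N e z.
Proof.
move=> tr h; have := tr_final tr e z.
have -> : (D < e <= d) = false by lia.
have -> : (D <= e <= d) = false by lia.
by rewrite !addn0.
Qed.

Lemma trace_mono N N' q d D k e : ins_trace N N' q d D k ->
  (forall e z, N e.+1 z <= N e z) -> D <= e < d -> k e.+1 <= k e.
Proof.
move=> tr yam h; have := tr_viol tr h; have := yam e (k e).
by case: (leqP (k e.+1)) => //= _ y; rewrite addn0 ltnNge y.
Qed.

(** Column d.-1 is empty at first, so the first letter reaches it unchanged. This offset allows the
    first trail in a column e to be compared with the second one in e.+1. *)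
Section TwoInsertions.
Variables (N N1 N2 : nat -> nat -> nat) (q1 q2 d D1 D2 : nat) (k1 k2 : nat -> nat).
Hypothesis yamN : forall e z, N e.+1 z <= N e z.
Hypothesis yamN1 : forall e z, N1 e.+1 z <= N1 e z.
Hypothesis monN : forall e z z', z <= z' -> N e z <= N e z'.
Hypothesis d0 : 0 < d.
Hypothesis emptyN : forall e z, d <= e.+1 -> N e z = 0.
Hypothesis tr1 : ins_trace N N1 q1 d D1 k1.
Hypothesis tr2 : ins_trace N1 N2 q2 d D2 k2.

Lemma trace_lt_top : D1 < d.
Proof.
rewrite ltn_neqAle (tr_le tr1) andbT; apply/eqP => D1d.
have D10 : 0 < D1 by rewrite D1d.
by have := tr_stop tr1 D10 (k1 D1); rewrite leqnn D1d !emptyN //; lia.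
Qed.

Lemma trace_top : k1 d.-1 = q1.
Proof.
have h : D1 <= d.-1 < d by have := trace_lt_top; lia.
have := trace_mono tr1 yamN h.
rewrite prednK // (tr_start tr1) leq_eqVlt => /orP[/eqP <- //|lt].
by have := tr_min tr1 h lt; rewrite prednK // (tr_start tr1) leqnn !emptyN //; lia.
Qed.

(* The row bumping lemma. *)
Lemma bump_lt : q1 < q2 -> D1 < D2.
Proof.
move=> q12; rewrite ltnNge; apply/negP => D21.
have D1d := trace_lt_top.
(* The second letter trails one column behind the first and stays at least as large. The descending
   induction starts with [k1 d.-1], which is [q1], and [k2 d], which is [q2]. *)
have key e : D1 <= e < d -> k1 e <= k2 e.+1.
  move: {2}(d - e) (erefl (d - e)) => j; elim: j e => [|j IH] e; first by lia.
  move=> de /andP[De ed]; have [ed1|ed1] := eqVneq e.+1 d.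
    by rewrite ed1 (tr_start tr2) -(_ : d.-1 = e) ?trace_top; lia.
  have h : D1 <= e.+1 < d by lia.
  have h2 : D2 <= e.+1 < d by lia.
  have IHe : k1 e.+1 <= k2 e.+2 by apply: IH => //; lia.
  have k2m := trace_mono tr2 yamN1 h2.
  have k1m := trace_mono tr1 yamN h.
  rewrite leqNgt; apply/negP => lt.
  have p1 : D1 < e.+1 <= d by lia.
  have p2 : D1 < e.+2 <= d by lia.
  have := tr_viol tr2 h2; rewrite k2m; have := yamN e.+1 (k2 e.+1).
  have := trace_pass (k2 e.+1) tr1 p1; rewrite /= (leqNgt (k1 e)) lt (leq_trans IHe k2m) /=.
  have := trace_pass (k2 e.+1) tr1 p2; rewrite /= (leq_trans IHe k2m).
  have := leq_b1 (k1 e.+2 <= k2 e.+1); clear; lia.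
have h : D2 <= D1 < d by lia.
have hk : D1 <= D1 < d by lia.
have k2m := trace_mono tr2 yamN1 h; have k1m := trace_mono tr1 yamN hk.
have p : D1 < D1.+1 <= d by lia.
have l1 := leq_trans (key D1 hk) k2m.
have := tr_viol tr2 h; rewrite k2m (trace_land _ tr1) l1.
have := trace_pass (k2 D1) tr1 p; rewrite /= l1 (leq_trans k1m l1).
by have := yamN D1 (k2 D1); clear; lia.
Qed.

Lemma bump_gt : q2 < q1 -> D2 <= D1.
Proof.
move=> q21; rewrite leqNgt; apply/negP => D12.
(* A violation for the second letter just before the first letter. *)
have viol e : D1 <= e < d -> k2 e.+1 < k1 e.+1 ->
    N1 e (k1 e).-1 < N1 e.+1 (k1 e).-1 + (k2 e.+1 <= (k1 e).-1).
  move=> h1 lt; have m := trace_mono tr1 yamN h1.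
  have k0 : 0 < k1 e by lia.
  have h3 : D1 <= e.+1 <= d by lia.
  have p1 : D1 < e.+1 <= d by lia.
  have b1 : (k1 e <= (k1 e).-1) = false by lia.
  have b2 : (k2 e.+1 <= (k1 e).-1) by lia.
  have := trace_pass (k1 e).-1 tr1 p1; rewrite /= b1 b2 addn0 => ->.
  have := tr_unit tr1 (k1 e).-1 h3; rewrite prednK // m.
  have := tr_viol tr1 h1; rewrite m.
  have := @monN e _ _ (leq_pred (k1 e)).
  suff -> : N1 e (k1 e).-1 = N e (k1 e).-1 by clear; lia.
  have [De|De] := ltnP D1 e; last first.
    have eD : e = D1 by lia.
    by rewrite [in LHS]eD (trace_land _ tr1) -eD b1 addn0.
  have p2 : D1 < e <= d by lia.
  have h4 : D1 <= e.-1 < d by lia.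
  have := trace_mono tr1 yamN h4; rewrite prednK => [m2|]; last by lia.
  have b3 : (k1 e.-1 <= (k1 e).-1) = false by lia.
  by have := trace_pass (k1 e).-1 tr1 p2; rewrite b1 b3 !addn0.
(* In each common column the second letter stays below the first. It therefore has to move on
   wherever the first one did, and cannot stop at [D2]. *)
have key e : D2 <= e <= d -> k2 e < k1 e.
  move: {2}(d - e) (erefl (d - e)) => j; elim: j e => [|j IH] e.
    by move=> de h; rewrite (_ : e = d) ?(tr_start tr1) ?(tr_start tr2) //; lia.
  move=> de h; have IHe : k2 e.+1 < k1 e.+1 by apply: IH; lia.
  have h1 : D1 <= e < d by lia.
  have h2 : D2 <= e < d by lia.
  have m := trace_mono tr1 yamN h1.
  rewrite ltnNge; apply/negP => lt.
  have lt' : (k1 e).-1 < k2 e by lia.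
  by have := tr_min tr2 h2 lt'; rewrite leqNgt viol.
have hD := tr_le tr2.
have h2 : D2 <= D2 <= d by lia.
have D20 : 0 < D2 by lia.
have h1 : D1 <= D2.-1 < d by lia.
have := viol _ h1; rewrite prednK // => /(_ (key D2 h2)).
by rewrite ltnNge (tr_stop tr2).
Qed.

End TwoInsertions.

(** A carried letter is the least violation between two adjacent columns. It depends only on their
    counts and on the letter carried into the right one, so counts that agree from [s] on give the
    same trail there. *)
Lemma trace_agree N N' M M' q d D E s k l :
    ins_trace N N' q d D k -> ins_trace M M' q d E l ->
    (forall e z, s <= e -> N e z = M e z) ->
  forall e, s <= e <= d -> D <= e -> E <= e -> k e = l e.
Proof.
move=> t1 t2 NM e; move: {2}(d - e) (erefl (d - e)) => j; elim: j e => [|j IH] e de h De Ee.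
  have -> : e = d by lia.
  by rewrite (tr_start t1) (tr_start t2).
have IHe : k e.+1 = l e.+1 by apply: IH; lia.
have h1 : D <= e < d by lia.
have h2 : E <= e < d by lia.
have v1 := tr_viol t1 h1; have v2 := tr_viol t2 h2.
have se : s <= e by lia.
have se1 : s <= e.+1 by lia.
case: (ltngtP (k e) (l e)) => // lt.
  by have := tr_min t2 h2 lt; rewrite -!NM // -IHe; lia.
by have := tr_min t1 h1 lt; rewrite !NM // IHe; lia.
Qed.

Lemma trace_stop_le N N' M M' q d D E s k l :
    ins_trace N N' q d D k -> ins_trace M M' q d E l ->
    (forall e z, s <= e -> N e z = M e z) -> s < D -> D <= E.
Proof.
move=> t1 t2 NM sD; rewrite leqNgt; apply/negP => ED.
have kl : k D = l D.
  by apply: (trace_agree t1 t2 NM) => //; have := tr_le t1; lia.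
have h : E <= D.-1 < d by have := tr_le t1; lia.
have D0 : 0 < D by lia.
have := tr_viol t2 h; have := tr_stop t1 D0 (l D.-1).
rewrite prednK // kl !NM; lia.
Qed.

(** * Young composition tableaux and their insertion *)

Record syct (T : filling) : Prop := Syct {
  syct_cell0 : forall i, i < size T -> is_cell T i 0;
  syct_row : forall i d, is_cell T i d.+1 -> entry T i d < entry T i d.+1;
  syct_head : forall i j, i < j -> is_cell T j 0 -> entry T i 0 < entry T j 0;
  syct_triple : forall i j d, i < j -> is_cell T j d -> is_cell T i d.+1 ->
    entry T j d <= entry T i d.+1 ->
    is_cell T j d.+1 && (entry T j d.+1 < entry T i d.+1)
}.

Lemma is_cell_size T i d : is_cell T i d -> i < size T.
Proof. by rewrite /is_cell; case: (ltnP i (size T)) => // h; rewrite nth_default. Qed.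

Lemma is_cellS T i d : is_cell T i d.+1 -> is_cell T i d.
Proof. exact: ltnW. Qed.

Lemma is_cell_leq T i d e : d <= e -> is_cell T i e -> is_cell T i d.
Proof. exact: leq_ltn_trans. Qed.

Lemma mem_flatten T v :
  reflect (exists i d, is_cell T i d /\ entry T i d = v) (v \in flatten T).
Proof.
apply: (iffP flattenP) => [[r rT vr]|[i [d [c <-]]]].
  exists (index r T), (index v r).
  by rewrite /is_cell /entry nth_index // index_mem nth_index.
by exists (nth [::] T i); [rewrite mem_nth ?(is_cell_size c) | rewrite mem_nth].
Qed.

Lemma entry_in T i d : is_cell T i d -> entry T i d \in flatten T.
Proof. by move=> c; apply/mem_flatten; exists i, d. Qed.

Lemma entry_inj T i d j e : uniq (flatten T) -> is_cell T i d -> is_cell T j e ->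
  entry T i d = entry T j e -> i = j /\ d = e.
Proof.
elim: T i j => [|r T IH] [|i] [|j] //=; rewrite cat_uniq => /and3P[ur /hasPn dis uT].
- by move=> c1 c2 e12; split=> //; apply/eqP; rewrite -(nth_uniq 0 c1 c2 ur); apply/eqP.
- move=> c1 c2 e12; have := dis _ (@entry_in T j e c2).
  by rewrite -[entry T j e]/(entry (r :: T) j.+1 e) -e12 mem_nth.
- move=> c1 c2 e12; have := dis _ (@entry_in T i d c1).
  by rewrite -[entry T i d]/(entry (r :: T) i.+1 d) e12 mem_nth.
by move=> c1 c2 e12; have [-> ->] := IH i j uT c1 c2 e12.
Qed.

(** This is [cnt] for the columns of a tableau, but free of any column map, so that tableaux with
    different letters can be compared. *)
Definition rowcnt (T : filling) e z := count (fun r => (e < size r) && (nth 0 r e <= z)) T.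

Definition reads (Z : nat -> nat) (T : filling) :=
  forall i d, is_cell T i d -> Z (entry T i d) = d.

Lemma reads_cons Z r T : reads Z (r :: T) ->
  (forall d, d < size r -> Z (nth 0 r d) = d) /\ reads Z T.
Proof. by move=> rd; split=> [d|i d]; [apply: (rd 0) | apply: (rd i.+1)]. Qed.

Lemma cnt_flatten Z T e z : reads Z T -> cnt (flatten T) Z e z = rowcnt T e z.
Proof.
elim: T => //= r T IH /reads_cons[rd /IH]; rewrite /cnt /rowcnt /= count_cat => ->.
congr (_ + _); rewrite -{1}[r](mkseq_nth 0) count_map.
rewrite (@eq_in_count _ _ (fun j => (j == e) && (nth 0 r e <= z))) => [|j]; last first.
  by rewrite mem_iota /= => /rd ->; case: eqP => // ->.
case: (nth 0 r e <= z); last first.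
  by rewrite andbF (eq_count (a2 := pred0)) ?count_pred0 // => j; rewrite andbF.
rewrite andbT (eq_count (a2 := pred1 e)) => [|j]; last by rewrite andbT.
by rewrite count_uniq_mem ?iota_uniq // mem_iota.
Qed.

Lemma cnt_perm V V' Z e z : perm_eq V V' -> cnt V Z e z = cnt V' Z e z.
Proof. by move/seq.permP; apply. Qed.

Lemma cnt_carry V Z T k e z : perm_eq V (k :: flatten T) -> reads Z T ->
  cnt V Z e z = ((Z k == e) && (k <= z)) + rowcnt T e z.
Proof. by move=> pV rd; rewrite (cnt_perm _ _ _ pV) -(cnt_flatten _ _ rd). Qed.

Lemma rowcnt_leq T e e' z z' :
    (forall i, is_cell T i e -> entry T i e <= z ->
       is_cell T i e' && (entry T i e' <= z')) ->
  rowcnt T e z <= rowcnt T e' z'.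
Proof.
elim: T => //= r T IH h; rewrite /rowcnt /=; apply: leq_add; last first.
  by apply: IH => i; apply: (h i.+1).
by case: andP => // -[h1 h2]; have := h 0 h1 h2; rewrite /is_cell /entry /= => ->.
Qed.

Lemma set_rowE T c r i : nth [::] (set_row T c r) i = if i == c then r else nth [::] T i.
Proof. by rewrite /set_row nth_set_nth. Qed.

Lemma size_set_row T c r : c < size T -> size (set_row T c r) = size T.
Proof. by move=> cT; rewrite size_set_nth; apply/maxn_idPr. Qed.

Lemma flatten_set_row T c r : c < size T ->
  perm_eq (nth [::] T c ++ flatten (set_row T c r)) (r ++ flatten T).
Proof.
rewrite /set_row; elim: T c => // s T IH [|c] /=; first by rewrite perm_catCA.
rewrite ltnS => /IH h; rewrite catA perm_sym catA perm_sym.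
have E (a b : seq nat) : perm_eq (a ++ b) (b ++ a) by rewrite perm_catC.
rewrite (perm_trans (y := s ++ nth [::] T c ++ flatten (set_nth [::] T c r))) //.
  by rewrite catA perm_cat2r.
by rewrite perm_sym -catA perm_catCA perm_cat2l perm_sym.
Qed.

Lemma flatten_set_entry T c d k : is_cell T c d ->
  perm_eq (entry T c d :: flatten (set_row T c (set_nth 0 (nth [::] T c) d k)))
          (k :: flatten T).
Proof.
move=> cd; have := flatten_set_row (set_nth 0 (nth [::] T c) d k) (is_cell_size cd).
move/seq.permP => h; apply/seq.permP; suff E (p : pred nat) :
    p (entry T c d) + count p (set_nth 0 (nth [::] T c) d k) = p k + count p (nth [::] T c).
  by move=> p; move: (h p) (E p); rewrite !count_cat /=; clear; lia.
rewrite set_nthE (cd : d < size _) /entry -{4}(cat_take_drop d (nth [::] T c)) (drop_nth 0 cd).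
by rewrite !count_cat /=; lia.
Qed.

Lemma flatten_rcons_row T c k : c < size T ->
  perm_eq (flatten (set_row T c (rcons (nth [::] T c) k))) (k :: flatten T).
Proof.
move=> cT; have /seq.permP h := flatten_set_row (rcons (nth [::] T c) k) cT.
by apply/seq.permP => p; have := h p; rewrite !count_cat /= -cats1 count_cat /=; lia.
Qed.

Section SetEntry.
Variables (T : filling) (c d k : nat).
Hypothesis cd : is_cell T c d.
Let T' := set_row T c (set_nth 0 (nth [::] T c) d k).

Lemma is_cell_set_entry i e : is_cell T' i e = is_cell T i e.
Proof.
rewrite /is_cell set_rowE; case: eqP => // ->.
by rewrite size_set_nth (maxn_idPr _).
Qed.

Lemma entry_set_entry i e :
  entry T' i e = if (i == c) && (e == d) then k else entry T i e.
Proof.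
by rewrite /entry set_rowE; case: eqP => // ->; rewrite nth_set_nth.
Qed.
End SetEntry.

Section AppendEntry.
Variables (T : filling) (c k : nat).
Hypothesis cT : c < size T.
Let T' := set_row T c (rcons (nth [::] T c) k).

Lemma is_cell_append i e :
  is_cell T' i e = is_cell T i e || ((i == c) && (e == size (nth [::] T c))).
Proof.
rewrite /is_cell set_rowE; case: eqP => [->|]; last by rewrite orbF.
by rewrite size_rcons ltnS leq_eqVlt orbC.
Qed.

Lemma entry_append i e :
  entry T' i e = if (i == c) && (e == size (nth [::] T c)) then k else entry T i e.
Proof.
rewrite /entry set_rowE; case: eqP => // -> /=; rewrite nth_rcons.
by case: ltngtP => // h; rewrite nth_default // ltnW.
Qed.
End AppendEntry.

Section Scan.

Definition row_cells (T : filling) d c :=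
  [seq x <- [seq (i, d) | i <- rev (iota 0 c)] | is_cell T x.1 x.2].

Definition stages (T : filling) d :=
  flatten [seq row_cells T e (size T) | e <- rev (iota 0 d)].

Lemma row_cellsS T d c :
  row_cells T d c.+1 = if is_cell T c d then (c, d) :: row_cells T d c else row_cells T d c.
Proof. by rewrite /row_cells -addn1 iotaD rev_cat. Qed.

Lemma stagesS T d : stages T d.+1 = row_cells T d (size T) ++ stages T d.
Proof. by rewrite /stages -[d.+1]addn1 iotaD rev_cat. Qed.

Lemma scan_cells_stages T : scan_cells T = stages T (foldr maxn 0 (shape T)).
Proof. by rewrite /scan_cells /stages filter_flatten -map_comp. Qed.

Lemma eq_row_cells T T' d c : (forall i e, is_cell T i e = is_cell T' i e) ->
  row_cells T d c = row_cells T' d c.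
Proof. by move=> h; apply: eq_filter => x; apply: h. Qed.

Lemma eq_stages T T' d : (forall i e, is_cell T i e = is_cell T' i e) ->
  size T = size T' -> stages T d = stages T' d.
Proof. by move=> h s; congr flatten; apply: eq_map => e; rewrite (eq_row_cells _ _ h) s. Qed.

(* The letter [k] falls in the row [j] between the columns [d] and [d.+1]. *)
Definition cov (T : filling) d k j :=
  [&& is_cell T j d, entry T j d <= k & is_cell T j d.+1 ==> (k < entry T j d.+1)].

(** The rows above [c] have refused [k] for column d.+1 in this stage, and those below [c] have
    refused it for d.+2 in the previous one. These refusals give the triple condition at the new
    entry, and the bumped letter inherits both. *)
Lemma syct_swap T c d k : syct T -> uniq (k :: flatten T) -> is_cell T c d.+1 ->
    entry T c d <= k < entry T c d.+1 ->
    (forall j, c < j -> ~~ cov T d k j) -> (forall i, i < c -> ~~ cov T d.+1 k i) ->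
  [/\ syct (set_row T c (set_nth 0 (nth [::] T c) d.+1 k)),
      forall j, c <= j -> ~~ cov (set_row T c (set_nth 0 (nth [::] T c) d.+1 k)) d (entry T c d.+1) j
    & forall i, i < c -> ~~ cov (set_row T c (set_nth 0 (nth [::] T c) d.+1 k)) d.+1 (entry T c d.+1) i].
Proof.
move=> sT uk cd1 /andP[lek ltk] I3 I4; set T' := set_row _ _ _; set e := entry T c d.+1.
have cell i f : is_cell T' i f = is_cell T i f by apply: is_cell_set_entry.
have ent i f : entry T' i f = if (i == c) && (f == d.+1) then k else entry T i f.
  exact: entry_set_entry.
have neT i f : is_cell T i f -> entry T i f != k.
  move=> ci; apply: contraTneq uk => <-; rewrite /= negb_and.
  by rewrite entry_in.
have I3' j : c < j -> is_cell T j d -> entry T j d <= k ->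
    is_cell T j d.+1 && (entry T j d.+1 < k).
  move=> cj jd le; have := I3 j cj; rewrite /cov jd le /= negb_imply -leqNgt.
  by case/andP=> jd1 h; rewrite jd1 ltn_neqAle neT.
have tri := syct_triple sT.
have low i : i < c -> is_cell T i d.+1 -> entry T i d.+1 < e -> entry T i d.+1 < k.
  move=> ic i1 lt; apply: leq_trans lek; rewrite ltnNge; apply/negP => le.
  by have := tri i c d ic (is_cellS cd1) i1 le; rewrite cd1 /=; rewrite -/e; lia.
have low2 i : i < c -> is_cell T i d.+2 -> entry T i d.+1 < k -> entry T i d.+2 < k.
  move=> ic i2 lt; have := I4 i ic; rewrite /cov (is_cellS i2) i2 (ltnW lt) /= -leqNgt => le.
  by rewrite ltn_neqAle neT.
split.
- split.
  + move=> i; rewrite cell size_set_row ?(is_cell_size cd1) //; exact: (syct_cell0 sT).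
  + move=> i f; rewrite cell !ent => ci; have := syct_row sT ci.
    case: (eqVneq i c) => [ic|//] /=; subst i; rewrite eqSS.
    case: (eqVneq f d.+1) => [fd|nf]; subst.
      by rewrite (_ : (d.+1 == d) = false) //=; [lia | lia].
    by case: (eqVneq f d) => // ->; move: (neT c d (is_cellS cd1)); lia.
  + move=> i j ij; rewrite cell !ent !andbF; exact: (syct_head sT).
  + move=> i j f ij; rewrite !cell !ent => cj ci.
    case: (eqVneq i c) => [ic|ni] /=.
      subst i; rewrite (gtn_eqF ij) /= eqSS.
      case: (eqVneq f d) => [fd|nf]; last exact: tri.
      by subst f => /(I3' _ ij cj).
    case: (eqVneq j c) => [jc|nj] /=; last exact: tri.
    subst j; rewrite eqSS; case: (eqVneq f d.+1) => [fd|nf].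
      subst f; rewrite (_ : (d.+1 == d) = false) //=; last by lia.
      move=> ke; have [lt|le] := ltnP (entry T i d.+2) e.
        have := low2 i ij ci; have := low i ij (is_cellS ci); have := syct_row sT ci; lia.
      by apply: tri.
    case: (eqVneq f d) => [fd|nf']; last exact: tri.
    subst f; move=> le; have := tri i c d ij cj ci le; rewrite cd1 -/e /=.
    by apply: ltn_trans.
- move=> j; rewrite /cov !cell !ent leq_eqVlt => /orP[/eqP <-|cj].
    by apply/negP => /and3P[_ _]; rewrite !eqxx cd1 /= ltnNge (ltnW ltk).
  rewrite (gtn_eqF cj) /=; apply/negP => /and3P[j0 le h].
  have := tri c j d cj j0 cd1 le => /andP[j1 lt]; move: h; rewrite j1 /=.
  by rewrite ltnNge (ltnW lt).
move=> i ic; rewrite /cov !cell !ent (ltn_eqF ic) /=; apply/negP => /and3P[i1 le h].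
have lt : entry T i d.+1 < e.
  rewrite ltn_neqAle le andbT; apply/eqP => ee.
  have u : uniq (flatten T) by case/andP: uk.
  by have [ic' _] := entry_inj u i1 cd1 ee; rewrite ic' ltnn in ic.
have lk := low i ic i1 lt; have := I4 i ic; rewrite /cov i1 (ltnW lk) /= negb_imply => /andP[i2].
by rewrite i2 /= in h; rewrite -leqNgt; rewrite -/e in h; lia.
Qed.

Lemma syct_append T c d k : syct T -> uniq (k :: flatten T) ->
    is_cell T c d -> ~~ is_cell T c d.+1 -> entry T c d <= k ->
    (forall j, c < j -> ~~ cov T d k j) -> (forall i, i < c -> ~~ cov T d.+1 k i) ->
  syct (set_row T c (rcons (nth [::] T c) k)).
Proof.
move=> sT uk cd cd1 lek I3 I4; set T' := set_row _ _ _.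
have cT := is_cell_size cd.
have sz : size (nth [::] T c) = d.+1.
  by apply/eqP; rewrite eqn_leq; move: cd cd1; rewrite /is_cell -leqNgt => -> ->.
have cell i f : is_cell T' i f = is_cell T i f || ((i == c) && (f == d.+1)).
  by rewrite is_cell_append ?sz.
have ent i f : entry T' i f = if (i == c) && (f == d.+1) then k else entry T i f.
  by rewrite entry_append ?sz.
have neT i f : is_cell T i f -> entry T i f != k.
  move=> ci; apply: contraTneq uk => <-; rewrite /= negb_and.
  by rewrite entry_in.
have I3' j : c < j -> is_cell T j d -> entry T j d <= k ->
    is_cell T j d.+1 && (entry T j d.+1 < k).
  move=> cj jd le; have := I3 j cj; rewrite /cov jd le /= negb_imply -leqNgt.
  by case/andP=> jd1 h; rewrite jd1 ltn_neqAle neT.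
have tri := syct_triple sT.
have ncd2 : ~~ is_cell T c d.+2 by apply: contra cd1; apply: is_cellS.
split.
- move=> i; rewrite cell size_set_row // => /(syct_cell0 sT) -> //.
- move=> i f; rewrite cell !ent eqSS; case: (eqVneq i c) => [ic|//] /=.
    subst i; case: (eqVneq f d) => [fd|nf].
      subst f; rewrite (_ : (d == d.+1) = false) ?ltn_neqAle ?neT //; lia.
    rewrite orbF => ci; have := syct_row sT ci; case: (eqVneq f d.+1) => // fd.
    by rewrite fd (negbTE ncd2) in ci.
  by rewrite orbF => _; apply: (syct_row sT).
- move=> i j ij; rewrite cell !ent !andbF orbF; exact: (syct_head sT).
move=> i j f ij; rewrite !cell !ent.
case: (eqVneq j c) => [jc|nj] /=.
  subst j; rewrite (ltn_eqF ij) /= eqSS orbF.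
  case: (eqVneq f d.+1) => [fd|nf].
    subst f; rewrite (_ : (d.+1 == d) = false) //=; last by lia.
    rewrite orbT => _ i2 ki; exfalso.
    have i1 := is_cellS i2.
    have lt : entry T i d.+1 < entry T c d.
      rewrite ltnNge; apply/negP => le.
      by have := tri i c d ij cd i1 le; rewrite (negbTE cd1).
    case/negP: (I4 i ij); rewrite /cov i1 i2 /=; have := neT i d.+2 i2.
    by move: ki; lia.
  rewrite orbF; case: (eqVneq f d) => [fd|nf'].
    subst f => _ i1 le; exfalso.
    by have := tri i c d ij cd i1 le; rewrite (negbTE cd1).
  by rewrite orbF => cf i1 le; have := tri i c f ij cf i1 le.
rewrite !orbF; case: (eqVneq i c) => [ic|ni] /=; last by rewrite orbF; apply: tri.
subst i; rewrite eqSS; case: (eqVneq f d) => [fd|nf]; last by rewrite orbF; apply: tri.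
by subst f => cj _ /(I3' _ ij cj).
Qed.

End Scan.

Lemma nth_insert (p : nat) (T : filling) r i : p <= size T ->
  nth [::] (take p T ++ r :: drop p T) i =
  if i < p then nth [::] T i else if i == p then r else nth [::] T i.-1.
Proof.
move=> pT; rewrite nth_cat size_takel //; case: (ltnP i p) => ip; first by rewrite nth_take.
case: (eqVneq i p) => [->|ne]; first by rewrite subnn.
have -> : i - p = (i.-1 - p).+1 by lia.
by rewrite /= nth_drop; congr nth; lia.
Qed.

Section AddRow.
Variables (T : filling) (k : nat).
Let p := find (fun r => k < head 0 r) T.
Let pT : p <= size T. Proof. exact: find_size. Qed.
Let rowE i : nth [::] (add_row k T) i =
  if i < p then nth [::] T i else if i == p then [:: k] else nth [::] T i.-1.
Proof. exact: nth_insert. Qed.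

Lemma add_row_position : exists p, [/\ p <= size T,
  shape (add_row k T) = take p (shape T) ++ 1 :: drop p (shape T)
  & p = 0 -> 0 < size T -> k < entry T 0 0].
Proof.
exists p; split=> //; first by rewrite /shape map_cat /= map_take map_drop.
by rewrite /p; case: (T) => //= r s; case: ifP => // h _ _; rewrite /entry nth0.
Qed.

Lemma perm_add_row : perm_eq (flatten (add_row k T)) (k :: flatten T).
Proof.
rewrite /add_row flatten_cat /= perm_sym -/p -{1}(cat_take_drop p T) flatten_cat.
by rewrite -cat1s perm_catCA.
Qed.

Lemma reads_add_row Z : reads Z T -> Z k = 0 -> reads Z (add_row k T).
Proof.
move=> rd Zk i d; rewrite /is_cell /entry rowE; case: ifP => _; first exact: rd.
by case: ifP => _; [case: d | apply: rd].
Qed.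

Lemma syct_add_row : syct T -> uniq (k :: flatten T) -> (forall j, ~~ cov T 0 k j) ->
  syct (add_row k T).
Proof.
move=> sT uk I3.
have neT i f : is_cell T i f -> entry T i f != k.
  move=> ci; apply: contraTneq uk => <-; rewrite /= negb_and.
  by rewrite entry_in.
have low i : i < p -> is_cell T i 0 -> entry T i 0 < k.
  move=> ip c0; rewrite ltn_neqAle neT //= /entry nth0.
  by have /= /negbT := before_find [::] ip; rewrite -leqNgt.
have low1 i : i < p -> is_cell T i 1 -> entry T i 1 < k.
  move=> ip c1; rewrite ltnNge; apply/negP => le; case/negP: (I3 i).
  by rewrite /cov (is_cellS c1) (ltnW (low i ip (is_cellS c1))) c1 /= ltn_neqAle eq_sym neT.
have high i : p <= i -> is_cell T i 0 -> k < entry T i 0.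
  move=> pi c0; have hp : p < size T by apply: leq_ltn_trans pi (is_cell_size c0).
  have := nth_find [::] (_ : has (fun r => k < head 0 r) T); rewrite has_find -/p => /(_ hp).
  rewrite -nth0 -/(entry T p 0); move: pi; rewrite leq_eqVlt => /orP[/eqP -> //|pi] h.
  by apply: ltn_trans h (syct_head sT pi c0).
have cellE i f : is_cell (add_row k T) i f =
    if i < p then is_cell T i f else if i == p then f == 0 else is_cell T i.-1 f.
  rewrite /is_cell rowE; case: ifP => // _; case: ifP => // _ /=; by case: f.
have entE i f : entry (add_row k T) i f =
    if i < p then entry T i f else if i == p then nth 0 [:: k] f else entry T i.-1 f.
  by rewrite /entry rowE; case: ifP => // _; case: ifP.
have sz : size (add_row k T) = (size T).+1.
  by rewrite size_cat /= size_take_min size_drop; move: pT; rewrite /p; lia.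
have tri := syct_triple sT.
split.
- move=> i; rewrite cellE sz => ilt; case: (ltngtP i p) => // ip; apply: (syct_cell0 sT); lia.
- move=> i f; rewrite cellE !entE; case: (ltngtP i p) => // ip; exact: (syct_row sT).
- move=> i j ij; rewrite cellE !entE; case: (ltngtP j p) => jp cj.
  + by rewrite (ltn_trans ij jp); apply: (syct_head sT).
  + case: (ltngtP i p) => ip.
    * by apply: (syct_head sT) => //; lia.
    * by apply: (syct_head sT) => //; lia.
    by apply: high => //; lia.
  by rewrite -jp ij in cj *; apply: low; [lia | apply: (syct_cell0 sT); lia].
move=> i j f ij; rewrite !cellE !entE; case: (ltngtP j p) => jp.
- by rewrite (ltn_trans ij jp); apply: tri.
- by case: (ltngtP i p) => ip //; apply: tri; lia.
rewrite -jp ij => /eqP -> /= c1 le; exfalso.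
by have := low1 i (leq_trans ij (eq_leq jp)) c1; lia.
Qed.

End AddRow.

(* [D] is the column of the new cell. *)
Definition shape_step (T : filling) k (T' : filling) D : Prop :=
  if D is 0 then exists p, [/\ p <= size T,
      shape T' = take p (shape T) ++ 1 :: drop p (shape T)
    & p = 0 -> 0 < size T -> k < entry T 0 0]
  else (exists c, [/\ c < size T, nth 0 (shape T) c = D
                   & shape T' = set_nth 0 (shape T) c D.+1]) /\
       (forall i e, e < D -> entry T' i e = entry T i e).

Lemma shape_step_trans T k T1 k1 T' D d : shape T1 = shape T -> k <= k1 ->
    (forall i e, e <= d -> entry T1 i e = entry T i e) -> D <= d.+1 ->
  shape_step T1 k1 T' D -> shape_step T k T' D.
Proof.
move=> sh kk1 ent Dd; have sz : size T1 = size T.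
  by rewrite -[LHS](size_map size) -[RHS](size_map size) -!/(shape _) sh.
case: D Dd => [|D] Dd /=; rewrite sh sz; last first.
  by move=> [h1 h2]; split=> // i e eD; rewrite h2 // ent //; lia.
case=> p [h1 h2 h3]; exists p; split=> // p0 T0.
by apply: leq_ltn_trans kk1 _; rewrite -ent //; apply: h3.
Qed.

Section ScanSteps.
Variables (V : seq nat).
Hypothesis uV : uniq V.

Definition scan_ok Z d T k (res : filling * nat) : Prop :=
  exists Z', [/\ syct res.1, perm_eq V (flatten res.1), reads Z' res.1,
    (forall q, estep V Z q d Z' res.2) & shape_step T k res.1 res.2].

Lemma leq_rowcnt_cell T e z : syct T -> rowcnt T e.+1 z <= rowcnt T e z.
Proof.
move=> sT; apply: rowcnt_leq => i ci le; rewrite (is_cellS ci).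
by apply: leq_trans le; apply: ltnW; apply: (syct_row sT).
Qed.

Lemma shape_nth (T : filling) c : c < size T -> nth 0 (shape T) c = size (nth [::] T c).
Proof. by move=> cT; rewrite (nth_map [::]). Qed.

Lemma shape_is_cell (T T' : filling) i e : shape T = shape T' -> is_cell T i e = is_cell T' i e.
Proof.
move=> h; have sz : size T = size T'.
  by rewrite -[LHS](size_map size) -[RHS](size_map size) -/(shape T) h.
rewrite /is_cell; case: (ltnP i (size T)) => iT; last first.
  by rewrite !nth_default // -sz.
by rewrite -!shape_nth -?sz // h.
Qed.

Lemma shape_set_row (T : filling) c r : c < size T ->
  shape (set_row T c r) = set_nth 0 (shape T) c (size r).
Proof.
move=> cT; apply: (@eq_from_nth _ 0).
  by rewrite size_map size_set_row // size_set_nth size_map (maxn_idPr _).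
move=> i; rewrite size_map size_set_row // => iT.
rewrite nth_set_nth /= !shape_nth ?size_set_row // set_rowE; by case: eqP.
Qed.

(** If no row takes [k], each row with an entry at most [k] in column d has one in column d.+1 too,
    so [k] itself is in excess; below [k] the rows keep the columns ballot. Hence the letter left at
    the end of a stage is the least violation that [estep] moves. *)
Lemma cnt_viol Z T k d : syct T -> perm_eq V (k :: flatten T) -> reads Z T ->
    Z k = d.+1 -> (forall j, ~~ cov T d k j) ->
  cnt V Z d k < cnt V Z d.+1 k /\ (forall z, z < k -> cnt V Z d.+1 z <= cnt V Z d z).
Proof.
move=> sT pV rd Zk I3; split=> [|z zk]; rewrite !(cnt_carry _ _ pV rd) Zk eqxx (gtn_eqF (ltnSn d)) /=.
  rewrite leqnn add0n ltnS; apply: rowcnt_leq => i ci le.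
  have := I3 i; rewrite /cov ci le /= negb_imply -leqNgt; by case/andP => ->.
by rewrite (leqNgt k) zk /= !add0n leq_rowcnt_cell.
Qed.

Lemma scan_stages d T k Z : syct T -> perm_eq V (k :: flatten T) -> reads Z T ->
    Z k = d -> (forall j, ~~ cov T d k j) ->
  scan_ok Z d T k (insert_scan k T (stages T d)).
Proof.
elim: d T k Z => [|d IH] T k Z sT pV rd Zk I3.
  have uk : uniq (k :: flatten T) by rewrite -(perm_uniq pV).
  exists Z; split=> /=.
  - exact: syct_add_row.
  - by rewrite (perm_trans pV) // perm_sym perm_add_row.
  - exact: reads_add_row.
  - by move=> q; apply: EstepStop.
  exact: add_row_position.
rewrite stagesS.
(* Within a stage the carried letter is swapped with entries of column d.+1, where [Z] places it as
   well, so [Z] is constant until the stage ends. The carried letter only grows and the columns up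
   to d stay intact, which preserves what [shape_step] records. *)
suff inner c : c <= size T -> forall T1 k1, shape T1 = shape T -> k <= k1 ->
    (forall i e, e <= d -> entry T1 i e = entry T i e) -> syct T1 ->
    perm_eq V (k1 :: flatten T1) -> reads Z T1 -> Z k1 = d.+1 ->
    (forall j, c <= j -> ~~ cov T1 d k1 j) -> (forall i, i < c -> ~~ cov T1 d.+1 k1 i) ->
    scan_ok Z d.+1 T k (insert_scan k1 T1 (row_cells T d c ++ stages T d)).
  apply: inner => // j; rewrite /cov; case: (boolP (is_cell T j d)) => //= /is_cell_size.
  by rewrite ltnNge => /negbTE ->.
elim: c => [|c IHc] cT T1 k1 sh kk1 ent sT1 pV1 rd1 Zk1 J3 J4.
  have uk : uniq (k1 :: flatten T1) by rewrite -(perm_uniq pV1).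
  have eqc i e : is_cell T i e = is_cell T1 i e by apply: shape_is_cell.
  have sz : size T = size T1 by rewrite -[LHS](size_map size) -[RHS](size_map size) -!/(shape _) sh.
  rewrite /row_cells /= (eq_stages _ eqc sz).
  have k1V : k1 \in V by rewrite (perm_mem pV1) mem_head.
  have [viol noviol] := cnt_viol sT1 pV1 rd1 Zk1 (fun j => J3 j (leq0n j)).
  have rd1' : reads (upd Z k1 d) T1.
    move=> i e ci; rewrite /upd; case: eqP => [ek|_]; last exact: rd1.
    by move: uk; rewrite /= -ek entry_in.
  have Zk1' : upd Z k1 d k1 = d by rewrite /upd eqxx.
  have J3' j : ~~ cov T1 d k1 j by apply: J3.
  have [Z' [h1 h2 h3 h4 h5]] := IH T1 k1 (upd Z k1 d) sT1 pV1 rd1' Zk1' J3'.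
  exists Z'; split=> //; first by move=> q; apply: (@EstepMove _ _ _ _ _ _ k1).
  by apply: (shape_step_trans sh kk1 ent _ h5); apply: leqW; apply: estep_le (h4 k1).
have cT' : c < size T1 by rewrite -(size_map size T1) -/(shape T1) sh size_map.
have uk : uniq (k1 :: flatten T1) by rewrite -(perm_uniq pV1).
rewrite row_cellsS (shape_is_cell c d (esym sh)); case: ifP => cd; last first.
  apply: IHc => // [|j|i ic]; first exact: ltnW.
    by rewrite leq_eqVlt => /orP[/eqP <-|/J3 //]; rewrite /cov cd.
  by apply: J4; apply: leqW.
rewrite cat_cons /=; case: (boolP (is_cell T1 c d.+1)) => cd1 /=.
  case: ifP => [swap|noswap].
    have J3' j : c < j -> ~~ cov T1 d k1 j by apply: J3.
    have J4' i : i < c -> ~~ cov T1 d.+1 k1 i by move=> ic; apply: J4; apply: leqW.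
    have [s1 s2 s3] := syct_swap sT1 uk cd1 swap J3' J4'.
    have cell i f := is_cell_set_entry k1 cd1 i f.
    apply: IHc => //; first exact: ltnW.
    - rewrite shape_set_row // -sh size_set_nth (maxn_idPr _) // -shape_nth //.
      apply: (@eq_from_nth _ 0); first by rewrite size_set_nth size_map (maxn_idPr _).
      by move=> i _; rewrite nth_set_nth /=; case: eqP => // ->.
    - by apply: leq_trans kk1 (ltnW _); case/andP: swap.
    - by move=> i e ed; rewrite entry_set_entry (ltn_eqF (_ : e < d.+1)) // andbF ent.
    - by rewrite (perm_trans pV1) // perm_sym flatten_set_entry.
    - move=> i f; rewrite cell entry_set_entry.
      by case: eqP => [->|_]; case: eqP => [->|_] //= ci; apply: rd1.
    exact: rd1.
  apply: IHc => // [|j|i ic]; first exact: ltnW.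
    by rewrite leq_eqVlt => /orP[/eqP <-|/J3 //]; rewrite /cov cd cd1 /= noswap.
  by apply: J4; apply: leqW.
case: ifP => [land|noland]; last first.
  apply: IHc => // [|j|i ic]; first exact: ltnW.
    by rewrite leq_eqVlt => /orP[/eqP <-|/J3 //]; rewrite /cov cd noland.
  by apply: J4; apply: leqW.
have J3' j : c < j -> ~~ cov T1 d k1 j by apply: J3.
have J4' i : i < c -> ~~ cov T1 d.+1 k1 i by move=> ic; apply: J4; apply: leqW.
have sT' := syct_append sT1 uk cd cd1 land J3' J4'.
have szc : size (nth [::] T1 c) = d.+1.
  by apply/eqP; rewrite eqn_leq; move: cd cd1; rewrite /is_cell -leqNgt => -> ->.
have pV' : perm_eq V (flatten (set_row T1 c (rcons (nth [::] T1 c) k1))).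
  by rewrite (perm_trans pV1) // perm_sym flatten_rcons_row.
have rd' : reads Z (set_row T1 c (rcons (nth [::] T1 c) k1)).
  move=> i f; rewrite is_cell_append // entry_append // szc.
  case: (eqVneq i c) => [->|_]; case: (eqVneq f d.+1) => [->|_] //=; rewrite ?orbF //; exact: rd1.
exists Z; split=> //=.
  move=> q; apply: EstepStop => z _ /=.
  by rewrite !(cnt_perm _ _ _ pV') !cnt_flatten // leq_rowcnt_cell.
split; last first.
  move=> i e ed; rewrite entry_append // szc (ltn_eqF ed) andbF ent //.
exists c; split; first by rewrite -(size_map size T) -/(shape T) -sh size_map.
  by rewrite -sh shape_nth.
by rewrite shape_set_row // size_rcons szc sh.
Qed.

Lemma insertion_ok T k Z : syct T -> perm_eq V (k :: flatten T) -> reads Z T ->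
    Z k = foldr maxn 0 (shape T) ->
  scan_ok Z (foldr maxn 0 (shape T)) T k (insertion k T).
Proof.
move=> sT pV rd Zk; rewrite /insertion scan_cells_stages; apply: scan_stages => // j.
rewrite /cov; suff -> : is_cell T j (foldr maxn 0 (shape T)) = false by [].
apply/negbTE; rewrite /is_cell -leqNgt.
elim: T j {sT pV rd Zk} => [|r T IH] [|j] //=; first by rewrite leq_maxl.
by apply: leq_trans (IH j) _; rewrite leq_maxr.
Qed.

End ScanSteps.

(** * Tableaux of words and the columns of their new cells *)

Lemma reads_column T : uniq (flatten T) -> reads (column T) T.
Proof.
move=> uT i d ci; have iT := is_cell_size ci; rewrite /column.
have hT : has (fun r => entry T i d \in r) T.
  by apply/hasP; exists (nth [::] T i); rewrite mem_nth // mem_nth.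
set j := find _ T; have jr : entry T i d \in nth [::] T j by apply: (nth_find [::] hT).
have cj : is_cell T j (index (entry T i d) (nth [::] T j)) by rewrite /is_cell index_mem.
by have [] := entry_inj uT cj ci (nth_index 0 jr).
Qed.

Lemma eq_reads Z Z' T : reads Z T -> reads Z' T -> {in flatten T, Z =1 Z'}.
Proof. by move=> r r' v /mem_flatten[i [d [c <-]]]; rewrite r ?r'. Qed.

Lemma reads_eq Z Z' T : {in flatten T, Z =1 Z'} -> reads Z T -> reads Z' T.
Proof. by move=> h r i d c; rewrite -h ?r // entry_in. Qed.

Lemma leq_max_shape T i d : is_cell T i d -> d < foldr maxn 0 (shape T).
Proof.
rewrite /is_cell; elim: T i => [|r T IH] [|i] //= h; first by rewrite leq_max h.
by rewrite leq_max (IH i) ?orbT.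
Qed.

Lemma max_shape_size (T : filling) : foldr maxn 0 (shape T) <= size (flatten T).
Proof.
by elim: T => //= r T IH; rewrite size_cat geq_max leq_addr (leq_trans IH) ?leq_addl.
Qed.

Lemma cntx_above V Z k m e z : (forall v, v \in V -> v != k -> Z v < m) -> m <= e ->
  cntx V Z k e z = 0.
Proof.
move=> lt me; apply/eqP; rewrite -leqn0 leqNgt -has_count -all_predC; apply/allP => v vV /=.
by apply/negP => /and3P[vk /eqP ve _]; have := lt v vV vk; rewrite ve ltnNge me.
Qed.

Lemma carry_start V Z k M : k \in V -> Z k = M ->
    (forall e z, cntx V Z k e.+1 z <= cntx V Z k e z) ->
    (forall v, v \in V -> v != k -> Z v < M) -> carry V Z k M.
Proof. by move=> kV Zk yam lt; split; rewrite // !(cntx_above _ lt). Qed.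

Lemma estep_label V c p q d c' D : estep V c p d c' D -> estep V c q d c' D.
Proof.
case=> [{}c {}p {}d h|{}c {}p {}d {}c' {}D y h1 h2 h3 h4 h5]; first exact: EstepStop.
exact: EstepMove h1 h2 h3 h4 h5.
Qed.

(** From column m on there is no letter but [k], which is thus the least violation each time and
    passes on. Insertions into tableaux of different widths can so start from one column. *)
Lemma estep_start V Z k q m M Z' D : uniq V -> k \in V -> m <= M ->
    (forall v, v \in V -> v != k -> Z v < m) ->
  estep V (upd Z k m) k m Z' D -> estep V (upd Z k M) q M Z' D.
Proof.
move=> uV kV; elim: M q => [|M IH] q.
  by rewrite leqn0 => /eqP -> _; apply: estep_label.
rewrite leq_eqVlt => /orP[/eqP -> _|mM lt st]; first exact: estep_label.
have updK : upd (upd Z k M.+1) k M = upd Z k M.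
  by apply: funext => v; rewrite /upd; case: eqP.
have E e z : m <= e -> cnt V (upd Z k M.+1) e z = (M.+1 == e) && (k <= z) :> nat.
  move=> me; rewrite (cnt_cntx uV _ e z kV) cntx_upd (cntx_above _ lt) // add0n.
  by rewrite {1}/upd eqxx.
have mM1 : m <= M by [].
apply: (@EstepMove _ _ _ _ _ _ k) => //.
- by rewrite /upd eqxx.
- by rewrite !E ?leqW // eqxx leqnn gtn_eqF.
- by move=> z zk; rewrite !E ?leqW // eqxx gtn_eqF //= (leqNgt k z) zk.
by rewrite updK; apply: IH.
Qed.

Lemma cntx_flatten V Z T k e z : uniq V -> perm_eq V (k :: flatten T) -> reads Z T ->
  cntx V Z k e z = rowcnt T e z.
Proof.
move=> uV pV rd; have kV : k \in V by rewrite (perm_mem pV) mem_head.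
have := cnt_cntx uV Z e z kV; rewrite (cnt_carry _ _ pV rd); lia.
Qed.

Lemma insertion_estep T k Z M : syct T -> uniq (k :: flatten T) -> reads Z T ->
    Z k = M -> foldr maxn 0 (shape T) <= M -> forall V, perm_eq V (k :: flatten T) ->
  exists Z', [/\ syct (insertion k T).1, perm_eq V (flatten (insertion k T).1),
    reads Z' (insertion k T).1, carry V Z k M /\ estep V Z k M Z' (insertion k T).2
  & shape_step T k (insertion k T).1 (insertion k T).2].
Proof.
move=> sT uk rd Zk mM V pV; set m := foldr maxn 0 (shape T) in mM.
have uV : uniq V by rewrite (perm_uniq pV).
have kV : k \in V by rewrite (perm_mem pV) mem_head.
have VT v : v \in V -> v != k -> v \in flatten T.
  by rewrite (perm_mem pV) inE => /orP[/eqP ->|//]; rewrite eqxx.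
have lt v : v \in V -> v != k -> Z v < m.
  by move=> vV vk; have /mem_flatten[i [d [c <-]]] := VT v vV vk; rewrite rd //; exact: leq_max_shape c.
have rdm : reads (upd Z k m) T.
  move=> i d c; rewrite /upd; case: eqP => [ek|_]; last exact: rd.
  by move: uk; rewrite /= -ek entry_in.
have Zm : upd Z k m k = m by rewrite /upd eqxx.
have [Z' [h1 h2 h3 h4 h5]] := insertion_ok uV sT pV rdm Zm.
exists Z'; split=> //; split.
  apply: carry_start => // [e z|v vV vk]; last exact: leq_trans (lt v vV vk) mM.
  by rewrite !(cntx_flatten _ _ uV pV rd) leq_rowcnt_cell.
have -> : Z = upd Z k M by apply: funext => v; rewrite /upd; case: eqP => // ->.
exact: estep_start uV kV mM lt (h4 k).
Qed.

Lemma insertion_trace T k M : syct T -> uniq (k :: flatten T) ->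
    foldr maxn 0 (shape T) <= M ->
  exists kk, ins_trace (rowcnt T) (rowcnt (insertion k T).1) k M (insertion k T).2 kk.
Proof.
move=> sT uk mM; pose Z := upd (column T) k M.
have uT : uniq (flatten T) by case/andP: uk.
have rd : reads Z T.
  move=> i d c; rewrite /Z /upd; case: eqP => [ek|_]; last exact: reads_column.
  by move: uk; rewrite /= -ek entry_in.
have Zk : Z k = M by rewrite /Z /upd eqxx.
have [Z' [sT' pT' rd' [cq st] _]] := insertion_estep sT uk rd Zk mM (perm_refl _).
have [kk tr] := estep_trace uk st cq; exists kk.
have e1 : rowcnt T = cntx (k :: flatten T) Z k.
  by apply: funext => e; apply: funext => z; rewrite (cntx_flatten _ _ uk (perm_refl _) rd).
have e2 : rowcnt (insertion k T).1 = cnt (k :: flatten T) Z'.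
  by apply: funext => e; apply: funext => z; rewrite (cnt_perm _ _ _ pT') cnt_flatten.
by rewrite e1 e2.
Qed.

Definition insP (w : seq nat) : filling := (PQ w).1.

Lemma PQ_rcons w k : PQ (rcons w k) = PQ_step (PQ w) ((size w).+1, k).
Proof.
have e n : iota 1 n.+1 = rcons (iota 1 n) n.+1 by rewrite -{1}(addn1 n) iotaD cats1 add1n.
by rewrite /PQ size_rcons e zip_rcons ?size_iota // -cats1 foldl_cat.
Qed.

Lemma insP_rcons w k : insP (rcons w k) = (insertion k (insP w)).1.
Proof.
by rewrite /insP PQ_rcons /PQ_step; case: insertion.
Qed.

Lemma syct_nil : syct [::].
Proof.
have nc i d : is_cell [::] i d = false by rewrite /is_cell nth_nil.
by split=> [|i d|i j _|i j d _]; rewrite ?nc.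
Qed.

Lemma insP_syct w : uniq w -> syct (insP w) /\ perm_eq w (flatten (insP w)).
Proof.
elim/last_ind: w => [_|w k IH]; first by split=> //; apply: syct_nil.
rewrite rcons_uniq => /andP[kw uw]; have [sT pT] := IH uw.
have uk : uniq (k :: flatten (insP w)) by rewrite /= -(perm_mem pT) kw -(perm_uniq pT).
pose M := foldr maxn 0 (shape (insP w)).
pose Z := upd (column (insP w)) k M.
have uT : uniq (flatten (insP w)) by case/andP: uk.
have rd : reads Z (insP w).
  move=> i d c; rewrite /Z /upd; case: eqP => [ek|_]; last exact: reads_column.
  by move: uk; rewrite /= -ek entry_in.
have Zk : Z k = M by rewrite /Z /upd eqxx.
have [Z' [sT' pT' _ _ _]] := insertion_estep sT uk rd Zk (leqnn M) (perm_refl _).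
rewrite insP_rcons; split=> //; apply: perm_trans pT'.
by rewrite perm_rcons perm_cons.
Qed.

Definition Dstep w k := (insertion k (insP w)).2.
Definition Dseq (w : seq nat) := [seq Dstep (take i w) (nth 0 w i) | i <- iota 0 (size w)].

Lemma Dseq_rcons w k : Dseq (rcons w k) = rcons (Dseq w) (Dstep w k).
Proof.
rewrite /Dseq size_rcons -(addn1 (size w)) iotaD map_cat cats1 /= add0n.
have -> : take (size w) (rcons w k) = w by rewrite -cats1 take_size_cat.
rewrite nth_rcons ltnn eqxx; congr rcons; apply/eq_in_map => i.
by rewrite mem_iota /= => iw; rewrite -cats1 takel_cat ?(ltnW iw) // nth_cat iw.
Qed.

Lemma size_Dseq w : size (Dseq w) = size w.
Proof. by rewrite size_map size_iota. Qed.

Section Word.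
Variable w : seq nat.
Hypothesis uw : uniq w.

Lemma insP_uniq : uniq (flatten (insP w)).
Proof. by have [_ /perm_uniq <-] := insP_syct uw. Qed.

Lemma mem_insP v : (v \in flatten (insP w)) = (v \in w).
Proof. by have [_ /perm_mem ->] := insP_syct uw. Qed.

Lemma insP_max : foldr maxn 0 (shape (insP w)) <= size w.
Proof. by have [_ /perm_size ->] := insP_syct uw; apply: max_shape_size. Qed.

Lemma Dstep_estep k Z V M : uniq (rcons w k) -> perm_eq V (k :: w) ->
    {in w, column (insP w) =1 Z} -> Z k = M -> size w <= M ->
  exists Z', [/\ carry V Z k M, estep V Z k M Z' (Dstep w k)
    & {in V, column (insP (rcons w k)) =1 Z'}].
Proof.
move=> uwk pV eZ Zk wM; have [sT pT] := insP_syct uw.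
have uk : uniq (k :: flatten (insP w)).
  by rewrite /= mem_insP insP_uniq andbT; move: uwk; rewrite rcons_uniq => /andP[].
have rd : reads Z (insP w).
  by apply: reads_eq (reads_column insP_uniq) => v; rewrite mem_insP; apply: eZ.
have mM := leq_trans insP_max wM.
have pV' : perm_eq V (k :: flatten (insP w)) by rewrite (perm_trans pV) // perm_cons.
have [Z' [sT' pT' rd' [cq st] _]] := insertion_estep sT uk rd Zk mM pV'.
exists Z'; split=> //; rewrite insP_rcons => v; rewrite (perm_mem pT').
move=> vT; apply: (eq_reads _ rd' vT); apply: reads_column.
by rewrite -(perm_uniq pT') (perm_uniq pV').
Qed.

End Word.

(** Insertion is undone from the last letter: started from a column common to both words,
    [estep_inj] recovers that letter and the columns before its insertion. *)
Lemma Dseq_inj w1 w2 : uniq w1 -> perm_eq w1 w2 -> Dseq w1 = Dseq w2 ->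
  {in w1, column (insP w1) =1 column (insP w2)} -> w1 = w2.
Proof.
move: {2}(size w1) (erefl (size w1)) => n; elim: n w1 w2 => [|n IH] w1 w2.
  by move/size0nil => -> _ /perm_size/esym/size0nil ->.
case/lastP: w1 => // u1 k1; rewrite size_rcons => -[n1] uw1 p12.
have := perm_size p12; case/lastP: w2 p12 => [|u2 k2]; first by rewrite size_rcons.
rewrite !size_rcons => p12 [sz]; rewrite !Dseq_rcons => /rcons_inj[eD eDk] eC.
have uw2 : uniq (rcons u2 k2) by rewrite -(perm_uniq p12).
have [k1u uu1] : k1 \notin u1 /\ uniq u1 by move: uw1; rewrite rcons_uniq => /andP.
have [k2u uu2] : k2 \notin u2 /\ uniq u2 by move: uw2; rewrite rcons_uniq => /andP.
pose Z1 := upd (column (insP u1)) k1 n; pose Z2 := upd (column (insP u2)) k2 n.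
pose V := k1 :: u1.
have e1 : {in u1, column (insP u1) =1 Z1}.
  by move=> v vu; rewrite /Z1 /upd; case: eqP => // vk; rewrite -vk vu in k1u.
have e2 : {in u2, column (insP u2) =1 Z2}.
  by move=> v vu; rewrite /Z2 /upd; case: eqP => // vk; rewrite -vk vu in k2u.
have pV : perm_eq V (k2 :: u2).
  have h1 : perm_eq V (rcons u1 k1) by rewrite perm_sym perm_rcons.
  by apply: perm_trans h1 (perm_trans p12 _); rewrite perm_rcons.
have Zk1 : Z1 k1 = n by rewrite /Z1 /upd eqxx.
have Zk2 : Z2 k2 = n by rewrite /Z2 /upd eqxx.
have sz1 : size u1 <= n by rewrite n1.
have sz2 : size u2 <= n by rewrite -sz n1.
have [Z1' [c1 s1 f1]] := Dstep_estep uu1 uw1 (perm_refl V) e1 Zk1 sz1.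
have [Z2' [c2 s2 f2]] := Dstep_estep uu2 uw2 pV e2 Zk2 sz2.
have uV : uniq V by rewrite /= k1u.
rewrite -eDk in s2.
have eZ : {in V, Z1' =1 Z2'}.
  by move=> v vV; rewrite -f1 // -f2 // eC // mem_rcons.
have [kk eZ12] := estep_inj uV s1 c1 s2 c2 eZ.
subst k2; congr rcons; apply: IH => //.
  by move: p12; rewrite -!cats1 perm_cat2r.
move=> v vu; rewrite e1 // eZ12 ?inE ?vu ?orbT // e2 //.
by move: p12; rewrite -!cats1 perm_cat2r => /perm_mem <-.
Qed.

(** * Greene's theorem and descents *)

Definition trunc k (sh : seq nat) := sumn [seq minn k a | a <- sh].

Lemma count_minn n k : count (fun j => j < k) (iota 0 n) = minn k n.
Proof.
elim: n => [|n IH]; first by rewrite minn0.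
by rewrite -[in LHS](addn1 n) iotaD count_cat IH /= add0n; lia.
Qed.

Lemma uniq_row (T : filling) r : uniq (flatten T) -> r \in T -> uniq r.
Proof.
elim: T => //= s T IH; rewrite cat_uniq inE => /and3P[us _ uT] /orP[/eqP -> //|].
exact: IH.
Qed.

(** A colour meets a row at most once, since columns strictly increase with the entries of a row; so
    a row of length a has at most [minn k a] coloured letters. The columns themselves, taken as
    colours, attain this bound. *)
Lemma colorable_tableau T Z k N : syct T -> uniq (flatten T) -> reads Z T ->
  colorable (flatten T) Z k N <-> N <= trunc k (shape T).
Proof.
move=> sT uT rd; split=> [[f [fP fN]]|le]; last first.
  exists Z; split=> [u v _ _ ->//|]; apply: leq_trans le (eq_leq _).
  rewrite count_flatten /trunc /shape -map_comp; congr sumn; apply/eq_in_map => r rT /=.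
  rewrite -count_minn -{2}[r](mkseq_nth 0) count_map; apply: eq_in_count => j.
  rewrite mem_iota /= => jr; have := rd (index r T) j.
  by rewrite /is_cell /entry nth_index // => ->.
apply: leq_trans fN _; rewrite count_flatten /trunc /shape -map_comp.
suff : {in T, forall r, count (fun v => f v < k) r <= minn k (size r)}.
  elim: (T) => //= r s IH h; apply: leq_add; first by apply: h; rewrite mem_head.
  by apply: IH => x xs; apply: h; rewrite inE xs orbT.
move=> r rT; rewrite leq_min count_size andbT -size_filter -(size_map f).
rewrite -[X in _ <= X](size_iota 0 k); apply: uniq_leq_size; last first.
  by move=> c /mapP[v]; rewrite mem_filter mem_iota => /andP[fv _] ->.
have iT : index r T < size T by rewrite index_mem.
have rE : nth [::] T (index r T) = r by rewrite nth_index.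
have ur : uniq r by apply: uniq_row rT.
rewrite map_inj_in_uniq ?filter_uniq // => u v.
rewrite !mem_filter => /andP[fu ur'] /andP[fv vr'] fuv.
have key (x y : nat) : x \in r -> y \in r -> f x = f y -> f x < k -> x < y -> False.
  move=> xr yr fxy fx xy.
  have xT : x \in flatten T by apply/flattenP; exists r.
  have yT : y \in flatten T by apply/flattenP; exists r.
  have := fP y x yT xT (esym fxy); rewrite -fxy => /(_ fx xy).
  have cx : is_cell T (index r T) (index x r) by rewrite /is_cell rE index_mem.
  have cy : is_cell T (index r T) (index y r) by rewrite /is_cell rE index_mem.
  have := rd _ _ cx; have := rd _ _ cy; rewrite /entry rE !nth_index // => -> ->.
  have mono m i : is_cell T (index r T) (i + m) -> entry T (index r T) i <= entry T (index r T) (i + m).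
    elim: m => [|m IH]; first by rewrite addn0.
    rewrite addnS => c; apply: leq_trans (IH (is_cellS c)) (ltnW _); exact: (syct_row sT).
  move=> le; have := mono (index x r - index y r) (index y r).
  by rewrite subnKC // => /(_ cx); rewrite /entry rE !nth_index // leqNgt xy.
by case: (ltngtP u v) => // uv; [case: (key u v) | case: (key v u) => //; rewrite -fuv].
Qed.

Lemma estep_nonincr V col q d col' D v : estep V col q d col' D -> col' v <= col v.
Proof.
elim=> // {}col {}q {}d {}col' {}D y yV cy _ _ _ IH; apply: leq_trans IH _.
by rewrite /upd; case: eqP => // ->; rewrite cy.
Qed.

Section WordInvariant.
Variables (w : seq nat) (P : (nat -> nat) -> Prop).
Hypothesis uw : uniq w.
Hypothesis Pext : forall Z Z', {in w, Z =1 Z'} -> P Z -> P Z'.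
Hypothesis Pstep : forall V Z Z' q d D, uniq V -> {subset V <= w} ->
  (forall v, v \in w -> v \notin V -> d < Z v) -> (forall v, v \in V -> Z v <= d) ->
  carry V Z q d -> estep V Z q d Z' D -> (P Z <-> P Z').

Lemma insP_invariant : P (index^~ w) <-> P (column (insP w)).
Proof.
(* Initially the letter at position p is alone in column p. The letter at position j starts its
   insertion in column j, beyond the letters already inserted and before those still waiting, so
   each insertion is a sequence of moves on the whole word. *)
pose c j v := if v \in take j w then column (insP (take j w)) v else index v w.
have PE Z Z' : {in w, Z =1 Z'} -> (P Z <-> P Z').
  by move=> h; split; apply: Pext => // v vw; rewrite h.
have step j : j <= size w -> (P (index^~ w) <-> P (c j)).
  elim: j => [_|j IH jw]; first by apply: PE => v _; rewrite /c take0.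
  rewrite IH; last exact: ltnW.
  set k0 := nth 0 w j; set u := take j w.
  have tk : take j.+1 w = rcons u k0 by rewrite (take_nth 0).
  have uk : uniq (rcons u k0) by rewrite -tk take_uniq.
  have [k0u uu] : k0 \notin u /\ uniq u by move: uk; rewrite rcons_uniq => /andP.
  have szu : size u = j by rewrite size_takel // ltnW.
  have idx v : v \in w -> (v \in take j.+1 w) = (index v w <= j).
    by move=> vw; rewrite in_take.
  have e1 : {in u, column (insP u) =1 c j} by move=> v vu; rewrite /c -/u vu.
  have ck : c j k0 = j by rewrite /c -/u (negbTE k0u) /k0 index_uniq.
  have le : size u <= j by rewrite szu.
  have [Z' [cq st eZ]] := Dstep_estep uu uk (perm_refl (k0 :: u)) e1 ck le.
  have sub v : v \in k0 :: u -> v \in take j.+1 w by rewrite tk mem_rcons.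
  have sub' v : v \in take j.+1 w -> v \in k0 :: u by rewrite tk mem_rcons.
  have big v : v \in w -> v \notin k0 :: u -> j < c j v.
    move=> vw nv; have nv' : v \notin take j.+1 w by apply: contra nv; apply: sub'.
    have nu : v \notin u by apply: contra nv => vu; rewrite inE vu orbT.
    by rewrite /c -/u (negbTE nu); move: nv'; rewrite idx // -ltnNge.
  have small v : v \in k0 :: u -> c j v <= j.
    rewrite inE => /orP[/eqP ->|vu]; first by rewrite ck.
    rewrite /c -/u vu; move: vu; rewrite -(mem_insP uu) => /mem_flatten[i [d [ci <-]]].
    rewrite (reads_column (insP_uniq uu)) //; apply: ltnW; apply: leq_trans (leq_max_shape ci) _.
    by rewrite -szu insP_max.
  have uV : uniq (k0 :: u) by rewrite /= k0u.
  have VW : {subset k0 :: u <= w} by move=> v /sub; apply: mem_take.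
  rewrite (Pstep uV VW big small cq st); apply: PE => v vw.
  rewrite [c j.+1 v]/c tk mem_rcons; case: ifP => vV; first by rewrite eZ.
  rewrite (estep_outside st) ?vV // /c -/u; case: ifP => // vu.
  by move: vV; rewrite inE vu orbT.
have := step (size w) (leqnn _) => ->; apply: PE => v vw.
by rewrite /c take_size vw.
Qed.

End WordInvariant.

(* Greene's theorem for the sums of the first columns. *)
Lemma greene w k N : uniq w ->
  colorable w (index^~ w) k N <-> N <= trunc k (shape (insP w)).
Proof.
move=> uw; have [sT pT] := insP_syct uw.
rewrite -(colorable_tableau k N sT (insP_uniq uw) (reads_column (insP_uniq uw))).
rewrite (insP_invariant (P := fun Z => colorable w Z k N) uw).
- by split; apply: eq_mem_colorable; rewrite // perm_sym.
- by move=> Z Z'; apply: eq_in_colorable.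
move=> V Z Z' q d D uV VW big _ cq st.
by apply: estep_colorable st cq uw VW big.
Qed.

(** The order could change only if i moves out of column d.+1 where i.+1 stays, or if i.+1 moves
    into column d where i stays. The ballot condition above or below the moved letter forbids this,
    the interval up to the other letter containing that letter alone. *)
Lemma estep_desc V col q d col' D i : uniq V -> estep V col q d col' D -> carry V col q d ->
  i \in V -> i.+1 \in V -> (col' i < col' i.+1) = (col i < col i.+1).
Proof.
move=> uV st; elim: st => // {}col {}q {}d {}col' {}D y yV cy viol noviol _ IH cq iV i1V.
have cy' := carry_move uV cq yV cy viol noviol.
rewrite IH // /upd.
case: (eqVneq i y) => [iy|iy].
  rewrite (_ : (i.+1 == y) = false); last by rewrite -iy gtn_eqF.
  have ne : col i.+1 != d.+1.
    apply/eqP => c1; have := carry_ballot_up uV i.+1 cy' cy.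
    rewrite leqNgt => /negP; apply.
    rewrite [X in X < _](_ : _ = 0) -?has_count; last first.
      apply/eqP; rewrite -leqn0 leqNgt -has_count -all_predC; apply/allP => v _ /=.
      apply/negP => /andP[h /eqP cv]; have vi : v = i.+1 by lia.
      by move: cv; rewrite vi c1; lia.
    by apply/hasP; exists i.+1; rewrite // -iy c1 eqxx ?leqnn ?ltnSn.
  by rewrite iy cy -iy; lia.
case: (eqVneq i.+1 y) => // i1y.
have ne : col i != d.
  apply/eqP => c1; have := carry_ballot_down uV i cy' cy.
  rewrite leqNgt => /negP; apply.
  rewrite [X in X < _](_ : _ = 0) -?has_count; last first.
    apply/eqP; rewrite -leqn0 leqNgt -has_count -all_predC; apply/allP => v _ /=.
    apply/negP => /andP[h /eqP cv]; have vi : v = i by lia.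
    by move: cv; rewrite vi c1; lia.
  by apply/hasP; exists i; rewrite // -i1y c1 eqxx ?leqnn ?ltnSn.
by rewrite i1y cy; lia.
Qed.

Lemma insP_desc w i : uniq w -> i \in w -> i.+1 \in w ->
  (column (insP w) i < column (insP w) i.+1) = (index i w < index i.+1 w).
Proof.
move=> uw iw i1w.
have H b : (index i w < index i.+1 w) = b <-> (column (insP w) i < column (insP w) i.+1) = b.
  apply: (insP_invariant (P := fun Z => (Z i < Z i.+1) = b) uw).
    by move=> Z Z' e <-; rewrite !e.
  move=> V Z Z' q d D uV VW big small cq st.
  have [iV|iV] := boolP (i \in V); have [i1V|i1V] := boolP (i.+1 \in V).
  - by rewrite (estep_desc uV st cq).
  - rewrite (estep_outside st i1V); have := big _ i1w i1V; have := small i iV.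
    by have := estep_nonincr i st => h1 h2 h3; rewrite !(leq_ltn_trans _ h3) //; lia.
  - rewrite (estep_outside st iV); have := big _ iw iV; have := small _ i1V.
    have := estep_nonincr i.+1 st => h1 h2 h3.
    by rewrite !(ltnNge (Z i)) !(ltnW (leq_ltn_trans _ h3)) //; lia.
  by rewrite !(estep_outside st).
by apply/H.
Qed.

Lemma rowcnt_max T e z : foldr maxn 0 (shape T) <= e -> rowcnt T e z = 0.
Proof.
move=> h; apply/eqP; rewrite -leqn0 leqNgt -has_count -all_predC; apply/allP => r rT /=.
apply/negP => /andP[er _].
have := @leq_max_shape T (index r T) e; rewrite /is_cell nth_index // => /(_ er); lia.
Qed.

Lemma leq_rowcnt T e z z' : z <= z' -> rowcnt T e z <= rowcnt T e z'.
Proof. by move=> zz'; apply: sub_count => r /andP[-> /leq_trans ->]. Qed.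

Lemma insP_trace w k M : uniq (rcons w k) -> size w <= M ->
  exists kk, ins_trace (rowcnt (insP w)) (rowcnt (insP (rcons w k))) k M (Dstep w k) kk.
Proof.
rewrite rcons_uniq => /andP[kw uw] wM; have [sT pT] := insP_syct uw.
have uk : uniq (k :: flatten (insP w)) by rewrite /= mem_insP // insP_uniq // kw.
rewrite insP_rcons; apply: insertion_trace => //; exact: leq_trans (insP_max uw) wM.
Qed.

Lemma Dstep_bump w k1 k2 : uniq (rcons (rcons w k1) k2) ->
  (Dstep w k1 < Dstep (rcons w k1) k2) = (k1 < k2).
Proof.
move=> u2; have u1 : uniq (rcons w k1) by move: u2; rewrite rcons_uniq => /andP[].
have u0 : uniq w by move: u1; rewrite rcons_uniq => /andP[].
have [s0 p0] := insP_syct u0; have [s1 p1] := insP_syct u1.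
pose M := (size w).+1.
have sz1 : size (rcons w k1) <= M by rewrite size_rcons.
have sz0 : size w <= M by apply: leqnSn.
have [kk1 t1] := insP_trace u1 sz0; have [kk2 t2] := insP_trace u2 sz1.
have y0 e z : rowcnt (insP w) e.+1 z <= rowcnt (insP w) e z by apply: leq_rowcnt_cell.
have y1 e z : rowcnt (insP (rcons w k1)) e.+1 z <= rowcnt (insP (rcons w k1)) e z.
  by apply: leq_rowcnt_cell.
have e0 e z : M <= e.+1 -> rowcnt (insP w) e z = 0.
  by move=> Me; apply: rowcnt_max; apply: leq_trans (insP_max u0) _; move: Me; rewrite ltnS.
have m0 e z z' : z <= z' -> rowcnt (insP w) e z <= rowcnt (insP w) e z' by apply: leq_rowcnt.
case: (ltngtP k1 k2) => [lt|gt|eq].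
- exact: (bump_lt y0 y1 (ltn0Sn _) e0 t1 t2 lt).
- by apply/negbTE; rewrite -leqNgt; exact: (bump_gt y0 m0 (ltn0Sn _) t1 t2 gt).
by move: u2; rewrite eq rcons_uniq mem_rcons mem_head.
Qed.

(** * Recovering a tableau and a word from columns *)

Lemma count_ltn (s : seq nat) (p q : pred nat) x :
    {in s, forall y, p y -> q y} -> x \in s -> q x -> ~~ p x -> count p s < count q s.
Proof.
move=> pq xs qx px; rewrite -[count q s]size_filter -(count_predC p) !count_filter.
rewrite (@eq_in_count _ (predI p q) p) => [|y ys /=]; last first.
  by case: (boolP (p y)) => //= /(pq y ys).
by rewrite -[X in X < _]addn0 ltn_add2l -has_count; apply/hasP; exists x; rewrite //= px.
Qed.

Lemma rowcnt_iota T e z :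
  rowcnt T e z = count (fun j => is_cell T j e && (entry T j e <= z)) (iota 0 (size T)).
Proof. by rewrite /rowcnt -{1}[T](mkseq_nth [::]) count_map. Qed.

(* The lowest row where the next columns differ gives different counts: its
   smaller end is covered by no other row of the tableau that contains it. *)
Lemma syct_unique_row T T' d i : syct T -> syct T' -> size T = size T' ->
    (forall j, is_cell T j d = is_cell T' j d) ->
    (forall j, is_cell T j d -> entry T j d = entry T' j d) ->
    (forall j, j < i -> is_cell T j d.+1 = is_cell T' j d.+1) ->
    (forall j, j < i -> is_cell T j d.+1 -> entry T j d.+1 = entry T' j d.+1) ->
    (forall z, rowcnt T d.+1 z = rowcnt T' d.+1 z) ->
    is_cell T i d.+1 -> is_cell T' i d.+1 && (entry T' i d.+1 <= entry T i d.+1).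
Proof.
move=> sT sT' sz cd ed cd1 ed1 cnt ci; apply: contraT => h.
have := cnt (entry T i d.+1); rewrite !rowcnt_iota -sz.
set y := entry T i d.+1; move/eqP; rewrite eq_sym ltn_eqF //.
apply: (@count_ltn _ _ _ i) => //=.
- move=> j jT /andP[c' e']; case: (ltngtP j i) => ji.
  + by rewrite (cd1 j ji) c' (ed1 j ji) ?(cd1 j ji).
  + have cj : is_cell T j d by rewrite cd (is_cellS c').
    have le : entry T j d <= y.
      by rewrite ed //; apply: leq_trans e'; apply: ltnW; apply: (syct_row sT').
    by have /andP[-> /ltnW ->] := syct_triple sT ji cj ci le.
  by rewrite ji ci leqnn.
- by rewrite mem_iota /= (is_cell_size ci).
- by rewrite ci leqnn.
Qed.

Lemma syct_size T Z z : syct T -> reads Z T -> {in flatten T, forall v, v <= z} ->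
  size T = cnt (flatten T) Z 0 z.
Proof.
move=> sT rd h; rewrite cnt_flatten // rowcnt_iota -[LHS](size_iota 0) -[LHS]count_predT.
apply: eq_in_count => j; rewrite mem_iota /= => jT.
by have c := syct_cell0 sT jT; rewrite c h // entry_in.
Qed.

(** Columns are rebuilt from left to right: the first one is sorted, and each next one follows from
    its counts row by row, from the bottom up. *)
Lemma syct_unique T T' Z : syct T -> syct T' -> uniq (flatten T) ->
  perm_eq (flatten T) (flatten T') -> reads Z T -> reads Z T' -> T = T'.
Proof.
move=> sT sT' uT pT rd rd'.
have cntE e z : rowcnt T e z = rowcnt T' e z.
  by rewrite -!(cnt_flatten _ _ rd) -(cnt_flatten _ _ rd') (cnt_perm _ _ _ pT).
pose m := \max_(v <- flatten T) v.
have hm : {in flatten T, forall v, v <= m} by move=> v vT; exact: (@leq_bigmax_seq _ _ xpredT id v).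
have hm' : {in flatten T', forall v, v <= m} by move=> v; rewrite -(perm_mem pT); apply: hm.
have sz : size T = size T'.
  by rewrite (syct_size sT rd hm) (syct_size sT' rd' hm') (cnt_perm _ _ _ pT).
have key d : (forall j, is_cell T j d = is_cell T' j d) /\
             (forall j, is_cell T j d -> entry T j d = entry T' j d).
  elim: d => [|d [cd ed]].
    have c0 j : is_cell T j 0 = is_cell T' j 0.
      apply/idP/idP => /is_cell_size h; first by apply: (syct_cell0 sT'); rewrite -sz.
      by apply: (syct_cell0 sT); rewrite sz.
    split=> // j cj; have jT := is_cell_size cj.
    pose f (U : filling) := [seq entry U i 0 | i <- iota 0 (size U)].
    have srt (U : filling) : syct U -> sorted ltn (f U).
      move=> sU; apply/(sortedP 0) => i; rewrite size_map size_iota => iU.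
      rewrite !(nth_map 0) ?size_iota ?(ltnW iU) // !nth_iota ?(ltnW iU) //.
      by apply: (syct_head sU); [rewrite !add0n | apply: (syct_cell0 sU)].
    have fmem (U : filling) v : syct U -> reads Z U -> (v \in f U) = (v \in flatten U) && (Z v == 0).
      move=> sU rU; apply/mapP/andP => [[ i]|[/mem_flatten[i [e [ci <-]]]]].
        rewrite mem_iota /= => iU ->; have c := syct_cell0 sU iU.
        by rewrite entry_in // rU.
      by rewrite rU // => /eqP e0; exists i; rewrite ?mem_iota ?(is_cell_size ci) ?e0.
    have ff : f T = f T'.
      apply: (irr_sorted_eq ltn_trans ltnn (srt T sT) (srt T' sT')) => v.
      by rewrite !fmem // (perm_mem pT).
    have := congr1 (nth 0 ^~ j) ff.
    by rewrite /= /f -sz !(nth_map 0) ?size_iota // nth_iota.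
  have row j : (is_cell T j d.+1 = is_cell T' j d.+1) /\
               (is_cell T j d.+1 -> entry T j d.+1 = entry T' j d.+1).
    elim/ltn_ind: j => j IH.
    have h1 : is_cell T j d.+1 -> is_cell T' j d.+1 && (entry T' j d.+1 <= entry T j d.+1).
      by apply: syct_unique_row => // l lj; have [] := IH l lj.
    have h2 : is_cell T' j d.+1 -> is_cell T j d.+1 && (entry T j d.+1 <= entry T' j d.+1).
      apply: syct_unique_row => // [l c|l lj|l lj c].
      - by rewrite ed // cd.
      - by have [-> _] := IH l lj.
      by have [e1 e2] := IH l lj; rewrite e2 // e1.
    have cE : is_cell T j d.+1 = is_cell T' j d.+1 by apply/idP/idP => [/h1|/h2] /andP[].
    split=> // c; apply/eqP; rewrite eqn_leq; case/andP: (h1 c) => c' ->.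
    by case/andP: (h2 c') => _ ->.
  by split=> j; have [] := row j.
apply: (@eq_from_nth _ [::]) => // i iT; apply: (@eq_from_nth _ 0).
  apply/eqP; rewrite eqn_leq; apply/andP; split; rewrite leqNgt; apply/negP => h.
    by have := (key (size (nth [::] T' i))).1 i; rewrite /is_cell h ltnn.
  by have := (key (size (nth [::] T i))).1 i; rewrite /is_cell h ltnn.
by move=> d di; have := (key d).2 i; apply.
Qed.

Lemma estep_det V col q d col1 D1 col2 D2 :
  estep V col q d col1 D1 -> estep V col q d col2 D2 -> col1 = col2 /\ D1 = D2.
Proof.
move=> st1; elim: st1 col2 D2 => {col q d col1 D1} 
  [col q d stop|col q d col1 D1 y yV cy viol noviol st1 IH] col2 D2 st2.
  case: (estep_case st2) => [[-> [-> _]] //|[y [d0 [dd [_ _ viol _ _]]]]].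
  by have := stop y; rewrite dd => /(_ isT); rewrite leqNgt viol.
case: (estep_case st2) => [[_ [_ stop]]|[y' [d0 [[dd] [y'V cy' viol' noviol' st2']]]]].
  by have := stop y isT; rewrite leqNgt viol.
rewrite -dd in cy' viol' noviol' st2'.
have yy' : y = y'.
  case: (ltngtP y y') => // lt; first by have := noviol' y lt; rewrite leqNgt viol.
  by have := noviol y' lt; rewrite leqNgt viol'.
by rewrite -yy' in st2'; apply: IH.
Qed.

Lemma estep_count V (uV : uniq V) col q d col' D e : estep V col q d col' D ->
  count (fun v => col' v == e) V + (d == e) = count (fun v => col v == e) V + (D == e).
Proof.
elim=> // {}col {}q {}d {}col' {}D y yV cy _ _ _ IH.
have E c : count (fun v => c v == e) V = cnt V c e (\max_(v <- V) v).
  apply: eq_in_count => v vV; rewrite (_ : v <= _) ?andbT //.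
  exact: (@leq_bigmax_seq _ V xpredT id v).
have := cnt_upd uV col d e (\max_(v <- V) v) yV.
have -> : y <= \max_(v <- V) v by exact: (@leq_bigmax_seq _ V xpredT id y).
rewrite !andbT cy -!E => h.
by apply: (@addIn (d == e)); rewrite addnAC IH addnAC h addnAC.
Qed.

(** After [D] is appended, column [D] is strictly longer than column [D.+1]: the last cell can be
    removed by reverse insertion. The other inequalities between columns come from the ballot
    condition on the column map. *)
Inductive lattice_word : seq nat -> Prop :=
| LatticeNil : lattice_word [::]
| LatticeRcons s D : lattice_word s -> count_mem D.+1 s <= count_mem D s ->
    lattice_word (rcons s D).

Lemma word_of_columns Dl V Z : uniq V -> size V = size Dl -> yam V Z -> lattice_word Dl ->
    (forall e, count (fun v => Z v == e) V = count_mem e Dl) ->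
  exists w, [/\ perm_eq w V, Dseq w = Dl & {in w, column (insP w) =1 Z}].
Proof.
move=> uV sV yZ lw; elim: lw V Z uV sV yZ => [|Dl' D lw IH corner] V Z uV sV yZ cnts.
  by exists [::]; rewrite (size0nil sV).
rewrite size_rcons in sV.
pose B := \max_(v <- V) v.
have hB : {in V, forall v, v <= B} by move=> v vV; exact: (@leq_bigmax_seq _ V xpredT id v).
(* [M] exceeds every column in use, so no letter lands there, and it is at least the length of the
   shortened word, as the insertion of [q] from column [M] requires. *)
pose M := (\max_(e <- rcons Dl' D) e + size V).+1.
have DM : D < M.
  have : D <= \max_(e <- rcons Dl' D) e.
    by apply: (@leq_bigmax_seq _ _ xpredT id D); rewrite // mem_rcons mem_head.
  by rewrite /M; lia.
have cB e : cnt V Z e B = count_mem e (rcons Dl' D).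
  by rewrite -cnts; apply: eq_in_count => v /hB ->; rewrite andbT.
have cM : count_mem M (rcons Dl' D) = 0.
  apply/eqP; rewrite -leqn0 leqNgt -has_count; apply/negP => /hasP[e eD /eqP eM].
  have : e <= \max_(e <- rcons Dl' D) e by apply: (@leq_bigmax_seq _ _ xpredT id e).
  by rewrite eM /M; lia.
have rE e : count_mem e (rcons Dl' D) = count_mem e Dl' + (D == e).
  by rewrite -cats1 count_cat /= addn0.
have corner' : cnt V Z D.+1 B < cnt V Z D B.
  by rewrite !cB !rE eqxx (ltn_eqF (ltnSn D)); lia.
have [col [q [cq st big tot]]] := estep_surj uV hB yZ corner' (ltnW DM).
have [qV colq yq bal] := cq.
pose V' := rem q V.
have pV : perm_eq V (q :: V') by apply: perm_to_rem.
have uV' : uniq V' by apply: rem_uniq.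
have sV' : size V' = size Dl' by rewrite size_rem // sV.
have cx e z : cnt V' col e z = cntx V col q e z.
  have := cnt_cntx uV col e z qV; rewrite (cnt_perm _ _ _ pV) /cnt /= -/V'; lia.
have yam' : yam V' col by move=> e z; rewrite !cx.
have cnts' e : count (fun v => col v == e) V' = count_mem e Dl'.
  have := estep_count uV e st; rewrite (seq.permP pV (fun v => col v == e)) /= colq cnts rE => h.
  apply: (@addnI (M == e)); apply: (@addIn (D == e)).
  by rewrite -h addnAC [in LHS](addnC (count_mem e Dl')).
have [w' [pw' Dw' cw']] := IH V' col uV' sV' yam' cnts'.
have uw' : uniq w' by rewrite (perm_uniq pw').
have qw' : q \notin w' by rewrite (perm_mem pw') mem_rem_uniq // inE eqxx.
have urw : uniq (rcons w' q) by rewrite rcons_uniq qw'.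
have pVw : perm_eq V (q :: w') by rewrite (perm_trans pV) // perm_cons perm_sym.
have szM : size w' <= M by rewrite (perm_size pw') sV' /M sV; lia.
have [Z' [cq' st' eZ']] := Dstep_estep uw' urw pVw cw' colq szM.
have [eZ eD] := estep_det st st'.
exists (rcons w' q); split.
- by apply: perm_trans (_ : perm_eq (q :: w') V); rewrite ?perm_rcons // perm_sym.
- by rewrite Dseq_rcons Dw' -eD.
by move=> v vw; rewrite eZ' ?eZ // (perm_mem pVw) -mem_rcons.
Qed.

(** * Insertion of an increasing segment *)

Lemma sumn_map_set_nth (f : nat -> nat) (s : seq nat) c D : c < size s ->
  sumn [seq f i | i <- set_nth 0 s c D] + f (nth 0 s c) = sumn [seq f i | i <- s] + f D.
Proof.
elim: s c => // b s IH [|c] /=; first by move=> _; lia.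
by rewrite ltnS => /IH; lia.
Qed.

Lemma trunc_step k T q T' D : shape_step T q T' D ->
  trunc k (shape T') = trunc k (shape T) + (D < k).
Proof.
case: D => [[p [_ -> _]]|D [[c [cT cD ->]] _]].
  rewrite /trunc -[in RHS](cat_take_drop p (shape T)) !map_cat !sumn_cat /=; lia.
have := @sumn_map_set_nth (minn k) (shape T) c D.+2; rewrite size_map => /(_ cT).
rewrite cD /trunc; lia.
Qed.

Lemma insertion_step w k : uniq (rcons w k) ->
  shape_step (insP w) k (insP (rcons w k)) (Dstep w k).
Proof.
rewrite rcons_uniq => /andP[kw uw]; have [sT pT] := insP_syct uw.
have uk : uniq (k :: flatten (insP w)) by rewrite /= mem_insP // insP_uniq // kw.
pose M := foldr maxn 0 (shape (insP w)).
pose Z := upd (column (insP w)) k M.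
have rd : reads Z (insP w).
  move=> i d c; rewrite /Z /upd; case: eqP => [ek|_]; last exact: reads_column (insP_uniq uw) _ _ _.
  by move: uk; rewrite /= -ek entry_in.
have Zk : Z k = M by rewrite /Z /upd eqxx.
have [Z' [_ _ _ _ h]] := insertion_estep sT uk rd Zk (leqnn M) (perm_refl _).
by rewrite insP_rcons.
Qed.

Fixpoint lands u x := if x is k :: x' then Dstep u k :: lands (rcons u k) x' else [::].

Lemma Dseq_cat u x : Dseq (u ++ x) = Dseq u ++ lands u x.
Proof.
by elim: x u => [|k x IH] u; rewrite ?cats0 // -cat_rcons IH Dseq_rcons cat_rcons.
Qed.

Lemma size_lands u x : size (lands u x) = size x.
Proof. by elim: x u => //= k x IH u; rewrite IH. Qed.

Lemma nth_lands u x j : j < size x ->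
  nth 0 (lands u x) j = Dstep (u ++ take j x) (nth 0 x j).
Proof.
elim: x u j => // k x IH u [|j] /=; first by rewrite cats0.
by rewrite ltnS => /IH ->; rewrite cat_rcons.
Qed.

Lemma sorted_lands u x : uniq (u ++ x) -> sorted ltn (lands u x) = sorted ltn x.
Proof.
case: x => //= k1 x; elim: x u k1 => //= k2 x IH u k1 ux.
rewrite IH ?cat_rcons // Dstep_bump //.
by move: ux; rewrite -!cat_rcons cat_uniq => /andP[].
Qed.

Lemma trunc_lands k u x : uniq (u ++ x) ->
  trunc k (shape (insP (u ++ x))) = trunc k (shape (insP u)) + count (fun D => D < k) (lands u x).
Proof.
elim: x u => [|q x IH] u /=; first by rewrite cats0 addn0.
rewrite -cat_rcons => ux; rewrite IH // addnA; congr (_ + _).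
by apply/trunc_step/insertion_step; move: ux; rewrite cat_uniq => /andP[].
Qed.

Lemma sorted_iota s : sorted ltn s -> {in s, forall i, i < size s} -> s = iota 0 (size s).
Proof.
move=> ss lt; apply: (irr_sorted_eq ltn_trans ltnn ss (iota_ltn_sorted 0 _)) => i.
have us : uniq s by apply: sorted_uniq ss; [apply: ltn_trans | apply: ltnn].
have sub : {subset s <= iota 0 (size s)} by move=> v /lt; rewrite mem_iota.
by have [|_ ->] := uniq_min_size us sub; rewrite ?size_iota.
Qed.

Lemma sorted_nth_geq s j c : path ltn c s -> j < size s -> c + j < nth 0 s j.
Proof.
elim: s c j => // b s IH c [|j] /= /andP[cb sb]; first by rewrite addn0.
by rewrite ltnS => /(IH b j sb); lia.
Qed.

Lemma insertion_min k T : syct T -> {in flatten T, forall v, k < v} ->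
  insertion k T = ([:: k] :: T, 0).
Proof.
move=> sT lt; rewrite /insertion.
have -> : ([:: k] :: T, 0) = (add_row k T, 0).
  rewrite /add_row; case: T sT lt => // r T sT lt /=.
  have := lt _ (@entry_in (r :: T) 0 0 (syct_cell0 sT (ltn0Sn _))).
  by rewrite /entry /= nth0 => ->.
have : {in scan_cells T, forall x, is_cell T x.1 x.2} by move=> x; rewrite mem_filter => /andP[].
elim: (scan_cells T) => //= -[c d] s IH h.
have cd := h _ (mem_head _ _); rewrite /= in cd.
have := lt _ (entry_in cd); rewrite ltnNge => /negbTE ->; rewrite /= !andbF.
by apply: IH => x xs; apply: h; rewrite inE xs orbT.
Qed.

Lemma syct_behead r T : syct (r :: T) -> syct T.
Proof.
move=> sT; split=> [i|i d|i j|i j d].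
- exact: (@syct_cell0 _ sT i.+1).
- exact: (@syct_row _ sT i.+1 d).
- exact: (@syct_head _ sT i.+1 j.+1).
exact: (@syct_triple _ sT i.+1 j.+1 d).
Qed.

Lemma rowcnt_cons r T e z :
  rowcnt (r :: T) e z = (e < size r) && (nth 0 r e <= z) + rowcnt T e z.
Proof. by []. Qed.

(* Every row with an entry in the column e below [entry T 0 e.+1] also has one in
   the column e.+1. *)
Lemma bottom_rowcnt T e : syct T -> is_cell T 0 e.+1 ->
  rowcnt T e.+1 (entry T 0 e.+1) = rowcnt T e (entry T 0 e.+1).
Proof.
move=> sT c1; apply/eqP; rewrite eqn_leq leq_rowcnt_cell //=.
apply: rowcnt_leq => -[|i] ci le; first by rewrite c1 /=.
by have /andP[-> /ltnW] := syct_triple sT (ltn0Sn i) ci c1 le.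
Qed.

(** The letter settling in column [D] exceeds the bottom entry [g] there: for [D = 0] because the
    carried letters grow, otherwise by [bottom_rowcnt] and the stopping condition. It left column
    [D.+1] as a violation, for which [g] would compensate if the bottom row ended at [D]. So the
    bottom row already has the next cell, and keeps it. *)
Lemma bottom_grow T T' q d D k : syct T -> ins_trace (rowcnt T) (rowcnt T') q d D k ->
    shape_step T q T' D -> D < d -> is_cell T 0 D -> (D = 0 -> entry T 0 0 < q) ->
  is_cell T' 0 D.+1.
Proof.
move=> sT tr st Dd cD q0; set g := entry T 0 D.
have yam e z : rowcnt T e.+1 z <= rowcnt T e z by apply: leq_rowcnt_cell.
have gk : g < k D.
  case: (posnP D) => [D0|D0].
    have m j : j <= d -> k (d - j) >= q.
      elim: j => [|j IH] jd; first by rewrite subn0 (tr_start tr).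
      apply: leq_trans (IH (ltnW jd)) _.
      have h : D <= d - j.+1 < d by lia.
      have := trace_mono tr yam h; by rewrite (_ : (d - j.+1).+1 = d - j) //; lia.
    have := m d (leqnn d); rewrite subnn -{1}D0; apply: leq_trans.
    by rewrite /g D0; apply: q0.
  have := tr_stop tr D0 g; have := @bottom_rowcnt T D.-1 sT.
  rewrite prednK // -/g => -> //; by case: (leqP (k D)) => //= _; rewrite addn1 ltnn.
have c1 : is_cell T 0 D.+1.
  have h : D <= D < d by rewrite leqnn.
  have := tr_viol tr h; rewrite (trace_mono tr yam h) addn1 ltnS; apply: contraLR => nc.
  rewrite -ltnNge; move: cD nc gk sT; rewrite /g /is_cell /entry.
  case: (T) => [//|r s] cD nc gk sT; rewrite -[nth [::] (r :: s) 0]/r in cD nc gk.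
  rewrite !rowcnt_cons (negbTE nc) cD /= (ltnW gk) add0n add1n ltnS.
  exact: leq_rowcnt_cell (syct_behead sT).
have T0 := is_cell_size c1.
have sz U : 0 < size U -> is_cell U 0 D.+1 = (D.+1 < nth 0 (shape U) 0).
  by move=> U0; rewrite shape_nth.
move: c1; rewrite sz // => c1.
case: D {tr yam Dd cD g gk} st c1 q0 sz => [[p [pT sh p0]]|D [[c [cT cD sh]] _]] c1 q0 sz.
  case: p sh p0 pT => [|p] sh p0 pT.
    by have := p0 erefl T0; have := q0 erefl; lia.
  have T'0 : 0 < size T' by rewrite -(size_map size) -/(shape T') sh; case: (T) T0.
  by rewrite sz // sh; move: T0 c1; case: (T).
have T'0 : 0 < size T' by rewrite -(size_map size) -/(shape T') sh size_set_nth; lia.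
rewrite sz // sh nth_set_nth /=; case: eqP => // c0; move: c1; rewrite -c0 in cD; rewrite cD; lia.
Qed.

(* A letter [q] is inserted in [T = b :: P] and in a tableau with column counts
   [M]: these agree with the counts of [P] from the column [t.-1] on, [t] being
   the length of the bottom row [b] of [T]. *)
Section ParallelInsertion.
Variables (b : seq nat) (P T' : filling) (N' M M' : nat -> nat -> nat).
Variables (q d D E t : nat) (k l : nat -> nat).
Let T := b :: P.
Hypotheses (sT' : syct T') (bt : size b = t) (t0 : 0 < t).
Hypothesis tr1 : ins_trace (rowcnt T) (rowcnt T') q d D k.
Hypothesis tr2 : ins_trace M M' q d E l.
Hypothesis st : shape_step T q T' D.
Hypothesis MP : forall e z, t.-1 <= e -> M e z = rowcnt P e z.


Let TP e z : t <= e -> rowcnt T e z = rowcnt P e z.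
Proof. by move=> te; rewrite rowcnt_cons bt ltnNge te. Qed.

Let TP1 z : rowcnt T t.-1 z = (nth 0 b t.-1 <= z) + rowcnt P t.-1 z.
Proof. by rewrite rowcnt_cons bt prednK // leqnn. Qed.

Let agree e z : t <= e -> rowcnt T e z = M e z.
Proof. by move=> te; rewrite TP // MP // (leq_trans (leq_pred _)). Qed.

Let T't1 z : D = t -> rowcnt T' t.-1 z = rowcnt T t.-1 z.
Proof. by move=> Dt; apply: (trace_other z tr1); left; rewrite Dt prednK. Qed.

Let T't z : D = t -> rowcnt T' t z = rowcnt P t z + (k t <= z).
Proof. by move=> Dt; have := trace_land z tr1; rewrite Dt TP. Qed.

Let T'last : D = t -> entry T' 0 t.-1 = nth 0 b t.-1.
Proof.
move=> Dt; have st1 : shape_step T q T' t by rewrite -Dt.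
by case: t t0 st1 => // t1 _ [_ ->].
Qed.

Section Landing.
Hypothesis shT' : shape T' = t.+1 :: shape P.
Hypothesis Dt : D = t.

Let c' : is_cell T' 0 t.
Proof.
have T'0 : 0 < size T' by rewrite -(size_map size) -/(shape T') shT'.
by rewrite /is_cell -shape_nth // shT' /=.
Qed.

Let g' := entry T' 0 t.

(* The new entry of the bottom row is where the column t.-1 of the rows above
   it stops dominating the column t, the carried letter being counted. *)
Let viol : rowcnt P t.-1 g' < rowcnt P t g' + (k t <= g').
Proof.
have e : is_cell T' 0 t.-1.+1 by rewrite prednK.
have := bottom_rowcnt sT' e; rewrite prednK // -/g' T't1 // T't // TP1.
suff -> : nth 0 b t.-1 <= g' by lia.
by rewrite -T'last //; have := syct_row sT' e; rewrite prednK // => /ltnW.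
Qed.

(** From column t on the two insertions see the same counts. If the second one also stopped at t,
    the ballot condition there would contradict [viol] at [g']. *)
Lemma parallel_stop : E < t.
Proof.
rewrite ltnNge; apply/negP => tE.
have Et : E <= t.
  rewrite leqNgt; apply/negP => lt.
  have := trace_stop_le tr2 tr1 (fun e z h => esym (agree z h)) lt; lia.
have {Et tE} Et : E = t by lia.
have kl : k t = l t.
  by apply: (trace_agree tr1 tr2 agree) => //; have := tr_le tr1; lia.
have E0 : 0 < E by rewrite Et.
have := tr_stop tr2 E0 g'; rewrite Et -kl !MP ?leq_pred //.
by rewrite leqNgt viol.
Qed.

Lemma parallel_rowcnt e z : t <= e -> rowcnt (behead T') e z = M' e z.
Proof.
have Et := parallel_stop; have Dd := tr_le tr1.
have kl f : t <= f -> f <= d -> k f = l f.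
  by move=> tf fd; apply: (trace_agree tr1 tr2 agree); rewrite ?tf ?fd //; lia.
have T'E f x : rowcnt T' f x = (f < t.+1) && (nth 0 (nth [::] T' 0) f <= x) + rowcnt (behead T') f x.
  case: (T') shT' => // r s [hr _]; by rewrite rowcnt_cons hr.
rewrite leq_eqVlt => /orP[/eqP <-|te]; last first.
  have := T'E e z; rewrite ltnS (leqNgt e) te /= add0n => <-.
  have [ed|ed] := leqP e d; last first.
    rewrite (trace_other z tr1) ?(trace_other z tr2); [|lia|lia].
    by rewrite agree // ltnW.
  have h1 : D < e <= d by lia.
  have h2 : E < e <= d by lia.
  have := trace_pass z tr1 h1; have := trace_pass z tr2 h2.
  rewrite (kl e) ?(ltnW te) // (kl e.-1); [|lia|lia].
  by rewrite agree ?(ltnW te) //; clear; lia.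
have h2 : E < t <= d by lia.
have h1 : E <= t.-1 < d by lia.
have := T'E t z; rewrite ltnSn -/(entry T' 0 t) -/g' T't // kl //; last by lia.
have := trace_pass z tr2 h2; rewrite (MP z (leq_pred t)) andTb.
suff -> : g' = l t.-1 by clear; lia.
have v1 := viol.
have v2 := tr_viol tr2 h1; rewrite prednK // !MP ?leq_pred // -(kl t) // in v2; last by lia.
apply/eqP; rewrite eqn_leq andbC leqNgt; apply/andP; split.
  apply/negP => lt; have := tr_min tr2 h1 lt; rewrite prednK // !MP ?leq_pred // -(kl t) //; last by lia.
  by move: v1; clear; lia.
set z1 := l t.-1 in v2 *; rewrite leqNgt; apply/negP => lt.
have y1 : rowcnt (behead T') t z1 <= rowcnt (behead T') t.-1 z1.
  have := @leq_rowcnt_cell (behead T') t.-1 z1; rewrite prednK //; apply.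
  by case: (T') sT' => // r s; apply: syct_behead.
have := T'E t z1; have := T'E t.-1 z1; rewrite -/(entry T' 0 t.-1) -/(entry T' 0 t) -/g'.
rewrite T't1 // TP1 T't // T'last // (leqNgt g') lt andbF add0n.
have -> : t.-1 < t.+1 by lia.
by move: v2 y1; clear; lia.
Qed.

End Landing.

(** The second insertion met a violation between the columns [t.-1] and t. If the new cell were not
    in the bottom row, this violation would persist in the rows of [T'] above the bottom one, which
    form a tableau. *)
Lemma parallel_land : E < t -> t <= D -> D = t /\ shape T' = t.+1 :: shape P.
Proof.
move=> Et tD; have Dd := tr_le tr1.
have Dt : D = t.
  apply/eqP; rewrite eqn_leq tD andbT leqNgt; apply/negP => lt.
  have := trace_stop_le tr1 tr2 agree lt; lia.
split=> //.
have kl : k t = l t by apply: (trace_agree tr1 tr2 agree); lia.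
have h1 : E <= t.-1 < d by lia.
have := tr_viol tr2 h1; rewrite prednK // !MP ?leq_pred // -kl.
set z1 := l t.-1 => v.
have st1 : shape_step T q T' t by rewrite -Dt.
have ent := T'last Dt; have T'E1 := T't1 z1 Dt; have T'E := T't z1 Dt; move: ent T'E1 T'E.
have : exists c, [/\ c < size T, nth 0 (shape T) c = t & shape T' = set_nth 0 (shape T) c t.+1].
  by case: t t0 st1 => // t1 _ [].
case=> -[|c] [cT ct sh] ent T1 T2; first by rewrite sh.
have sr : nth 0 (shape T') 0 = t by rewrite sh.
exfalso; move: sr ent T1 T2 sT'; rewrite /entry.
case: (T') => [|r s]; first by move/eqP; rewrite eq_sym gtn_eqF.
rewrite -[nth 0 (shape _) 0]/(size r) -[nth [::] (r :: s) 0]/r => sr ent.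
rewrite TP1 !rowcnt_cons ent sr ltnn prednK // leqnn andTb andFb add0n => T1 T2 sT''.
have := leq_rowcnt_cell t.-1 z1 (syct_behead sT''); rewrite prednK //.
by move: v T1 T2; clear; lia.
Qed.
End ParallelInsertion.

Lemma insP_min u k : uniq (rcons u k) -> all (ltn k) u ->
  insP (rcons u k) = [:: k] :: insP u /\ Dstep u k = 0.
Proof.
rewrite rcons_uniq => /andP[ku uu] /allP lt; have [sT _] := insP_syct uu.
have lt' : {in flatten (insP u), forall v, k < v} by move=> v; rewrite mem_insP //; apply: lt.
by rewrite insP_rcons /Dstep (insertion_min sT lt').
Qed.

Section ParallelInsertions.
Variables (u y : seq nat) (x0 : nat) (sh : seq nat).
Hypotheses (uw : uniq (u ++ x0 :: y)) (lt0 : all (ltn x0) u).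
Let x := rcons u x0.

Let uxy : uniq (x ++ y). Proof. by rewrite cat_rcons. Qed.

Let uuy : uniq (u ++ y).
Proof. by move: uw; rewrite -cat1s uniq_catCA /= => /andP[]. Qed.

Let take_uniqS (v : seq nat) j : uniq (v ++ y) -> j < size y ->
  uniq (rcons (v ++ take j y) (nth 0 y j)).
Proof.
move=> uv jy; rewrite rcons_cat -take_nth //.
by move: uv; rewrite -{1}(cat_take_drop j.+1 y) catA cat_uniq => /andP[].
Qed.

(** The hypothesis has two forms, one for each direction of [segment_step]: either the insertion
    with [x0] is known, or only bounds on the two landing columns are. *)
Lemma parallel_insertion : shape (insP u) = sh ->
    (forall j, j < size y ->
      (nth 0 (lands x y) j = j.+1 /\ shape (insP (x ++ take j.+1 y)) = j.+2 :: sh) \/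
      (nth 0 (lands u y) j <= j /\ j < nth 0 (lands x y) j)) ->
  forall j, j <= size y ->
    (exists b P, [/\ insP (x ++ take j y) = b :: P, size b = j.+1, shape P = sh
       & forall e z, j <= e -> rowcnt (insP (u ++ take j y)) e z = rowcnt P e z]) /\
    (forall i, i < j -> nth 0 (lands u y) i <= i /\ nth 0 (lands x y) i = i.+1).
Proof.
move=> shu H; elim=> [_|j IH jy].
  split=> //; have ux : uniq x by move: uxy; rewrite cat_uniq => /andP[].
  exists [:: x0], (insP u); rewrite take0 !cats0.
  by have [-> _] := insP_min ux lt0; split.
have [[b [P [Tb bj shP MP]]] IHl] := IH (ltnW jy).
set k := nth 0 y j in H *; pose M := size (u ++ x0 :: y).
have u1 := take_uniqS uxy jy; have u2 := take_uniqS uuy jy.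
have sz1 : size (x ++ take j y) <= M.
  by rewrite /M size_cat size_take_min /x size_rcons size_cat /=; lia.
have sz2 : size (u ++ take j y) <= M.
  by rewrite /M size_cat size_take_min size_cat /=; lia.
have [kk tr1] := insP_trace u1 sz1; have [ll tr2] := insP_trace u2 sz2.
have st := insertion_step u1.
have u1' : uniq (x ++ take j y) by move: u1; rewrite rcons_uniq => /andP[].
have [sT' _] := insP_syct u1.
have ET : x ++ take j.+1 y = rcons (x ++ take j y) k by rewrite (take_nth 0 jy) rcons_cat.
have ES : u ++ take j.+1 y = rcons (u ++ take j y) k by rewrite (take_nth 0 jy) rcons_cat.
have e1 := nth_lands x jy; have e2 := nth_lands u jy.
have H1 := H j jy; move: H1; rewrite e1 e2 ET -/k => H1.
rewrite Tb in tr1 st.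
suff [Dt Et sh'] : [/\ Dstep (x ++ take j y) k = j.+1, Dstep (u ++ take j y) k < j.+1 &
    shape (insP (rcons (x ++ take j y) k)) = j.+2 :: shape P].
  split; last first.
    move=> i; rewrite ltnS leq_eqVlt => /orP[/eqP ->|]; last exact: IHl.
    by rewrite e1 e2; split.
  move: (parallel_rowcnt sT' bj (ltn0Sn j) tr1 tr2 st MP sh' Dt).
  rewrite ES -/k; case: (insP (rcons (x ++ _) k)) sh' => // r s [szr shs] h.
  by exists r, s; split; rewrite ?shs ?shP ?szr // => e z je; rewrite -h.
case: H1 => [[Dt sh']|[Et tD]].
  split=> //; last by rewrite shP.
  by apply: (parallel_stop sT' bj (ltn0Sn j) tr1 tr2 st MP _ Dt); rewrite shP.
by have [] := parallel_land sT' bj (ltn0Sn j) tr1 tr2 st MP Et tD.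
Qed.

End ParallelInsertions.

Lemma leq_size_count (p : pred nat) s : (size s <= count p s) = all p s.
Proof. by rewrite all_count eqn_leq count_size. Qed.

Section SegmentStep.
Variables (u y : seq nat) (x0 : nat) (sh : seq nat).
Hypothesis uw : uniq (u ++ x0 :: y).
Let x := rcons u x0.

Let uxy : uniq (x ++ y). Proof. by rewrite cat_rcons. Qed.

Let uuy : uniq (u ++ y).
Proof. by move: uw; rewrite -cat1s uniq_catCA /= => /andP[]. Qed.

Let ux : uniq x. Proof. by move: uxy; rewrite cat_uniq => /andP[]. Qed.

Let uu : uniq u. Proof. by move: uuy; rewrite cat_uniq => /andP[]. Qed.

Let take_uniqS j : j < size y -> uniq (rcons (x ++ take j y) (nth 0 y j)).
Proof.
move=> jy; rewrite rcons_cat -take_nth //.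
by move: uxy; rewrite -{1}(cat_take_drop j.+1 y) catA cat_uniq => /andP[].
Qed.

Lemma lands_step j : lands x y = iota 1 (size y) -> j < size y ->
  exists c, [/\ c < size (insP (x ++ take j y)),
    nth 0 (shape (insP (x ++ take j y))) c = j.+1
  & shape (insP (x ++ take j.+1 y)) = set_nth 0 (shape (insP (x ++ take j y))) c j.+2].
Proof.
move=> lx jy; have := insertion_step (take_uniqS jy).
have e := nth_lands x jy; rewrite lx nth_iota // in e.
rewrite -{}e add1n rcons_cat -take_nth //.
by case.
Qed.

(** After j letters the bottom row has at most j.+1 cells. Hence, going back from the final shape,
    the row that reached length j.+2 can only be the bottom one. *)
Lemma segment_shape : size (nth [::] (insP x) 0) <= 1 -> 0 < size (insP x) ->
    lands x y = iota 1 (size y) ->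
    shape (insP (x ++ y)) = (size y).+1 :: sh ->
  forall j, j <= size y -> shape (insP (x ++ take j y)) = j.+1 :: sh.
Proof.
move=> sh1 sh2 lx shf.
have up j : j <= size y -> exists2 b, b <= j.+1 & exists s, shape (insP (x ++ take j y)) = b :: s.
  elim: j => [_|j IH jy].
    rewrite take0 cats0; case: (insP x) sh1 sh2 => // r s /= r1 _.
    by exists (size r) => //; exists (shape s).
  have [b bj [s sj]] := IH (ltnW jy); have [c [_ _ ->]] := lands_step lx jy; rewrite sj.
  by case: c => [|c]; [exists j.+2; [|exists s] | exists b; [apply: leqW | exists (set_nth 0 s c j.+2)]].
move=> j; move: {2}(size y - j) (erefl (size y - j)) => m.
elim: m j => [|m IH] j mj jy.
  by rewrite (_ : j = size y) ?take_size //; lia.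
have jy' : j < size y by lia.
have h : shape (insP (x ++ take j.+1 y)) = j.+2 :: sh by apply: IH; lia.
have [b bj [s sj]] := up j jy; have [c] := lands_step lx jy'; rewrite h sj.
case: c => [|c] [_ cj []] /=; first by move=> ->; rewrite -cj.
by move=> e; move: bj; rewrite -e ltnn.
Qed.

(** Otherwise [x0] exceeds the first entry of the bottom row, and by [bottom_grow] that row stays
    ahead of each new cell and ends with more than [(size y).+1] cells. *)
Lemma segment_min : lands u (x0 :: y) = iota 0 (size y).+1 ->
  shape (insP (u ++ x0 :: y)) = (size y).+1 :: sh -> all (ltn x0) u.
Proof.
move=> lu shf; have [sT pT] := insP_syct uu.
have [T0|T0] := posnP (size (insP u)).
  suff -> : u = [::] by [].
  by apply: size0nil; rewrite (perm_size pT) (size0nil T0).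
have c0 := syct_cell0 sT T0.
case: (ltnP x0 (entry (insP u) 0 0)) => [lt|le].
  apply/allP => v; rewrite -mem_insP // => /mem_flatten[i [d [ci <-]]] /=.
  apply: leq_trans lt _.
  have ci0 : is_cell (insP u) i 0 by apply: is_cell_leq ci.
  have le : entry (insP u) 0 0 <= entry (insP u) i 0.
    by case: i ci0 {ci} => [//|i] ci0; apply/ltnW/(syct_head sT).
  apply: leq_trans le _; elim: d ci => // d IH ci.
  by apply: leq_trans (IH (is_cellS ci)) _; apply/ltnW/(syct_row sT).
exfalso.
have x0u : x0 \notin u by move: ux; rewrite rcons_uniq => /andP[].
have lt : entry (insP u) 0 0 < x0.
  rewrite ltn_neqAle le andbT; apply: contraNneq x0u => <-.
  by rewrite -mem_insP // entry_in.
have grow j : j <= (size y).+1 -> is_cell (insP (u ++ take j (x0 :: y))) 0 j.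
  elim: j => [_|j IH jy]; first by rewrite take0 cats0.
  have jy' : j < size (x0 :: y) by [].
  pose k := nth 0 (x0 :: y) j; pose v := u ++ take j (x0 :: y).
  have ev : u ++ take j.+1 (x0 :: y) = rcons v k by rewrite (take_nth 0 jy') rcons_cat.
  have uk : uniq (rcons v k).
    by rewrite -ev; move: uw; rewrite -{1}(cat_take_drop j.+1 (x0 :: y)) catA cat_uniq => /andP[].
  have uv : uniq v by move: uk; rewrite rcons_uniq => /andP[].
  have szv : size v <= (size v).+1 by [].
  have [kk tr] := insP_trace uk szv; have st := insertion_step uk.
  have [sv _] := insP_syct uv.
  have Dj : Dstep v k = j by have := nth_lands u jy'; rewrite lu nth_iota.
  rewrite Dj in tr st; have cj : is_cell (insP v) 0 j := IH (ltnW jy).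
  rewrite ev; apply: (bottom_grow sv tr st _ cj) => [|j0].
    by apply: leq_trans (leq_trans (leq_max_shape cj) (insP_max uv)) _.
  by rewrite /v /k j0 take0 cats0.
have := grow _ (leqnn _); rewrite -[X in take X _]/(size (x0 :: y)) take_size.
have T'0 : 0 < size (insP (u ++ x0 :: y)).
  by rewrite -(size_map size) -/(shape (insP (u ++ x0 :: y))) shf.
by rewrite /is_cell -shape_nth // shf /= ltnn.
Qed.

(* When x0 is smaller than the letters of u and x0 :: y is increasing, inserting
   x0 :: y makes a new bottom row exactly when inserting y alone never creates a
   cell in the column [size y] or beyond; by Greene this is a condition on
   decreasing subsequences. *)
Theorem segment_step :
  (shape (insP (u ++ x0 :: y)) = (size y).+1 :: sh /\ lands u (x0 :: y) = iota 0 (size y).+1) <->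
  [/\ shape (insP u) = sh, sorted ltn (x0 :: y), all (ltn x0) u
    & trunc (size y) sh + size y <= trunc (size y) (shape (insP (u ++ y)))].
Proof.
split=> [[shf lu]|[shu srt lt0 col]].
  have lt0 := segment_min lu shf.
  have [ix dx] := insP_min ux lt0.
  have lx : lands x y = iota 1 (size y) by move: lu; rewrite /= dx => -[].
  have Hsh : forall j, j <= size y -> shape (insP (x ++ take j y)) = j.+1 :: sh.
    by apply: segment_shape; rewrite // ?ix // cat_rcons.
  have shu : shape (insP u) = sh.
    by have := Hsh 0 (leq0n _); rewrite take0 cats0 ix => -[].
  split=> //; first by rewrite -(sorted_lands uw) lu iota_ltn_sorted.
  rewrite trunc_lands // shu leq_add2l.
  have [|_ H] := parallel_insertion uw lt0 shu _ (leqnn (size y)).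
    by move=> j jy; left; rewrite lx nth_iota // Hsh.
  rewrite -[X in X <= _](size_lands u) leq_size_count; apply/(all_nthP 0) => i.
  by rewrite size_lands => iy; have [le _] := H i iy; apply: leq_ltn_trans le iy.
have [ix dx] := insP_min ux lt0.
have sy : sorted ltn y by move: srt => /=; apply: path_sorted.
(* The bound on truncated sums puts all these landing columns below [size y]; as they increase, they
   are 0, 1, 2 and so on. *)
have luy : lands u y = iota 0 (size y).
  rewrite -[X in iota 0 X](size_lands u y); apply: sorted_iota; first by rewrite sorted_lands.
  move: col; rewrite trunc_lands // shu leq_add2l -{1}(size_lands u) leq_size_count => /allP.
  by rewrite size_lands.
have slx : path ltn 0 (lands x y).
  by have := sorted_lands uw; rewrite srt /= dx.
have [|[b [P [bP szb shP _]]] H] := parallel_insertion uw lt0 shu _ (leqnn (size y)).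
  move=> j jy; right; rewrite luy nth_iota // leqnn; split=> //.
  by have := sorted_nth_geq slx; move/(_ j); rewrite size_lands add0n; apply.
have lx : lands x y = iota 1 (size y).
  apply: (@eq_from_nth _ 0); rewrite size_lands ?size_iota // => i iy.
  by rewrite nth_iota //; have [] := H i iy.
rewrite take_size /= dx lx cat_rcons in bP *.
by rewrite bP /= szb shP.
Qed.
End SegmentStep.

(** * The words of K_alpha *)

(* The columns of the successive new cells when the recording filling is the
   canonical one of shape [rev alpha]. *)
Definition segcols (alpha : seq nat) : seq nat := flatten [seq iota 0 a | a <- rev alpha].

Lemma segcols_cons a alpha : segcols (a :: alpha) = segcols alpha ++ iota 0 a.
Proof. by rewrite /segcols rev_cons map_rcons -cats1 flatten_cat /= cats0. Qed.

Lemma size_segcols alpha : size (segcols alpha) = sumn alpha.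
Proof.
by elim: alpha => // a alpha IH; rewrite segcols_cons size_cat IH size_iota addnC.
Qed.

Fixpoint rising (alpha w : seq nat) : bool :=
  if alpha is a :: alpha' then
    rising alpha' (take (sumn alpha') w) && sorted ltn (drop (sumn alpha') w)
  else true.

(* The words of K_alpha (read backwards, i.e. multiplied by w_0), in a form that is
   visibly stable when inversions between different segments are created. *)
Fixpoint good (alpha w : seq nat) : Prop :=
  if alpha is a :: alpha' then
    let w' := take (sumn alpha') w in let x := drop (sumn alpha') w in
    let y := w' ++ behead x in
    [/\ good alpha' w', sorted ltn x, all (ltn (head 0 x)) w'
      & colorable y (index^~ y) a.-1 (trunc a.-1 alpha' + a.-1)]
  else w = [::].

Lemma good_rising alpha w : good alpha w -> rising alpha w.
Proof. by elim: alpha w => //= a alpha IH w [/IH -> ->]. Qed.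

Lemma good_insP alpha w : all (leq 1) alpha -> uniq w -> size w = sumn alpha ->
  shape (insP w) = alpha /\ Dseq w = segcols alpha <-> good alpha w.
Proof.
elim: alpha w => [|a alpha IH] w /=; first by move=> _ _ /size0nil ->.
move=> /andP[a0 al0] uw sw; set w' := take _ w; set x := drop _ w.
have sw' : size w' = sumn alpha by rewrite size_takel // sw leq_addl.
have wE : w = w' ++ x by rewrite cat_take_drop.
have sx : size x = a by rewrite size_drop sw addnK.
case: x => [|x0 y] in wE sx *; first by move: a0; rewrite -sx.
have uw' : uniq w' by rewrite take_uniq.
have uwy : uniq (w' ++ x0 :: y) by rewrite -wE.
have uy : uniq (w' ++ y) by move: uwy; rewrite -cat1s uniq_catCA /= => /andP[].
have {}IH := IH w' al0 uw' sw'.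
have S := segment_step alpha uwy; rewrite -wE in S.
have ya : size y = a.-1 by rewrite -sx.
have Da : Dseq w = segcols (a :: alpha) <-> Dseq w' = segcols alpha /\ lands w' (x0 :: y) = iota 0 a.
  rewrite wE Dseq_cat segcols_cons; split=> [/eqP|[-> ->] //].
  by rewrite eqseq_cat ?size_Dseq ?size_segcols // => /andP[/eqP -> /eqP ->].
have G := greene a.-1 (trunc a.-1 alpha + a.-1) uy.
have sx1 : (size y).+1 = a := sx.
rewrite Da; rewrite sx1 ya in S.
split=> [[shw [Dw' lw]]|[/IH[shw' Dw'] srt lt0 /G col]].
  have [shw' srt lt0 col] := S.1 (conj shw lw).
  by split=> //; [apply/IH | apply/G].
by have [shw lw] := S.2 (And4 shw' srt lt0 col).
Qed.

(** [g] keeps every inversion of [w], so it maps decreasing subsequences to decreasing ones. *)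
Lemma colorable_map w g k N : uniq w -> {in w &, injective g} ->
    pairwise (fun u v => (v < u) ==> (g v < g u)) w ->
  colorable w (index^~ w) k N -> colorable [seq g v | v <- w] (index^~ [seq g v | v <- w]) k N.
Proof.
move=> uw gi /(pairwiseP 0) pw [f [fP fN]].
have idx v : v \in w -> index (g v) [seq g v | v <- w] = index v w.
  move=> vw; rewrite -{1}(nth_index 0 vw) -(nth_map _ (g 0)) ?index_mem //.
  by rewrite index_uniq ?size_map ?index_mem // map_inj_in_uniq.
exists (fun y => f (nth 0 w (index y [seq g v | v <- w]))); split; last first.
  apply: leq_trans fN (eq_leq _); rewrite count_map; apply: eq_in_count => v vw /=.
  by rewrite idx // nth_index.
move=> _ _ /mapP[u uwd ->] /mapP[v vwd ->]; rewrite !idx // !nth_index // => fuv fk lt.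
case: (ltnP u v) => [uv|].
  rewrite leqNgt; apply/negP => iuv.
  have := pw _ _ _ _ iuv; rewrite !inE !index_mem !nth_index // => /(_ vwd uwd).
  by rewrite uv /=; lia.
rewrite leq_eqVlt => /orP[/eqP vu|vu]; first by rewrite vu ltnn in lt.
exact: fP.
Qed.

(** Apart from the increase within segments, which is assumed of the image, the conditions in [good]
    are inversions and lower bounds on covers, and [g] preserves both. *)
Lemma good_map alpha w g : size w = sumn alpha -> all (leq 1) alpha -> uniq w -> {in w &, injective g} ->
    pairwise (fun u v => (v < u) ==> (g v < g u)) w ->
  good alpha w -> rising alpha [seq g v | v <- w] -> good alpha [seq g v | v <- w].
Proof.
elim: alpha w => [|a alpha IH] w /=; first by move=> _ _ _ _ _ ->.
move=> sw /andP[a0 al0] uw gi pw [h1 h2 h3 h4]; rewrite -map_take -map_drop => /andP[r1 r2].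
set w' := take _ w in h1 h3 h4 r1 *; set x := drop _ w in h2 h3 h4 r2 *.
have sw' : size w' = sumn alpha by rewrite size_takel // sw leq_addl.
have wE : w = w' ++ x by rewrite cat_take_drop.
have sx : size x = a by rewrite size_drop sw addnK.
have sub1 : subseq w' w by rewrite wE prefix_subseq.
have sub2 : subseq (w' ++ behead x) w.
  by rewrite [w in subseq _ w]wE cat_subseq //; case: (x) => // b s; apply: subseq_cons.
have inj s : subseq s w -> {in s &, injective g}.
  by move=> ss u v us vs; apply: gi; apply: (mem_subseq ss).
split=> //.
- apply: IH => //; [exact: subseq_uniq sub1 _ | exact: inj | exact: subseq_pairwise sub1 _].
- move: wE sx h3; case: (x) => [|x0 y] wE sx h3; first by move: a0; rewrite -sx.
  apply/allP => _ /mapP[v vw' ->] /=.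
  move: pw; rewrite wE pairwise_cat => /andP[/allrelP/(_ v x0 vw' (mem_head _ _))/implyP h _].
  exact: h (allP h3 v vw').
rewrite behead_map -map_cat; apply: colorable_map h4; [exact: subseq_uniq sub2 _ | exact: inj |].
exact: subseq_pairwise sub2 _.
Qed.

(* The source of K_alpha, on the letters starting at [c]. *)
Fixpoint canon c alpha :=
  if alpha is a :: alpha' then canon (c + a) alpha' ++ iota c a else [::].

Definition swapn i v := if v == i then i.+1 else if v == i.+1 then i else v.

Lemma rising_map alpha w g : {in w &, {homo g : u v / u < v}} ->
  rising alpha w -> rising alpha [seq g v | v <- w].
Proof.
elim: alpha w => //= a alpha IH w gm /andP[r1 r2].
rewrite -map_take -map_drop IH //=; last by move=> u v /mem_take uw /mem_take vw; apply: gm.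
apply: (homo_sorted_in (P := mem w) _ _ r2) => [u v uw vw|]; first exact: gm.
by apply/allP => v /mem_drop.
Qed.

Lemma swapn_homo (w : seq nat) i : i \notin w \/ i.+1 \notin w -> {in w &, {homo swapn i : u v / u < v}}.
Proof.
move=> h u v uw vw; rewrite /swapn.
case: (eqVneq u i) => [ui|un]; case: (eqVneq v i) => [vi|vn]; rewrite ?ui ?vi ?ltnn //.
- case: (eqVneq v i.+1) => [v1|]; last by lia.
  by case: h => /negP[]; [rewrite -ui | rewrite -v1].
- by case: (eqVneq u i.+1) => [->|]; lia.
case: (eqVneq u i.+1) => [u1|u1]; case: (eqVneq v i.+1) => [v1|v1]; lia.
Qed.

(** The least letter c lies in the last segment, whose head is below all previous letters. If this
    segment is not the interval from c, it contains some v.+1 but not v; then v stands in an earlier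
    segment, and exchanging the two alters no comparison within a segment. *)
Lemma canon_or_swap alpha c w : all (leq 1) alpha -> good alpha w ->
    perm_eq w (iota c (sumn alpha)) ->
  w = canon c alpha \/ exists i, [/\ i \in w, i.+1 \in w, index i w < index i.+1 w
                                & rising alpha [seq swapn i v | v <- w]].
Proof.
elim: alpha c w => [|a alpha IH] c w /=; first by move=> _ ->; left.
case/andP=> a0 al0 [h1 h2 h3 _] pw; set w' := take _ w in h1 h3 *; set x := drop _ w in h2 h3 *.
have uw : uniq w by rewrite (perm_uniq pw) iota_uniq.
have sw : size w = a + sumn alpha by rewrite (perm_size pw) size_iota.
have wE : w = w' ++ x by rewrite cat_take_drop.
have sw' : size w' = sumn alpha by rewrite size_takel // sw leq_addl.
have sx : size x = a by rewrite size_drop sw addnK.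
have mw v : (v \in w) = (c <= v < c + (a + sumn alpha)) by rewrite (perm_mem pw) mem_iota.
have dis v : v \in x -> v \notin w'.
  by move=> vx; move: uw; rewrite wE cat_uniq => /and3P[_ /hasPn/(_ v vx)].
have [xE|xE] := eqVneq x (iota c a).
  have pw' : perm_eq w' (iota (c + a) (sumn alpha)).
    by move: pw; rewrite wE xE iotaD perm_sym perm_catC perm_cat2r perm_sym.
  have [e|[i [iw i1w lt r]]] := IH (c + a) w' al0 h1 pw'; first by left; rewrite wE xE e.
  right; exists i; rewrite {1 2}wE !mem_cat iw i1w; split=> //.
    by rewrite wE !index_cat iw i1w.
  rewrite -map_take -map_drop -/w' -/x r /= xE map_id_in ?iota_ltn_sorted //.
  move=> v; rewrite mem_iota /swapn => vx.
  have := perm_mem pw' i; have := perm_mem pw' i.+1; rewrite iw i1w !mem_iota => /esym h /esym h'.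
  by case: eqP => [vi|_]; [lia | case: eqP => // vi; lia].
right.
suff [v [vx v1 v1w]] : exists v, [/\ v.+1 \in x, v \notin x & v \in w].
  have v1x : v \in w' by move: v1w; rewrite wE mem_cat (negbTE v1) orbF.
  exists v; rewrite v1w wE mem_cat vx orbT; split=> //.
    by rewrite !index_cat v1x (negbTE (dis _ vx)) ltn_addr // index_mem.
  rewrite map_cat take_size_cat ?size_map // drop_size_cat ?size_map //.
  rewrite rising_map ?good_rising //=; last by apply: swapn_homo; right; apply: dis.
  apply: (homo_sorted_in (P := mem x) _ _ h2) => [u u' ux u'x|]; last by apply/allP.
  by apply: (@swapn_homo x) => //; left.
have cx : c \in x.
  have : c \in w by rewrite mw leqnn; lia.
  rewrite wE mem_cat => /orP[cw'|//].
  have := allP h3 c cw'; rewrite /=.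
  have : head 0 x \in w by rewrite wE mem_cat; case: (x) sx => [s0|b s _];
    [move: a0; rewrite -s0 | rewrite mem_head orbT].
  by rewrite mw => /andP[/leq_ltn_trans h _] /h; rewrite ltnn.
case/boolP: (all (fun v => (v == c) || (v.-1 \in x)) x) => [al|].
  case/negP: xE; apply/eqP; apply: (irr_sorted_eq ltn_trans ltnn h2 (iota_ltn_sorted _ _)).
  have ux : uniq x by apply: sorted_uniq h2; [apply: ltn_trans | apply: ltnn].
  have dn m v : v + m \in x -> c <= v -> v \in x.
    elim: m => [|m IHm]; first by rewrite addn0.
    move=> vmx cv; apply: IHm => //; have /orP[/eqP e|] := allP al _ vmx; last by rewrite addnS.
    by move: vmx; rewrite e; lia.
  have sub : {subset x <= iota c a}.
    move=> v vx; have cv : c <= v by move: (mw v); rewrite wE mem_cat vx orbT => /esym/andP[].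
    rewrite mem_iota cv /=.
    have : size (iota c (v - c).+1) <= size x.
      apply: uniq_leq_size (iota_uniq _ _) _ => u; rewrite mem_iota => /andP[cu uv].
      by apply: (dn (v - u)) => //; rewrite subnKC //; lia.
    by rewrite size_iota sx; lia.
  have [|_ e] := uniq_min_size ux sub; first by rewrite size_iota sx.
  exact: e.
case/allPn=> v vx; rewrite negb_or => /andP[vc v1].
have vw : v \in w by rewrite wE mem_cat vx orbT.
have v0 : c < v by move: vw; rewrite mw; lia.
exists v.-1; rewrite prednK; last by lia.
by split=> //; move: vw; rewrite !mw; lia.
Qed.

Lemma swapn_inj i : injective (swapn i).
Proof. by move=> u v; rewrite /swapn; do 4?case: eqP; lia. Qed.

Lemma swapn_pairwise w i : uniq w -> i.+1 \in w -> index i w < index i.+1 w ->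
  pairwise (fun u v => (v < u) ==> (swapn i v < swapn i u)) w.
Proof.
move=> uw i1w lt; apply/(pairwiseP 0) => p q; rewrite !inE => pw qw pq; apply/implyP => vu.
set u := nth 0 w p in vu *; set v := nth 0 w q in vu *.
have : (v == i) && (u == i.+1) = false.
  apply/negP => /andP[/eqP vi /eqP ui]; move: lt.
  by rewrite -ui -vi /u /v !index_uniq // ltnNge (ltnW pq).
rewrite /swapn; do 4?case: eqP => //=; lia.
Qed.

Lemma good_swap alpha w i : all (leq 1) alpha -> uniq w -> size w = sumn alpha ->
    i.+1 \in w -> index i w < index i.+1 w -> good alpha w ->
  rising alpha [seq swapn i v | v <- w] -> good alpha [seq swapn i v | v <- w].
Proof.
move=> al0 uw sw i1w lt; apply: good_map => //; first by move=> u v _ _; apply: swapn_inj.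
exact: swapn_pairwise.
Qed.

Lemma perm_canon c alpha : perm_eq (canon c alpha) (iota c (sumn alpha)).
Proof.
elim: alpha c => //= a alpha IH c.
by rewrite iotaD perm_sym perm_catC perm_cat2r perm_sym.
Qed.

(** The segments of the canonical word are intervals. Since c lies in the last segment of [w], the
    assumed order of positions forces c+1, c+2 and so on into it as well, and the earlier segments
    follow by induction. *)
Lemma canon_unique alpha c w : all (leq 1) alpha -> good alpha w ->
    perm_eq w (iota c (sumn alpha)) ->
    (forall i, c <= i -> i.+1 < c + sumn alpha ->
       index i (canon c alpha) < index i.+1 (canon c alpha) -> index i w < index i.+1 w) ->
  w = canon c alpha.
Proof.
elim: alpha c w => [|a alpha IH] c w /=; first by move=> _ ->.
case/andP=> a0 al0 [h1 h2 h3 _] pw H; set w' := take _ w in h1 h3 *; set x := drop _ w in h2 h3 *.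
have uw : uniq w by rewrite (perm_uniq pw) iota_uniq.
have sw : size w = a + sumn alpha by rewrite (perm_size pw) size_iota.
have wE : w = w' ++ x by rewrite cat_take_drop.
have sw' : size w' = sumn alpha by rewrite size_takel // sw leq_addl.
have sx : size x = a by rewrite size_drop sw addnK.
have mw v : (v \in w) = (c <= v < c + (a + sumn alpha)) by rewrite (perm_mem pw) mem_iota.
have dis v : v \in x -> v \notin w'.
  by move=> vx; move: uw; rewrite wE cat_uniq => /and3P[_ /hasPn/(_ v vx)].
have mc v : (v \in canon (c + a) alpha) = (c + a <= v < c + a + sumn alpha).
  by rewrite (perm_mem (perm_canon _ _)) mem_iota.
have cx : c \in x.
  have : c \in w by rewrite mw leqnn; clear -a0; lia.
  rewrite wE mem_cat => /orP[cw'|//].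
  have := allP h3 c cw'; rewrite /=.
  have : head 0 x \in w by rewrite wE mem_cat; case: (x) sx => [s0|b s _];
    [move: a0; rewrite -s0 | rewrite mem_head orbT].
  by rewrite mw => /andP[/leq_ltn_trans h _] /h; rewrite ltnn.
have xa j : j < a -> c + j \in x.
  elim: j => [|j IHj] ja; first by rewrite addn0.
  have jx := IHj (ltnW ja).
  have lt : index (c + j) w < index (c + j.+1) w.
    rewrite addnS; apply: H; [exact: leq_addr | by clear -ja; lia |].
    have n1 : c + j \in canon (c + a) alpha = false by rewrite mc; clear -ja; lia.
    have n2 : (c + j).+1 \in canon (c + a) alpha = false by rewrite mc; clear -ja; lia.
    rewrite !index_cat n1 n2 ltn_add2l.
    have e i : i < a -> index (c + i) (iota c a) = i.
      by move=> ia; rewrite -[c + i](nth_iota 0 c ia) index_uniq ?size_iota ?iota_uniq.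
    by rewrite -addnS !e // ltnW.
  have : c + j.+1 \in w by rewrite mw; clear -ja; lia.
  rewrite wE mem_cat => /orP[h|//]; move: lt.
  rewrite wE !index_cat h (negbTE (dis _ jx)) => lt; exfalso.
  have := h; rewrite -index_mem; move: lt; clear; lia.
have ux : uniq x by apply: sorted_uniq h2; [apply: ltn_trans | apply: ltnn].
have xE : x = iota c a.
  apply: (irr_sorted_eq ltn_trans ltnn h2 (iota_ltn_sorted _ _)).
  have sub : {subset iota c a <= x}.
    move=> v; rewrite mem_iota => /andP[cv va].
    by have := xa (v - c); rewrite subnKC //; apply; clear -cv va; lia.
  by have [|_ e] := uniq_min_size (iota_uniq _ _) sub; first by rewrite size_iota sx.
have pw' : perm_eq w' (iota (c + a) (sumn alpha)).
  by move: pw; rewrite wE xE iotaD perm_sym perm_catC perm_cat2r perm_sym.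
rewrite wE xE; congr (_ ++ _); apply: IH => // i ci ia.
have m1 := perm_mem pw' i; have m2 := perm_mem pw' i.+1.
rewrite !mem_iota ia (leqW ci) in m1 m2; rewrite ci (ltnW ia) in m1.
have := H i; rewrite wE !index_cat m1 m2 !mc ci ia (leqW ci) (ltnW ia) /=.
by apply; [move: ci | move: ia]; clear; lia.
Qed.

(** * The recording filling *)

Lemma append_top_row c k Q : c \in shape Q ->
  exists p, [/\ p < size Q, size (nth [::] Q p) = c
             & append_top c k Q = set_row Q p (rcons (nth [::] Q p) k)].
Proof.
case/mapP=> r rQ rc; set f := find (fun r => size r == c) (rev Q).
have hf : has (fun r => size r == c) (rev Q) by apply/hasP; exists r; rewrite ?mem_rev ?rc.
have fQ : f < size Q by rewrite -(size_rev Q) -has_find.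
exists ((size Q).-1 - f); split=> //; first by lia.
have := nth_find [::] hf; rewrite -/f nth_rev // => /eqP <-.
by congr (size (nth _ _ _)); lia.
Qed.

Lemma reads_append_row Z T c k : c < size T -> Z k = size (nth [::] T c) -> reads Z T ->
  reads Z (set_row T c (rcons (nth [::] T c) k)).
Proof.
move=> cT Zk rd i d; rewrite is_cell_append // entry_append //.
case E: (_ && _); last by rewrite orbF; apply: rd.
by case/andP: E => _ /eqP ->.
Qed.

Lemma perm_set_nth (s t : seq nat) c d a : c < size s -> perm_eq s t -> d < size t ->
  nth 0 s c = nth 0 t d -> perm_eq (set_nth 0 s c a) (set_nth 0 t d a).
Proof.
move=> cs /seq.permP st dt e; apply/seq.permP => p.
have E (u : seq nat) i : i < size u -> count p (set_nth 0 u i a) + p (nth 0 u i) = count p u + p a.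
  move=> iu; rewrite set_nthE iu -[in RHS](cat_take_drop i u) (drop_nth 0 iu).
  rewrite !count_cat /=; lia.
have := E s c cs; have := E t d dt; rewrite e st; lia.
Qed.

Lemma perm_insert p (s : seq nat) a : perm_eq (take p s ++ a :: drop p s) (a :: s).
Proof. by rewrite -cat1s perm_catCA cat_take_drop. Qed.

Lemma shape_add_row k T : perm_eq (shape (add_row k T)) (1 :: shape T).
Proof. by have [p [_ -> _]] := add_row_position T k; apply: perm_insert. Qed.

(** The recording filling has k in the landing column of step k, so it determines [Dseq]. Its shape
    is kept as a rearrangement of that of the insertion tableau in order to supply the row to which
    k is appended. *)
Lemma insQ_ok w : uniq w ->
  [/\ perm_eq (shape (PQ w).2) (shape (insP w)), perm_eq (flatten (PQ w).2) (iota 1 (size w))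
    & reads (fun k => nth 0 (Dseq w) k.-1) (PQ w).2].
Proof.
elim/last_ind: w => [_|w q IH uwq]; first by split=> // i d; rewrite /is_cell nth_nil.
have uw : uniq w by move: uwq; rewrite rcons_uniq => /andP[].
have [sh fl rd] := IH uw; have st := insertion_step uwq.
set k := (size w).+1.
have -> : (PQ (rcons w q)).2 = record_step k (Dstep w q) (PQ w).2.
  by rewrite PQ_rcons /PQ_step /Dstep /insP; case: insertion.
have kQ : perm_eq (k :: flatten (PQ w).2) (iota 1 (size (rcons w q))).
  by rewrite size_rcons -(addn1 (size w)) iotaD -cat1s perm_sym perm_catC perm_cat2l perm_sym.
have Dk : nth 0 (Dseq (rcons w q)) k.-1 = Dstep w q.
  by rewrite Dseq_rcons nth_rcons size_Dseq ltnn eqxx.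
have {}rd : reads (fun k => nth 0 (Dseq (rcons w q)) k.-1) (PQ w).2.
  apply: reads_eq rd => v; rewrite (perm_mem fl) mem_iota Dseq_rcons nth_rcons size_Dseq.
  by case: v => // v /andP[_]; rewrite add1n ltnS /= => ->.
rewrite /record_step; case: (posnP (Dstep w q)) => [D0|D0].
  split.
  - rewrite D0 in st; have [p [_ -> _]] := st.
    rewrite (perm_trans (shape_add_row _ _)) // perm_sym.
    by rewrite (perm_trans (perm_insert _ _ _)) // perm_cons perm_sym.
  - by rewrite (perm_trans (perm_add_row _ _)).
  by apply: reads_add_row; rewrite ?Dk.
case: (Dstep w q) D0 st Dk => // D _ st Dk.
have [[c [cP cD shc]] _] := st.
have DQ : D.+1 \in shape (PQ w).2 by rewrite (perm_mem sh) -cD mem_nth // size_map.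
have [p [pQ pD ->]] := append_top_row k DQ; split.
- rewrite shape_set_row // size_rcons pD shc; apply: perm_set_nth; rewrite ?size_map //.
  by rewrite shape_nth // cD.
- by rewrite (perm_trans (flatten_rcons_row _ _)).
by apply: reads_append_row; rewrite // Dk.
Qed.

Lemma reads_canonical_filling beta :
  reads (fun k => nth 0 (flatten [seq iota 0 b | b <- beta]) k.-1) (canonical_filling beta).
Proof.
have sh : shape (canonical_filling beta) = beta by rewrite reshapeKl ?size_iota.
move=> i d ci; have iT := is_cell_size ci.
have ib : i < size beta by rewrite -sh size_map.
have db : d < nth 0 beta i by rewrite -sh shape_nth.
set T := canonical_filling beta in sh *.
have jlt : flatten_index beta i d < sumn beta by apply: flatten_indexP.
have -> : entry T i d = (flatten_index beta i d).+1.
  have := nth_flatten 0 T (flatten_index beta i d).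
  rewrite sh flatten_indexKl // flatten_indexKr // /entry => <-.
  by rewrite reshapeKr ?size_iota // nth_iota.
set U := [seq iota 0 b | b <- beta].
have shU : shape U = beta by rewrite /shape -map_comp map_id_in // => b _ /=; rewrite size_iota.
have := nth_flatten 0 U (flatten_index beta i d).
by rewrite shU flatten_indexKl // flatten_indexKr // /U (nth_map 0) // nth_iota.
Qed.

Lemma recording w alpha : uniq w -> size w = sumn alpha ->
  (PQ w).2 = canonical_filling (rev alpha) -> Dseq w = segcols alpha.
Proof.
move=> uw sw eQ; have [_ fl rd] := insQ_ok uw; rewrite eQ in fl rd.
apply: (@eq_from_nth _ 0); first by rewrite size_Dseq size_segcols.
move=> j; rewrite size_Dseq => jw.
have := eq_reads rd (@reads_canonical_filling (rev alpha)) (_ : j.+1 \in _) => /=; apply.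
by rewrite (perm_mem fl) mem_iota add1n ltnS.
Qed.

Definition record_seq (s : nat) Ds Q :=
  foldl (fun Q kc => record_step kc.1 kc.2 Q) Q (zip (iota s (size Ds)) Ds).

Lemma record_cat s D1 D2 Q : record_seq s (D1 ++ D2) Q = record_seq (s + size D1) D2 (record_seq s D1 Q).
Proof.
by rewrite /record_seq size_cat iotaD zip_cat ?size_iota // foldl_cat.
Qed.

Lemma PQ_record w : (PQ w).2 = record_seq 1 (Dseq w) [::].
Proof.
elim/last_ind: w => // w k IH.
rewrite PQ_rcons Dseq_rcons -cats1 record_cat -IH size_Dseq /PQ_step /Dstep /insP.
by case: insertion.
Qed.

Lemma record_row s b Q : {in Q, forall r, head 0 r < s} -> 0 < b ->
  record_seq s (iota 0 b) Q = rcons Q (iota s b).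
Proof.
move=> lt; elim: b => // b IH _; case: b => [|b] in IH *.
  rewrite /record_seq /= /record_step /= /add_row.
  have -> : find (fun r => s < head 0 r) Q = size Q.
    apply/eqP; rewrite eqn_leq find_size /= leqNgt -has_find; apply/hasPn => r /lt.
    by rewrite -leqNgt => /ltnW.
  by rewrite take_size drop_size cats1.
rewrite -[b.+2]addn1 iotaD record_cat IH // size_iota /= add0n.
rewrite /record_seq /= /record_step /= /append_top rev_rcons /= size_iota eqxx.
rewrite size_rcons subn0 /= /set_row nth_rcons ltnn eqxx -cats1 set_nthE size_cat /= addn1 ltnSn.
rewrite take_size_cat // drop_oversize ?size_cat ?addn1 // cats1.
by rewrite -(addn1 b) iotaD cats1 addn1 addSnnS.
Qed.

Lemma record_canonical alpha : all (leq 1) alpha ->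
  record_seq 1 (segcols alpha) [::] = canonical_filling (rev alpha).
Proof.
elim: alpha => //= a alpha IH /andP[a0 al0].
rewrite segcols_cons record_cat IH // size_segcols record_row //; last first.
  move=> r rT; set T := canonical_filling _ in rT.
  have fl : flatten T = iota 1 (sumn alpha) by rewrite reshapeKr ?size_iota // sumn_rev.
  case: r rT => // v r rT; have : v \in flatten T.
    by apply/flattenP; exists (v :: r); rewrite // mem_head.
  by rewrite fl mem_iota => /andP[].
rewrite /canonical_filling rev_cons sumn_rcons !sumn_rev addnC iotaD.
rewrite reshape_rcons; last by rewrite size_cat !size_iota sumn_rev.
by rewrite sumn_rev take_size_cat ?size_iota // drop_size_cat ?size_iota // addnC.
Qed.

Lemma hatQ_canonical w alpha : all (leq 1) alpha -> uniq w -> size w = sumn alpha ->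
  (PQ w).2 = canonical_filling (rev alpha) <-> Dseq w = segcols alpha.
Proof.
move=> al0 uw sw; split; first exact: recording.
by rewrite PQ_record => ->; apply: record_canonical.
Qed.

(** * Bijection with standard Young composition tableaux *)

Lemma is_SYCT_syct T : all (fun r => 0 < size r) T -> uniq (flatten T) -> is_SYCT T <-> syct T.
Proof.
move=> /all_nthP pos uT; split=> [/and3P[rows head /forallP tri]|sT].
  have c0 i : i < size T -> is_cell T i 0 by move=> iT; apply: pos.
  have hd i : i < size T -> nth 0 (first_column T) i = entry T i 0.
    by move=> iT; rewrite (nth_map [::]) // -nth0.
  split=> // [i d ci|i j ij cj|i j d ij cj ci le].
  - have := allP rows _ (mem_nth [::] (is_cell_size ci)) => /(sortedP 0)/(_ d ci) le.
    rewrite ltn_neqAle [_ <= _]le andbT; apply/eqP => e.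
    by have [_] := entry_inj uT (is_cellS ci) ci e; lia.
  - have jT := is_cell_size cj; have iT := ltn_trans ij jT.
    rewrite -!hd //.
    by apply: (sorted_ltn_nth ltn_trans 0 head) => //; rewrite inE size_map.
  have jT := is_cell_size cj.
  have := forallP (forallP (tri (Ordinal jT)) (Ordinal ij)) (Ordinal (cj : d < size (nth [::] T j))).
  by rewrite /= ci le.
apply/and3P; split.
- apply/allP => r /(nthP [::])[i iT <-]; apply/(sortedP 0) => d dr.
  exact: ltnW (syct_row sT (dr : is_cell T i d.+1)).
- apply/(sortedP 0) => i; rewrite size_map => iT.
  rewrite !(nth_map [::]) ?(ltnW iT) // -!nth0.
  by apply: (syct_head sT (ltnSn i)); apply: syct_cell0.
apply/forallP => j; apply/forallP => i; apply/forallP => k; apply/implyP => /andP[ci le].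
by apply: syct_triple => //; apply: ltn_ord.
Qed.

Lemma mem_standard alpha T :
  T \in standard_fillings alpha <-> shape T = alpha /\ perm_eq (flatten T) (iota 1 (sumn alpha)).
Proof.
split=> [/mapP[w]|[<- pT]].
  rewrite mem_permutations => pw ->; have sw : size w = sumn alpha by rewrite (perm_size pw) size_iota.
  by rewrite reshapeKl ?sw // reshapeKr ?sw.
by rewrite -{1}[T]flattenK; apply: (map_f (reshape (shape T))); rewrite mem_permutations.
Qed.

Lemma standard_uniq alpha : uniq (standard_fillings alpha).
Proof.
rewrite map_inj_in_uniq ?permutations_uniq // => u v.
rewrite !mem_permutations => /perm_size su /perm_size sv /(congr1 flatten).
by rewrite !reshapeKr ?su ?sv ?size_iota.
Qed.

Lemma mem_SYCT alpha T : all (leq 1) alpha -> T \in SYCT alpha <->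
  [/\ shape T = alpha, perm_eq (flatten T) (iota 1 (sumn alpha)) & syct T].
Proof.
move=> al0; rewrite mem_filter; split=> [/andP[sT /mem_standard[sh pT]]|[sh pT sT]].
  split=> //; apply/is_SYCT_syct => //; last by rewrite (perm_uniq pT) iota_uniq.
  by apply/allP => r rT; apply: (allP al0); rewrite -sh map_f.
apply/andP; split; last exact/mem_standard.
apply/is_SYCT_syct => //; last by rewrite (perm_uniq pT) iota_uniq.
by apply/allP => r rT; apply: (allP al0); rewrite -sh map_f.
Qed.

Lemma SYCT_uniq alpha : uniq (SYCT alpha).
Proof. exact: filter_uniq (standard_uniq alpha). Qed.

Lemma count_segcols e alpha : count_mem e (segcols alpha) = count (ltn e) alpha.
Proof.
elim: alpha => // a alpha IH; rewrite segcols_cons count_cat IH addnC /=; congr (_ + _).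
by rewrite count_uniq_mem ?iota_uniq // mem_iota.
Qed.

Lemma lattice_segcols alpha : lattice_word (segcols alpha).
Proof.
elim: alpha => [|a alpha IH]; first exact: LatticeNil.
rewrite segcols_cons; elim: a => [|a IHa]; first by rewrite cats0.
rewrite -(addn1 a) iotaD catA cats1; apply: LatticeRcons => //=.
rewrite add0n !count_cat !count_segcols !count_uniq_mem ?iota_uniq // !mem_iota /= !add0n ltnn.
have -> : (a.+1 < a) = false by rewrite ltnNge leqW.
by rewrite !addn0; apply: sub_count => b /ltnW.
Qed.

(** Reverse insertion gives a word with the columns of [T] and the landing columns of the segments;
    [syct_unique] then identifies its tableau with [T]. *)
Lemma SYCT_word alpha T : all (leq 1) alpha -> T \in SYCT alpha ->
  exists w, [/\ perm_eq w (iota 1 (sumn alpha)), good alpha w & insP w = T].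
Proof.
move=> al0 /(mem_SYCT _ al0)[sh pT sT].
have uT : uniq (flatten T) by rewrite (perm_uniq pT) iota_uniq.
have rd := reads_column uT.
have szT : size (flatten T) = size (segcols alpha).
  by rewrite (perm_size pT) size_iota size_segcols.
have yT : yam (flatten T) (column T) by move=> e z; rewrite !cnt_flatten // leq_rowcnt_cell.
have cnts e : count (fun v => column T v == e) (flatten T) = count_mem e (segcols alpha).
  pose m := \max_(v <- flatten T) v.
  have hm : {in flatten T, forall v, v <= m} by move=> v vT; exact: (@leq_bigmax_seq _ _ xpredT id v).
  rewrite count_segcols -[alpha]sh count_map.
  transitivity (cnt (flatten T) (column T) e m).
    by apply: eq_in_count => v /hm ->; rewrite andbT.
  rewrite cnt_flatten //; apply: eq_in_count => r rT /=.
  case er : (e < size r) => //=; apply: hm; apply/flattenP; exists r => //.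
  by rewrite mem_nth.
have [w [pw Dw cw]] := word_of_columns uT szT yT (lattice_segcols alpha) cnts.
have pw1 := perm_trans pw pT.
have uw : uniq w by rewrite (perm_uniq pw1) iota_uniq.
have [sP pP] := insP_syct uw.
have PT : insP w = T.
  apply: (syct_unique (Z := column T)) => //; first exact: insP_uniq.
    by rewrite (perm_trans _ pw) // perm_sym.
  by apply: reads_eq (reads_column (insP_uniq uw)) => v; rewrite mem_insP //; apply: cw.
exists w; split=> //; apply/good_insP => //; first by rewrite (perm_size pw1) size_iota.
by rewrite PT.
Qed.

Lemma word_SYCT alpha w : all (leq 1) alpha -> perm_eq w (iota 1 (sumn alpha)) -> good alpha w ->
  insP w \in SYCT alpha.
Proof.
move=> al0 pw gw; have uw : uniq w by rewrite (perm_uniq pw) iota_uniq.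
have sw : size w = sumn alpha by rewrite (perm_size pw) size_iota.
have [sh _] := (good_insP al0 uw sw).2 gw; have [sP pP] := insP_syct uw.
by apply/mem_SYCT => //; split=> //; rewrite (perm_trans _ pw) // perm_sym.
Qed.

Lemma good_insP_inj alpha w1 w2 : all (leq 1) alpha -> perm_eq w1 (iota 1 (sumn alpha)) ->
  perm_eq w2 (iota 1 (sumn alpha)) -> good alpha w1 -> good alpha w2 -> insP w1 = insP w2 -> w1 = w2.
Proof.
move=> al0 pw1 pw2 g1 g2 e; have uw w : perm_eq w (iota 1 (sumn alpha)) -> uniq w.
  by move/perm_uniq ->; apply: iota_uniq.
have sw w : perm_eq w (iota 1 (sumn alpha)) -> size w = sumn alpha.
  by move/perm_size ->; rewrite size_iota.
have [_ D1] := (good_insP al0 (uw _ pw1) (sw _ pw1)).2 g1.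
have [_ D2] := (good_insP al0 (uw _ pw2) (sw _ pw2)).2 g2.
apply: Dseq_inj; [exact: uw | by rewrite (perm_trans pw1) // perm_sym | by rewrite D1 | by rewrite e].
Qed.

Lemma canonical_SYCT alpha : all (leq 1) alpha -> canonical_filling alpha \in SYCT alpha.
Proof.
move=> al0; set T := canonical_filling alpha.
have sh : shape T = alpha by rewrite reshapeKl ?size_iota.
have fl : flatten T = iota 1 (sumn alpha) by rewrite reshapeKr ?size_iota.
have pos : all (fun r => 0 < size r) T.
  by apply/allP => r rT; apply: (allP al0); rewrite -sh map_f.
have ent i d : is_cell T i d -> entry T i d = (sumn (take i alpha) + d).+1.
  move=> ci; have iT := is_cell_size ci; have db : d < nth 0 alpha i by rewrite -sh shape_nth.
  have := nth_flatten 0 T (flatten_index alpha i d).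
  rewrite sh flatten_indexKl // flatten_indexKr // /entry => <-.
  by rewrite fl nth_iota //; apply: flatten_indexP.
apply/mem_SYCT => //; split; rewrite ?fl //.
have lt i j d e : i < j -> is_cell T i d -> is_cell T j e -> entry T i d < entry T j e.
  move=> ij ci cj; rewrite !ent // ltnS.
  have ia : i < size alpha by rewrite -sh size_map (is_cell_size ci).
  have dsz : d < nth 0 alpha i by rewrite -sh shape_nth // (is_cell_size ci).
  rewrite -(subnKC ij) takeD sumn_cat (take_nth 0 ia) sumn_rcons; move: dsz; clear; lia.
split=> [i iT|i d ci|i j ij cj|i j d ij cj ci le].
- exact: (all_nthP [::] pos).
- by rewrite (ent _ _ ci) (ent _ _ (is_cellS ci)) ltnS addnS.
- by apply: lt => //; apply: (all_nthP [::] pos); apply: ltn_trans (is_cell_size cj).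
by have := lt i j d.+1 d ij ci cj; lia.
Qed.

(** * The permutations of K_alpha *)

Lemma rising_swap alpha w i : uniq w -> rising alpha w -> i \in w -> i.+1 \in w ->
  index i.+1 w < index i w -> rising alpha [seq swapn i v | v <- w].
Proof.
elim: alpha w => //= a alpha IH w uw /andP[r1 r2] iw i1w lt.
rewrite -map_take -map_drop; set w' := take _ w in r1 *; set x := drop _ w in r2 *.
have wE : w = w' ++ x by rewrite cat_take_drop.
have hx s : sorted ltn s -> (i \notin s \/ i.+1 \notin s) -> sorted ltn [seq swapn i v | v <- s].
  move=> ss h; apply: (homo_sorted_in (P := mem s) _ _ ss) => [u v us vs|]; last exact/allP.
  exact: swapn_homo h _ _ us vs.
apply/andP; split.
  have [iw'|iw'] := boolP (i \in w'); last by apply: rising_map => //; apply: swapn_homo; left.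
  have [i1w'|i1w'] := boolP (i.+1 \in w'); last by apply: rising_map => //; apply: swapn_homo; right.
  apply: IH => //; first exact: take_uniq.
  by move: lt; rewrite wE !index_cat iw' i1w'.
apply: hx => //.
have [ix|ix] := boolP (i \in x); last by left.
have [i1x|i1x] := boolP (i.+1 \in x); last by right.
exfalso; have dis v : v \in x -> v \notin w'.
  by move=> vx; move: uw; rewrite wE cat_uniq => /and3P[_ /hasPn/(_ v vx)].
move: lt; rewrite wE !index_cat (negbTE (dis _ ix)) (negbTE (dis _ i1x)) ltn_add2l => lt.
have := sorted_ltn_nth ltn_trans 0 r2 _ _ _ _ lt; rewrite !inE !index_mem !nth_index //.
by move=> /(_ i1x ix); rewrite ltnNge leqnSn.
Qed.

Section Words.
Variable n : nat.
Implicit Types s : 'S_n.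

Definition wd s : seq nat := word (longest n * s)%g.

Lemma nth_wd s (p : 'I_n) : nth 0 (wd s) p = (s (rev_ord p)).+1.
Proof.
rewrite /wd /word (nth_map p) ?size_enum_ord // nth_ord_enum permM.
by rewrite /longest permE.
Qed.

Lemma size_wd s : size (wd s) = n.
Proof. by rewrite size_map size_enum_ord. Qed.

Lemma wd_uniq s : uniq (wd s).
Proof.
rewrite map_inj_uniq ?enum_uniq // => u v [/val_inj]; exact: perm_inj.
Qed.

Lemma perm_wd s : perm_eq (wd s) (iota 1 n).
Proof.
apply: uniq_perm; rewrite ?wd_uniq ?iota_uniq //.
have sub : {subset wd s <= iota 1 n}.
  by move=> v /mapP[i _ ->]; rewrite mem_iota /= add1n; apply: ltn_ord.
by have [|_ //] := uniq_min_size (wd_uniq s) sub; rewrite size_iota size_wd.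
Qed.

Lemma index_wd s (v : 'I_n) : index v.+1 (wd s) = rev_ord (s^-1%g v).
Proof.
have -> : v.+1 = nth 0 (wd s) (rev_ord (s^-1%g v)) by rewrite nth_wd rev_ordK permKV.
by rewrite index_uniq ?size_wd ?wd_uniq.
Qed.

Lemma wd_inj : injective wd.
Proof.
move=> s t e; apply/permP => p; apply/val_inj.
by have := congr1 (nth 0 ^~ (rev_ord p)) e; rewrite !nth_wd rev_ordK => -[].
Qed.

Lemma wd_surj w : perm_eq w (iota 1 n) -> exists s, wd s = w.
Proof.
move=> pw; have uw : uniq w by rewrite (perm_uniq pw) iota_uniq.
have sw : size w = n by rewrite (perm_size pw) size_iota.
have lt (p : 'I_n) : (nth 0 w (rev_ord p)).-1 < n.
  have : nth 0 w (rev_ord p) \in w by rewrite mem_nth // sw.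
  by rewrite (perm_mem pw) mem_iota; lia.
pose f p := Ordinal (lt p).
have fE p : (f p).+1 = nth 0 w (rev_ord p).
  have : nth 0 w (rev_ord p) \in w by rewrite mem_nth // sw.
  by rewrite (perm_mem pw) mem_iota => /andP[/prednK].
have fi : injective f.
  move=> p q /(congr1 (fun o : 'I_n => o.+1)); rewrite !fE.
  by move/eqP; rewrite nth_uniq ?sw // => /eqP/val_inj/rev_ord_inj.
exists (perm fi); apply: (@eq_from_nth _ 0); rewrite ?size_wd ?sw // => i lti.
by rewrite -[ i]/(nat_of_ord (Ordinal lti)) nth_wd permE fE rev_ordK.
Qed.

(** In the reversed word, a left descent means that the smaller letter comes first. *)
Definition desn s k := index k (wd s) < index k.+1 (wd s).

Lemma DesL_desn s (i : 'I_n.-1) : DesL s i = desn s i.+1.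
Proof.
have := index_wd s (lo_ord i); have := index_wd s (hi_ord i); rewrite /= /desn /DesL => -> ->.
have := ltn_ord (s^-1%g (lo_ord i)); have := ltn_ord (s^-1%g (hi_ord i)) => /=; lia.
Qed.

Lemma wd_simple s (i : 'I_n.-1) : wd (s * simple i)%g = [seq swapn i.+1 v | v <- wd s].
Proof.
apply: (@eq_from_nth _ 0) => [|p]; first by rewrite [RHS]size_map !size_wd.
rewrite size_wd => pn.
rewrite [RHS](nth_map 0) ?size_wd // -[p]/(nat_of_ord (Ordinal pn)) !nth_wd permM.
rewrite /simple /swapn !eqSS; case: tpermP => [->|->|/eqP h1 /eqP h2] /=; rewrite ?eqxx //.
  by rewrite (gtn_eqF (ltnSn _)).
by rewrite (negbTE h1 : (_ == nat_of_ord i) = false) (negbTE h2 : (_ == i.+1) = false).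
Qed.

Lemma mem_wd s (i : 'I_n.-1) : (i.+1 \in wd s) * (i.+2 \in wd s).
Proof.
have h := ltn_ord i.
by split; rewrite (perm_mem (perm_wd s)) mem_iota; lia.
Qed.

Lemma DesL_simple s i : DesL (s * simple i)%g i = ~~ DesL s i.
Proof.
rewrite /DesL invMg !permM /simple tpermV tpermL tpermR -leqNgt [RHS]leq_eqVlt.
case: eqP => //= e; exfalso.
by have /(congr1 val) /= := perm_inj (val_inj e); lia.
Qed.

Lemma simpleK s i : (s * simple i * simple i)%g = s.
Proof. by rewrite -mulgA tperm2 mulg1. Qed.

Section Alpha.
Variable alpha : seq nat.
Hypothesis halpha : is_comp n alpha.
Let al0 : all (leq 1) alpha. Proof. by case/andP: halpha. Qed.
Let an : sumn alpha = n. Proof. by case/andP: halpha => _ /eqP. Qed.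

Lemma mem_Kset s : s \in Kset n alpha <-> good alpha (wd s).
Proof.
have sw : size (wd s) = sumn alpha by rewrite size_wd an.
rewrite inE -(good_insP al0 (wd_uniq s) sw); split=> [/andP[/eqP sh /eqP hQ]|[sh hQ]].
  by split=> //; apply/hatQ_canonical => //; apply: wd_uniq.
apply/andP; split; apply/eqP => //.
by apply/hatQ_canonical => //; apply: wd_uniq.
Qed.

Definition segment_rising s := rising alpha (wd s).

Lemma Kset_rising s : s \in Kset n alpha -> segment_rising s.
Proof. by move/mem_Kset; apply: good_rising. Qed.

Lemma rising_simple s i : segment_rising s -> ~~ DesL s i -> segment_rising (s * simple i)%g.
Proof.
move=> rs; rewrite DesL_desn /segment_rising wd_simple => nd.
have [h1 h2] := mem_wd s i.
apply: rising_swap; rewrite ?wd_uniq //; move: nd; rewrite /desn -leqNgt leq_eqVlt => /orP[/eqP e|//].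
by have := congr1 (nth 0 (wd s)) e; rewrite !nth_index // => /eqP; rewrite gtn_eqF.
Qed.

Lemma Kset_simple s i : s \in Kset n alpha -> DesL s i -> segment_rising (s * simple i)%g ->
  (s * simple i)%g \in Kset n alpha.
Proof.
move=> /mem_Kset gs; rewrite DesL_desn /segment_rising => ds rs; apply/mem_Kset.
rewrite wd_simple; apply: good_swap; rewrite ?wd_uniq ?size_wd ?an ?mem_wd //.
by rewrite -wd_simple.
Qed.

Lemma Kset_minimal s : s \in Kset n alpha -> wd s = canon 1 alpha \/
  exists i, DesL s i /\ (s * simple i)%g \in Kset n alpha.
Proof.
move=> sK; have gs := (mem_Kset s).1 sK.
have pw : perm_eq (wd s) (iota 1 (sumn alpha)) by rewrite an perm_wd.
have [|[k [kw k1w lt rk]]] := canon_or_swap al0 gs pw; [by left | right].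
have hk : 0 < k < n by move: kw k1w; rewrite !(perm_mem pw) !mem_iota an; lia.
have kn : k.-1 < n.-1 by lia.
pose i := Ordinal kn; have ik : i.+1 = k by rewrite /= prednK //; case/andP: hk.
have di : DesL s i by rewrite DesL_desn ik.
by exists i; split=> //; apply: Kset_simple; rewrite // /segment_rising wd_simple ik.
Qed.

Lemma Kset_canon s t : s \in Kset n alpha -> wd t = canon 1 alpha ->
  (forall i, DesL t i -> DesL s i) -> s = t.
Proof.
move=> /mem_Kset gs tc H; apply: wd_inj; rewrite tc.
apply: canon_unique; rewrite ?an ?perm_wd //.
move=> k k0 kn; rewrite -tc => h.
have k1n : k.-1 < n.-1 by move: k0 kn; rewrite add1n ltnS; lia.
have := H (Ordinal k1n); rewrite !DesL_desn /= prednK //; exact.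
Qed.

End Alpha.
End Words.

(** * The 0-Hecke action on all permutations *)

Section TotalAction.
Variable n : nat.
Implicit Types s : 'S_n.

Definition hecke_act (i : 'I_n.-1) s := if DesL s i then s else (s * simple i)%g.

(* [hecke_act i] sorts the positions of the letters i and i+1 in decreasing order. *)
Definition pos s (v : nat) : nat := if insub v is Some o then (s^-1)%g o else 0.

Lemma pos_inj s t : pos s =1 pos t -> s = t.
Proof.
move=> h; apply: invg_inj; apply/permP => v; apply/val_inj.
by have := h v; rewrite /pos valK.
Qed.

Definition sort_pos i (f : nat -> nat) v :=
  if v == i then maxn (f i) (f i.+1) else if v == i.+1 then minn (f i) (f i.+1) else f v.

Lemma eq_sort_pos i f g : f =1 g -> sort_pos i f =1 sort_pos i g.
Proof. by move=> h v; rewrite /sort_pos !h. Qed.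

Lemma pos_act i s : pos (hecke_act i s) =1 sort_pos i (pos s).
Proof.
have hi : pos s i.+1 = (s^-1)%g (hi_ord i) by rewrite -[i.+1]/(val (hi_ord i)) /pos valK.
have lo : pos s i = (s^-1)%g (lo_ord i) by rewrite -[nat_of_ord i]/(val (lo_ord i)) /pos valK.
move=> v; rewrite /sort_pos hi lo /hecke_act /DesL; case: ltnP => h.
  case: eqP => [->|_]; first by rewrite lo; move: h; clear; lia.
  by case: eqP => [->|_] //; rewrite hi; move: h; clear; lia.
rewrite {1}/pos invMg; case: insubP => [o ov <-|nv].
  rewrite permM /simple tpermV; case: tpermP => [->|->|/eqP h1 /eqP h2] /=.
  - by rewrite eqxx.
  - by rewrite gtn_eqF // eqxx.
  rewrite (negbTE h1 : (nat_of_ord o == i) = false) (negbTE h2 : (nat_of_ord o == i.+1) = false).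
  by rewrite /pos valK.
have lt1 := ltn_ord (hi_ord i); have lt0 := ltn_ord (lo_ord i).
have -> : (v == i) = false by apply: contraNF nv => /eqP ->.
have -> : (v == i.+1) = false by apply: contraNF nv => /eqP ->.
by rewrite /pos insubN.
Qed.

Lemma hecke_act_des i s : DesL (hecke_act i s) i.
Proof. by rewrite /hecke_act; case: ifP => // h; rewrite DesL_simple h. Qed.

Lemma hecke_act_idem i s : hecke_act i (hecke_act i s) = hecke_act i s.
Proof. by rewrite {1}/hecke_act hecke_act_des. Qed.

(** Both sides sort the positions of three consecutive letters in decreasing order. *)
Lemma hecke_act_braid (i j : 'I_n.-1) s : j = i.+1 :> nat ->
  hecke_act i (hecke_act j (hecke_act i s)) = hecke_act j (hecke_act i (hecke_act j s)).
Proof.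
move=> ij; apply: pos_inj => v.
rewrite !(pos_act, eq_sort_pos _ (pos_act _ _), eq_sort_pos _ (eq_sort_pos _ (pos_act _ _))) ij.
move: (pos s) (nat_of_ord i) => f k; rewrite /sort_pos.
have e1 : (k == k.+1) = false by rewrite ltn_eqF.
have e2 : (k == k.+2) = false by rewrite ltn_eqF // leqW.
have e3 : (k.+1 == k.+2) = false by rewrite ltn_eqF.
rewrite !eqxx !(eq_sym k.+2) !(eq_sym k.+1 k) e1 e2 e3.
case: (eqVneq v k) => [->|vi]; first by rewrite e1 e2; clear; lia.
case: (eqVneq v k.+1) => [v1|v1]; first by rewrite ?v1 ?e3; clear; lia.
by case: (eqVneq v k.+2) => // _; clear; lia.
Qed.

Lemma hecke_act_comm (i j : 'I_n.-1) s : i.+1 < j ->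
  hecke_act i (hecke_act j s) = hecke_act j (hecke_act i s).
Proof.
move=> ij; apply: pos_inj => v; rewrite !(pos_act, eq_sort_pos _ (pos_act _ _)).
move: (pos s) => f; rewrite /sort_pos.
have e1 : (i == j :> nat) = false by lia.
have e2 : (i.+1 == j :> nat) = false by lia.
have e3 : (i == j.+1 :> nat) = false by lia.
have e4 : (i.+1 == j.+1 :> nat) = false by lia.
have e5 : (j.+1 == i :> nat) = false by lia.
have e6 : (j.+1 == i.+1 :> nat) = false by lia.
rewrite e1 e2 e3 e4 !(eq_sym (nat_of_ord j)) e1 e2 e5 e6.
case: (eqVneq v i) => [->|vi]; first by rewrite e1 e3.
by case: (eqVneq v i.+1) => [->|v1]; first by rewrite e2 e4.
Qed.

(** A linear statistic in place of the length: by rearrangement it grows when a descent is removed,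
    so a nontrivial step of [hecke_act] lowers it, and within [Kset] it is maximal at the source. *)
Definition inversion_weight s : nat := \sum_(v < n) v * (s^-1)%g v.

Lemma inversion_weight_simple s i : DesL s i -> inversion_weight s < inversion_weight (s * simple i)%g.
Proof.
rewrite /DesL /inversion_weight => lt.
have ne : hi_ord i != lo_ord i by rewrite -(inj_eq val_inj) /= gtn_eqF.
rewrite (bigD1 (lo_ord i)) //= [X in _ < X](bigD1 (lo_ord i)) //=.
rewrite (bigD1 (hi_ord i)) //= [X in _ < _ + X](bigD1 (hi_ord i)) //=.
rewrite !invMg !permM /simple tpermV tpermL tpermR.
rewrite [X in _ < _ + (_ + X)](eq_bigr (fun v : 'I_n => v * (s^-1)%g v)).
  move: lt; move: ((s^-1)%g (lo_ord i)) ((s^-1)%g (hi_ord i)) => a b.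
  by move: (\sum_(_ < n | _) _) => r; clear; lia.
by move=> v /andP[h1 h2]; rewrite permM tpermD // eq_sym.
Qed.

End TotalAction.

(** * Compositions and complements *)

Lemma sum_take_pairmap c S k : path ltn c S -> k <= size S ->
  c + sumn (take k (pairmap (fun a b => b - a) c S)) = nth c (c :: S) k.
Proof.
elim: S c k => [|b S IH] c [|k] //=; rewrite ?addn0 // ltnS => /andP[cb bS] kS.
rewrite addnA subnKC ?(ltnW cb) // IH //; case: k kS => //= k kS.
by apply: set_nth_default.
Qed.

Section CompOfSet.
Variables (n : nat) (S : seq nat).
Hypotheses (sS : sorted ltn S) (S0 : {in S, forall v, 0 < v < n}).

Let path_rcons : 0 < n -> path ltn 0 (rcons S n).
Proof.
move=> n0; rewrite rcons_path; apply/andP; split.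
  by case: S sS S0 => //= b s -> h; have /andP[-> _] := h b (mem_head _ _).
case/lastP: S S0 => //= s b h; rewrite last_rcons.
by have := h b; rewrite mem_rcons mem_head => /(_ isT)/andP[].
Qed.

Lemma comp_of_set_comp : is_comp n (comp_of_set n S).
Proof.
rewrite /is_comp /comp_of_set; case: n path_rcons => // m /(_ isT) p.
apply/andP; split.
  have pos c s : path ltn c s -> all (leq 1) (pairmap (fun a b => b - a) c s).
    by elim: s c => //= b s IH c /andP[cb bs]; rewrite subn_gt0 [c < b]cb IH.
  exact: pos p.
have := sum_take_pairmap p (leqnn _); rewrite add0n take_oversize ?size_pairmap // => ->.
by rewrite size_rcons /= nth_rcons ltnn eqxx.
Qed.

Lemma comp_set_of_set : comp_set (comp_of_set n S) = S.
Proof.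
rewrite /comp_set /comp_of_set; case: n S0 path_rcons => [|m] h.
  by case: S h => // b s h; have /andP[] := h b (mem_head _ _).
move=> /(_ isT) p; apply: (@eq_from_nth _ 0).
  by rewrite size_map size_iota size_pairmap size_rcons.
move=> i; rewrite size_map size_iota size_pairmap size_rcons /= => iS.
rewrite (nth_map 0) ?size_iota // nth_iota // add1n.
have := @sum_take_pairmap 0 (rcons S m.+1) i.+1 p; rewrite add0n => -> /=.
  by rewrite nth_rcons iS.
by rewrite size_rcons ltnW.
Qed.
End CompOfSet.

Lemma forall_triple (T : filling) (P : nat -> nat -> nat -> bool) :
  [forall j : 'I_(size T), forall i : 'I_j, forall k : 'I_(size (nth [::] T j)), P i j k] <->
  (forall i j k, i < j -> is_cell T j k -> P i j k).
Proof.
split=> [/forallP H i j k ij cj|H].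
  have ck : k < size (nth [::] T j) := cj.
  exact: (forallP (forallP (H (Ordinal (is_cell_size cj))) (Ordinal ij)) (Ordinal ck)).
by apply/forallP => j; apply/forallP => i; apply/forallP => k; apply: H; apply: ltn_ord.
Qed.

Section Complement.
Variable n : nat.

(** Complementing the entries exchanges the two kinds of tableaux of a given shape and turns i into
    n - i, as the automorphism phi does with the generators. *)
Definition complement (T : filling) : filling := [seq [seq n.+1 - v | v <- r] | r <- T].

Lemma row_complement T i : nth [::] (complement T) i = [seq n.+1 - v | v <- nth [::] T i].
Proof.
case: (ltnP i (size T)) => iT; first by rewrite (nth_map [::]).
by rewrite !nth_default ?size_map.
Qed.

Lemma is_cell_complement T i d : is_cell (complement T) i d = is_cell T i d.
Proof. by rewrite /is_cell row_complement size_map. Qed.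

Lemma entry_complement T i d : is_cell T i d -> entry (complement T) i d = n.+1 - entry T i d.
Proof. by move=> c; rewrite /entry row_complement (nth_map 0). Qed.

Lemma shape_complement T : shape (complement T) = shape T.
Proof. by rewrite /shape -map_comp; apply: eq_map => r /=; rewrite size_map. Qed.

Lemma flatten_complement T : flatten (complement T) = [seq n.+1 - v | v <- flatten T].
Proof. by rewrite map_flatten. Qed.

Variable T : filling.
Hypothesis pT : perm_eq (flatten T) (iota 1 n).

Let bound v : v \in flatten T -> 0 < v <= n.
Proof. by rewrite (perm_mem pT) mem_iota add1n ltnS. Qed.

Lemma complementK : complement (complement T) = T.
Proof.
rewrite /complement -map_comp -[RHS]map_id; apply/eq_in_map => r rT /=.
rewrite -map_comp -[RHS]map_id; apply/eq_in_map => v vr /=.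
have /bound : v \in flatten T by apply/flattenP; exists r.
lia.
Qed.

Lemma perm_complement : perm_eq (flatten (complement T)) (iota 1 n).
Proof.
rewrite flatten_complement (perm_trans (perm_map _ pT)) //.
apply: uniq_perm; rewrite ?iota_uniq //.
  by rewrite map_inj_in_uniq ?iota_uniq // => u v; rewrite !mem_iota; lia.
move=> v; rewrite mem_iota; apply/mapP/idP => [[u]|vn].
  by rewrite mem_iota => un ->; move: un; lia.
by exists (n.+1 - v); rewrite ?mem_iota; move: vn; lia.
Qed.

Lemma column_complement v : 0 < v <= n -> column (complement T) v = column T (n.+1 - v).
Proof.
move=> vn; have : n.+1 - v \in flatten T by rewrite (perm_mem pT) mem_iota; move: vn; lia.
case/mem_flatten=> i [d [ci e]].
have uT : uniq (flatten T) by rewrite (perm_uniq pT) iota_uniq.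
have uC : uniq (flatten (complement T)) by rewrite (perm_uniq perm_complement) iota_uniq.
have := reads_column uC (_ : is_cell (complement T) i d); rewrite is_cell_complement => /(_ ci).
rewrite entry_complement // e (_ : n.+1 - (n.+1 - v) = v); last by move: vn; lia.
by move=> ->; rewrite -e reads_column.
Qed.

Lemma DesC_complement : DesC n (complement T) =
  [seq i <- iota 1 n.-1 | column T (n - i).+1 <= column T (n - i)].
Proof.
apply: eq_in_filter => i; rewrite mem_iota => i_n.
rewrite !column_complement; [|move: i_n; lia|move: i_n; lia].
by congr (column T _ <= column T _); move: i_n; lia.
Qed.

Lemma is_SCT_complement : all (fun r => 0 < size r) T -> is_SCT (complement T) = is_SYCT T.
Proof.
move=> pos; rewrite /is_SCT /is_SYCT.
have rows : all (sorted geq) (complement T) = all (sorted leq) T.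
  rewrite all_map; apply: eq_in_all => r rT /=.
  have br v : v \in r -> 0 < v <= n by move=> vr; apply: bound; apply/flattenP; exists r.
  apply: (mono_sorted_in (P := mem r)); last by apply/allP.
  by move=> u v /br hu /br hv; apply/idP/idP; rewrite /=; move: hu hv; lia.
have col : sorted gtn (first_column (complement T)) = sorted ltn (first_column T).
  have -> : first_column (complement T) = [seq n.+1 - v | v <- first_column T].
    rewrite /first_column -!map_comp; apply/eq_in_map => r rT /=.
    by have := allP pos r rT; case: r {rT}.
  apply: (mono_sorted_in (P := mem (first_column T))); last by apply/allP.
  have bc v : v \in first_column T -> 0 < v <= n.
    case/mapP=> r rT ->; apply: bound; apply/flattenP; exists r => //.
    by have := allP pos r rT; case: (r) => //= x s _; rewrite mem_head.
  by move=> u v /bc hu /bc hv; apply/idP/idP; rewrite /=; move: hu hv; lia.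
pose PY i j k := (is_cell T i k.+1 && (entry T j k <= entry T i k.+1)) ==>
  (is_cell T j k.+1 && (entry T j k.+1 < entry T i k.+1)).
pose U := complement T.
pose PS i j k := (is_cell U i k.+1 && (entry U i k.+1 <= entry U j k)) ==>
  (is_cell U j k.+1 && (entry U i k.+1 < entry U j k.+1)).
have PYS i j k : is_cell T j k -> PS i j k = PY i j k.
  move=> cj; rewrite /PS /PY /U !is_cell_complement; case ci : (is_cell T i k.+1) => //=.
  have bi := bound (entry_in ci); have bj := bound (entry_in cj).
  rewrite (entry_complement ci) (entry_complement cj).
  case cj1 : (is_cell T j k.+1) => /=; last by congr (_ ==> _); move: bi bj; clear; lia.
  have bj1 := bound (entry_in cj1).
  by rewrite (entry_complement cj1) /=; congr (_ ==> _); move: bi bj bj1; clear; lia.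
rewrite rows col; congr [&& _, _ & _].
apply/idP/idP => [/(forall_triple U PS) H|/(forall_triple T PY) H].
  apply/(forall_triple T PY) => i j k ij cj; rewrite -PYS //; apply: H => //.
  by rewrite is_cell_complement.
apply/(forall_triple U PS) => i j k ij; rewrite is_cell_complement => cj; rewrite PYS //.
exact: H.
Qed.
End Complement.

Lemma perm_complement_SYCT alpha : all (leq 1) alpha ->
  perm_eq [seq complement (sumn alpha) T | T <- SYCT alpha] (SCT alpha).
Proof.
move=> al0; set n := sumn alpha.
have std T : T \in standard_fillings alpha ->
    [/\ perm_eq (flatten T) (iota 1 n), all (fun r => 0 < size r) T
      & complement n T \in standard_fillings alpha].
  move=> /mem_standard[sh pT]; split=> //.
    by apply/allP => r rT; apply: (allP al0); rewrite -sh map_f.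
  by apply/mem_standard; rewrite shape_complement; split=> //; apply: perm_complement.
apply: uniq_perm.
- rewrite map_inj_in_uniq ?SYCT_uniq // => T T'; rewrite !mem_filter.
  case/andP=> _ /std[pT _ _] /andP[_ /std[pT' _ _]] e.
  by rewrite -(complementK pT) e complementK.
- exact: filter_uniq (standard_uniq alpha).
move=> U; rewrite [RHS]mem_filter; apply/mapP/andP => [[T]|[scU stU]].
  by rewrite mem_filter => /andP[sT /std[pT pos stT]] ->; rewrite is_SCT_complement.
have [pU posU stC] := std U stU; have [pC posC _] := std _ stC.
exists (complement n U); last by rewrite complementK.
by rewrite mem_filter stC andbT -(is_SCT_complement pC posC) complementK.
Qed.

Import GRing.Theory.
Local Open Scope ring_scope.

(** * The module Y_alpha *)

Section HeckeInduction.
Variables (F : fieldType) (n : nat).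

Lemma hecke_ind (P : hecke F n -> Prop) : P 1 -> (forall i, P (hecke_gen F i)) ->
    (forall x y, P x -> P y -> P (x + y)) -> (forall x y, P x -> P y -> P (x * y)) ->
    (forall c x, P x -> P (c *: x)) -> forall x, P x.
Proof.
move=> P1 Pg PD PM PZ x; rewrite -[x]hecke_reprK; move: (generic_quotient.repr x) => {}x.
have Pw (w : {fmonom 'I_n.-1}) : P (hecke_pi (<< w >> : {malg F[{fmonom 'I_n.-1}]})).
  case: w => s; elim: s => [|i s IH].
    suff -> : FMonom [::] = @mone _ :> {fmonom 'I_n.-1} by [].
    by apply/val_inj; rewrite /= fm1.
  have -> : FMonom (i :: s) = mmul (fmu i) (FMonom s) by apply/val_inj; rewrite /= fmM fmU.
  have -> : << mmul (fmu i) (FMonom s) >> = free_gen F i * << FMonom s >>.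
    by rewrite malgM_def fgmulUU mulr1.
  by rewrite -hecke_pi_mul; exact: (PM _ _ (Pg i) IH).
rewrite [x]monalgE; elim/big_ind: _ => [|u v hu hv|w _].
- rewrite -[0](scale0r 1) hecke_piZ; exact: PZ.
- by rewrite hecke_piD; apply: PD.
have -> : << mcoeff w x *g w >> = mcoeff w x *: << w >> :> {malg F[{fmonom 'I_n.-1}]}.
  by apply/malgP => k; rewrite mcoeffZ !mcoeffU mulrnAr mulr1.
by rewrite hecke_piZ; apply: PZ.
Qed.
End HeckeInduction.

Section Operators.
Variables (F : fieldType) (n : nat) (alpha : seq nat).
Hypothesis halpha : is_comp n alpha.
Local Notation K := (Kset n alpha).
Local Notation V := (Yspace F n alpha).
Local Notation vec := (@Yvec F n alpha).

Lemma Yvec_out s : s \notin K -> vec s = 0.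
Proof.
move=> sK; apply/ffunP => t; rewrite !ffunE; case: eqP => // ts.
by case/negP: sK; rewrite -ts; apply: valP.
Qed.

Lemma Yvec_sum (u : V) : u = \sum_t u t *: vec (val t).
Proof.
apply/ffunP => t; rewrite sum_ffunE (bigD1 t) //= !ffunE eqxx [_ *: _]mulr1.
rewrite big1 ?addr0 // => t' ne; rewrite !ffunE.
by rewrite (inj_eq val_inj) eq_sym (negbTE ne) [_ *: _]mulr0.
Qed.

Lemma Yvec_eq0 s : s \in K -> vec s != 0.
Proof.
move=> sK; apply/eqP => /ffunP/(_ (exist _ s sK)); rewrite !ffunE /= eqxx => /eqP.
by rewrite oner_eq0.
Qed.

Lemma Yvec_span (U : {vspace V}) : (forall s, s \in K -> vec s \in U) -> U = fullv.
Proof.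
move=> h; apply/eqP; rewrite eqEsubv subvf; apply/subvP => u _.
by rewrite [u]Yvec_sum; apply: rpred_sum => t _; apply/rpredZ/h/valP.
Qed.

(** Since [Yvec] vanishes outside [Kset], this is the action on all permutations followed by the
    projection to the span of [Kset]. *)
Definition act_fun (i : 'I_n.-1) (u : V) : V := \sum_t u t *: vec (hecke_act i (val t)).

Fact act_fun_linear i : linear (act_fun i).
Proof.
move=> a u v; rewrite /act_fun scaler_sumr -big_split; apply: eq_bigr => t _ /=.
by rewrite !ffunE scalerDl scalerA.
Qed.
HB.instance Definition _ i := GRing.isLinear.Build F V V _ (act_fun i) (act_fun_linear i).

Definition act_op i : 'End(V) := linfun (act_fun i).

(* K_alpha is the difference of two sets, the outer one being [segment_rising],
   both stable under the increasing moves of [hecke_act]. *)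
Lemma act_opE i (s : 'S_n) : segment_rising alpha s -> act_op i (vec s) = vec (hecke_act i s).
Proof.
move=> rs; rewrite lfunE /= /act_fun; have [sK|sK] := boolP (s \in K).
  rewrite (bigD1 (exist _ s sK)) //= ffunE eqxx scale1r big1 ?addr0 // => t ne.
  rewrite ffunE /= (_ : (val t == s) = false) ?scale0r //.
  by apply: contraNF ne => /eqP e; apply/eqP/val_inj.
rewrite big1 => [|t _]; last first.
  rewrite ffunE (_ : (val t == s) = false) ?scale0r //.
  by apply: contraNF sK => /eqP <-; apply: valP.
rewrite Yvec_out // /hecke_act; case: ifP => // /negbT nd.
apply: contra sK => sK; rewrite -(simpleK s i); apply: Kset_simple => //.
  by rewrite DesL_simple.
by rewrite simpleK.
Qed.

Lemma hecke_act_rising i (s : 'S_n) : segment_rising alpha s -> segment_rising alpha (hecke_act i s).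
Proof. by rewrite /hecke_act; case: ifP => // /negbT nd /rising_simple; apply. Qed.

Lemma eq_on_basis (f g : 'End(V)) : (forall s, s \in K -> f (vec s) = g (vec s)) -> f = g.
Proof.
move=> h; apply/lfunP => u; rewrite [u]Yvec_sum !linear_sum; apply: eq_bigr => t _.
by rewrite !linearZ /=; congr (_ *: _); apply/h/valP.
Qed.

Lemma Y_exists : exists Y : hmodule n V, is_Y Y.
Proof.
have rK s : s \in K -> segment_rising alpha s := @Kset_rising _ _ halpha s.
have [|||Y hY] := @hmodule_of_operators F n V act_op.
- move=> i; apply: eq_on_basis => s /rK rs.
  by rewrite comp_lfunE !act_opE ?hecke_act_rising // hecke_act_idem.
- move=> i j ij; apply: eq_on_basis => s /rK rs.
  by rewrite !comp_lfunE !act_opE ?hecke_act_rising // hecke_act_braid.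
- move=> i j ij; apply: eq_on_basis => s /rK rs.
  by rewrite !comp_lfunE !act_opE ?hecke_act_rising // hecke_act_comm.
exists Y => i s sK; rewrite hY act_opE ?rK // /hecke_act; case: ifP => // _.
by case: ifP => // /negbT; apply: Yvec_out.
Qed.

Lemma is_Y_act (Y : hmodule n V) i s : is_Y Y -> s \in K ->
  Y (hecke_gen F i) (vec s) = vec (hecke_act i s).
Proof.
move=> hY sK; rewrite hY // /hecke_act; case: ifP => // _.
by case: ifP => // /negbT /Yvec_out ->.
Qed.

End Operators.

(** * Generation by the source and indecomposability *)

Section Indecomposable.
Variables (F : fieldType) (n : nat) (alpha : seq nat).
Hypothesis halpha : is_comp n alpha.
Local Notation K := (Kset n alpha).
Local Notation V := (Yspace F n alpha).
Local Notation vec := (@Yvec F n alpha).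
Let al0 : all (leq 1) alpha. Proof. by case/andP: halpha. Qed.
Let an : sumn alpha = n. Proof. by case/andP: halpha => _ /eqP. Qed.

Lemma Kset_nonempty : exists s, s \in K.
Proof.
have [w [pw gw _]] := SYCT_word al0 (canonical_SYCT al0).
rewrite an in pw; have [s sw] := wd_surj pw.
by exists s; apply/(mem_Kset halpha); rewrite sw.
Qed.

Lemma Kset_source : exists2 s0, s0 \in K & wd s0 = canon 1 alpha.
Proof.
have [s sK] := Kset_nonempty.
have [s0 s0K max0] := @arg_maxnP _ s (mem K) (@inversion_weight n) sK.
exists s0 => //; have [//|[i [di siK]]] := Kset_minimal halpha s0K.
by have := leq_trans (inversion_weight_simple di) (max0 _ siK); rewrite ltnn.
Qed.

Variable Y : hmodule n V.
Hypothesis hY : is_Y Y.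
Variable s0 : 'S_n.
Hypotheses (s0K : s0 \in K) (s0c : wd s0 = canon 1 alpha).
Local Notation pi i := (Y (hecke_gen F i)).

Let stable (U : {vspace V}) := forall i v, v \in U -> pi i v \in U.

Lemma cyclic_source (U : {vspace V}) : stable U -> vec s0 \in U -> U = fullv.
Proof.
move=> sU s0U; apply: Yvec_span => s.
pose N := (n * (n * n))%N.
have bound (t : 'S_n) : (inversion_weight t <= N)%N.
  have le : (inversion_weight t <= \sum_(v < n) n * n)%N.
    rewrite /inversion_weight. by apply: leq_sum => v _; apply: leq_mul; apply: ltnW.
  by rewrite sum_nat_const card_ord in le.
move: {2}(N - inversion_weight s)%N (leqnn (N - inversion_weight s)) => m.
elim: m s => [|m IH] s le sK; have [sc|[i [di siK]]] := Kset_minimal halpha sK.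
- by rewrite (wd_inj (etrans sc (esym s0c))).
- move: le; rewrite leqn0 subn_eq0 => le.
  by have := leq_trans (leq_trans (inversion_weight_simple di) (bound _)) le; rewrite ltnn.
- by rewrite (wd_inj (etrans sc (esym s0c))).
have := sU i _ (IH _ _ siK); rewrite (is_Y_act _ hY siK) /hecke_act DesL_simple di /= simpleK; apply.
have arith a b c d : (a < b -> c - a <= d.+1 -> c - b <= d)%N by lia.
exact: arith (inversion_weight_simple di) le.
Qed.

(** The image of pi_i is supported on permutations with descent i. *)
Lemma fixed_support i (u : V) t : pi i u = u -> ~~ DesL (val t) i -> u t = 0.
Proof.
move=> <- nd; rewrite [u]Yvec_sum linear_sum sum_ffunE big1 // => t' _.
rewrite linearZ /= (is_Y_act _ hY (valP t')) !ffunE (_ : _ == _ = false) ?[_ *: _]mulr0 //.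
by apply: contraNF nd => /eqP ->; apply: hecke_act_des.
Qed.

Lemma source_line (u : V) : (forall i, DesL s0 i -> pi i u = u) -> exists c, u = c *: vec s0.
Proof.
move=> h; exists (u (exist _ s0 s0K)); rewrite {1}[u]Yvec_sum (bigD1 (exist _ s0 s0K)) //=.
rewrite big1 ?addr0 // => t ne.
suff -> : u t = 0 by rewrite scale0r.
have [/forallP al|] := boolP [forall i, DesL s0 i ==> DesL (val t) i].
  case/negP: ne; apply/eqP/val_inj/(Kset_canon halpha (valP t) s0c) => i.
  exact: (implyP (al i)).
rewrite negb_forall => /existsP[ i]; rewrite negb_imply => /andP[d0 dt].
exact: fixed_support (h i d0) dt.
Qed.

(** Let u be the component of [vec s0] in [U]. If pi_i fixes [vec s0], then pi_i u - u lies in [U]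
    and in [W], so pi_i fixes u too. Hence u is a multiple of [vec s0], and one of the two summands
    contains the generator. *)
Lemma stable_indecomposable (U W : {vspace V}) : stable U -> stable W ->
  (U + W)%VS = fullv -> (U :&: W)%VS = 0%VS -> U = 0%VS \/ W = 0%VS.
Proof.
move=> sU sW UW dis.
have : vec s0 \in (U + W)%VS by rewrite UW memvf.
case/memv_addP=> u uU [w wW uw].
have fix_u i : DesL s0 i -> pi i u = u.
  move=> di; apply/eqP; rewrite -subr_eq0 -memv0 -dis memv_cap rpredB ?sU //=.
  have e : pi i (vec s0) = vec s0 by rewrite (is_Y_act _ hY s0K) /hecke_act di.
  have -> : pi i u - u = - (pi i w - w).
    have e2 : pi i u + pi i w = u + w by rewrite -[LHS](linearD (pi i)) /= -uw e.
    by rewrite opprB -[pi i u](addrK (pi i w)) e2 addrAC [u + w]addrC addrK.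
  by rewrite rpredN rpredB ?sW.
have [c uc] := source_line fix_u.
have [c0|c0] := eqVneq c 0.
  left; have s0W : vec s0 \in W by rewrite uw uc c0 scale0r add0r.
  by rewrite -dis (cyclic_source sW s0W) capvf.
right; have s0U : vec s0 \in U.
  by have := memvZ c^-1 uU; rewrite uc scalerA mulVf // scale1r.
by rewrite -dis (cyclic_source sU s0U) capfv.
Qed.

(** Only the collection of operators matters, not their indices: this treats the module and its
    twist at once. *)
Lemma Y_indecomposable (M : hmodule n V) :
  (forall i, exists j, M (hecke_gen F j) = pi i) -> indecomposable M.
Proof.
move=> hM; split.
  by move/eqP; apply/negP; apply: contra (Yvec_eq0 F s0K) => /eqP e; rewrite -memv0 -e memvf.
have st U : submodule M U -> stable U.
  move=> sU i v vU; have [j <-] := hM i; exact: (subvP (sU _)) (memv_img _ vU).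
by move=> U W /st sU /st sW; apply: stable_indecomposable.
Qed.

End Indecomposable.

(** * The quasisymmetric characteristic *)

Lemma hactD (F : fieldType) n (V : vectType F) (M : hmodule n V) x y : M (x + y) = M x + M y.
Proof. by have := hact_linear M 1 x y; rewrite !scale1r. Qed.

Lemma hactZ (F : fieldType) n (V : vectType F) (M : hmodule n V) c x : M (c *: x) = c *: M x.
Proof.
have M0 : M 0 = 0 by have := hact_linear M (-1) 0 0; rewrite !scaleN1r !addNr.
by have := hact_linear M c x 0; rewrite M0 !addr0.
Qed.

Section Restriction.
Variables (F : fieldType) (n : nat) (V : vectType F) (M : hmodule n V) (U : {vspace V}).
Hypothesis sU : forall i v, v \in U -> M (hecke_gen F i) v \in U.

Lemma submodule_gen h v : v \in U -> M h v \in U.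
Proof.
move: h v; apply: hecke_ind => [v vU|i v /sU //|x y hx hy v vU|x y hx hy v vU|c x hx v vU].
- by rewrite hact1 id_lfunE.
- by rewrite hactD lfunE /= rpredD ?hx ?hy.
- by rewrite hactM comp_lfunE; apply/hx/hy.
by rewrite hactZ lfunE /= rpredZ ?hx.
Qed.

Definition restrict_act h : 'End(subvs_of U) :=
  (linfun (vsproj U) \o M h \o linfun (@vsval _ _ U))%VF.

Lemma restrict_actE h (u : subvs_of U) : vsval (restrict_act h u) = M h (vsval u).
Proof.
by rewrite !comp_lfunE !lfunE /= vsprojK // submodule_gen ?subvsP.
Qed.

Fact restrict_linear : linear restrict_act.
Proof.
move=> c x y; apply/lfunP => u; apply/val_inj.
by rewrite /= restrict_actE hact_linear !add_lfunE !scale_lfunE linearP /= !restrict_actE.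
Qed.

Fact restrict1 : restrict_act 1 = \1%VF.
Proof. by apply/lfunP => u; apply/val_inj; rewrite /= restrict_actE hact1 !id_lfunE. Qed.

Fact restrictM g h : restrict_act (g * h) = (restrict_act g \o restrict_act h)%VF.
Proof.
apply/lfunP => u; have e : vsval ((restrict_act g \o restrict_act h)%VF u) = M g (M h (vsval u)).
  by rewrite comp_lfunE !restrict_actE.
by apply/val_inj; rewrite /= restrict_actE hactM comp_lfunE e.
Qed.

Definition restrict : hmodule n (subvs_of U) := HModule restrict_linear restrict1 restrictM.

End Restriction.

Section Triangular.
Variables (F : fieldType) (n : nat) (T : Type) (eps : T -> nat -> bool).

(* The simple module where pi_k acts by 1 when [eps t k] holds, and by 0 otherwise. *)
Definition fixed_comp t := comp_of_set n [seq k <- iota 1 n.-1 | ~~ eps t k].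

Lemma simple_exists t : exists N : hmodule n (F^o : vectType F),
  (forall i v, N (hecke_gen F i) v = (eps t i.+1)%:R * v) /\ simple_module (fixed_comp t) N.
Proof.
pose p (i : 'I_n.-1) : 'End(F^o : vectType F) := (eps t i.+1)%:R *: \1%VF.
have pE i v : p i v = (eps t i.+1)%:R * v by rewrite scale_lfunE id_lfunE.
have [|||N hN] := @hmodule_of_operators F n (F^o : vectType F) p.
- by move=> i; apply/lfunP => v; rewrite comp_lfunE !pE; case: eps; rewrite ?mul1r ?mul0r.
- by move=> i j _; apply/lfunP => v; rewrite !comp_lfunE !pE; do 2!case: eps; rewrite ?mul1r ?mul0r.
- by move=> i j _; apply/lfunP => v; rewrite !comp_lfunE !pE mulrCA.
exists N; split=> [i v|]; first by rewrite hN pE.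
split; first by rewrite dimvf.
move=> i v; rewrite hN pE.
rewrite comp_set_of_set.
- rewrite mem_filter mem_iota add1n ltnS /=; have := ltn_ord i; case: n i => [[]//|m] i im.
  by rewrite [_ && _](_ : _ = ~~ eps t i.+1) ?im ?andbT //; case: eps; rewrite ?mul1r ?mul0r.
- by apply: sorted_filter; [apply: ltn_trans | apply: iota_ltn_sorted].
by move=> v'; rewrite mem_filter mem_iota => /and3P[_ h1 h2]; rewrite h1 /=; move: h1 h2; lia.
Qed.

Lemma fixed_comp_comp t : is_comp n (fixed_comp t).
Proof.
apply: comp_of_set_comp.
- by apply: sorted_filter; [apply: ltn_trans | apply: iota_ltn_sorted].
by move=> v'; rewrite mem_filter mem_iota => /and3P[_ h1 h2]; rewrite h1 /=; move: h1 h2; lia.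
Qed.


Lemma hmorphism_gen (V W : vectType F) (M : hmodule n V) (N : hmodule n W) (f : 'Hom(V, W)) :
  (forall i v, f (M (hecke_gen F i) v) = N (hecke_gen F i) (f v)) -> hmorphism M N f.
Proof.
move=> h; apply: hecke_ind => [v|i v|x y hx hy v|x y hx hy v|c x hx v].
- by rewrite !hact1 !id_lfunE.
- exact: h.
- by rewrite !hactD !add_lfunE linearD /= hx hy.
- by rewrite !hactM !comp_lfunE hx hy.
by rewrite !hactZ !scale_lfunE linearZ /= hx.
Qed.

(* The functionals cut out a filtration of V by submodules, whose factors are
   simple. *)
Lemma qchar_triangular (l : seq T) (V : vectType F) (M : hmodule n V) (p : T -> 'Hom(V, F^o)) :
    (forall l1 t l2 i v, l = l1 ++ t :: l2 -> all (fun s => p s v == 0) l1 ->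
       p t (M (hecke_gen F i) v) = (eps t i.+1)%:R * p t v) ->
    (forall v, all (fun s => p s v == 0) l -> v = 0) ->
    (forall l1 t l2, l = l1 ++ t :: l2 -> exists v, all (fun s => p s v == 0) l1 /\ p t v != 0) ->
  qchar M (fun m => \sum_(t <- l) fundamental (fixed_comp t) m).
Proof.
elim: l V M p => [|t l IH] V M p H1 H2 H3.
  rewrite (_ : (fun m => _) = fun=> 0); last by apply/funext => m; rewrite big_nil.
  apply: QcharZero; suff -> : {: V}%VS = 0%VS by rewrite dimv0.
  by apply/eqP; rewrite -subv0; apply/subvP => v _; rewrite (H2 v isT) mem0v.
pose U := lker (p t).
have sU i v : v \in U -> M (hecke_gen F i) v \in U.
  by rewrite !memv_ker (H1 [::] t l) // => /eqP ->; rewrite mulr0.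
have [N [hN sN]] := simple_exists t.
pose j : 'Hom(subvs_of U, V) := linfun (@vsval _ _ U).
have jE u : j u = vsval u by rewrite lfunE.
pose p' s := (p s \o j)%VF.
have p'E s u : p' s u = p s (vsval u) by rewrite comp_lfunE jE.
have all' l1 (u : subvs_of U) : all (fun s => p' s u == 0) l1 = all (fun s => p s (vsval u) == 0) l1.
  by apply: eq_all => s; rewrite p'E.
have U0 (u : subvs_of U) : p t (vsval u) == 0 by have := subvsP u; rewrite memv_ker.
rewrite (_ : (fun m => _) =
  (fun m => \sum_(t <- l) fundamental (fixed_comp t) m + fundamental (fixed_comp t) m)); last first.
  by apply/funext => m; rewrite big_cons addrC.
have [v0 [_ v00]] := H3 [::] t l erefl.
apply: (@QcharExact _ _ _ _ _ (restrict sU) M N j (p t)).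
- by move=> h u; rewrite !jE restrict_actE.
- by apply: hmorphism_gen => i v; rewrite (H1 [::] t l) // hN.
- by apply/eqP/lker0P => u v; rewrite !jE; apply: val_inj.
- apply/eqP; rewrite eqEsubv; apply/andP; split; apply/subvP => v.
    by case/memv_imgP => u _ ->; rewrite jE subvsP.
  by move=> vU; rewrite -[v](vsprojK vU) -jE memv_img ?memvf.
- apply/eqP; rewrite eqEsubv subvf; apply/subvP => a _.
  have -> : a = p t ((a / p t v0) *: v0) by rewrite linearZ /= [_ *: _]divfK.
  by rewrite memv_img ?memvf.
- apply: (IH _ (restrict sU) p') => [l1 s l2 i u el|u|l1 s l2 el].
  + rewrite all' !p'E (restrict_actE sU) => h; apply: (H1 (t :: l1) s l2) => /=; first by rewrite el.
    by rewrite U0.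
  + by rewrite all' => h; apply/val_inj/H2; rewrite /= U0.
  have [|v [/= /andP[v1 v2] v3]] := H3 (t :: l1) s l2; first by rewrite el.
  have vU : v \in U by rewrite memv_ker.
  by exists (vsproj U v); rewrite all' p'E vsprojK.
exact: QcharSimple (fixed_comp_comp t) sN.
Qed.
End Triangular.

Section Characteristic.
Variables (F : fieldType) (n : nat) (alpha : seq nat).
Hypothesis halpha : is_comp n alpha.
Local Notation K := (Kset n alpha).
Local Notation V := (Yspace F n alpha).
Local Notation vec := (@Yvec F n alpha).
Local Notation I := {s : 'S_n | s \in K}.
Let al0 : all (leq 1) alpha. Proof. by case/andP: halpha. Qed.
Let an : sumn alpha = n. Proof. by case/andP: halpha => _ /eqP. Qed.

Definition heavier (s t : I) := (inversion_weight (val t) <= inversion_weight (val s))%N.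
(** By decreasing weight: a permutation that [hecke_act] moves to t precedes t. So once the
    coordinates before t vanish, the coordinate at t is multiplied by 0 or 1. *)
Definition Kseq : seq I := sort heavier (enum {: I}).

Definition coordinate_fun (t : I) (u : V) : F^o := u t.
Fact coordinate_linear t : linear (coordinate_fun t).
Proof. by move=> c u v; rewrite /coordinate_fun !ffunE. Qed.
HB.instance Definition _ t := GRing.isLinear.Build F V F^o _ (coordinate_fun t) (coordinate_linear t).

Definition coordinate (t : I) : 'Hom(V, F^o) := linfun (coordinate_fun t).

Lemma coordinateE t u : coordinate t u = u t.
Proof. by rewrite lfunE. Qed.

Lemma mem_Kseq t : t \in Kseq.
Proof. by rewrite mem_sort mem_enum. Qed.

Lemma Kseq_uniq : uniq Kseq.
Proof. by rewrite sort_uniq enum_uniq. Qed.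

Lemma Kseq_before l1 t l2 t' : Kseq = l1 ++ t :: l2 ->
  (inversion_weight (val t) < inversion_weight (val t'))%N -> t' \in l1.
Proof.
move=> e lt; have : t' \in Kseq by apply: mem_Kseq.
rewrite e mem_cat inE => /orP[//|/orP[/eqP tt|t2]]; first by rewrite tt ltnn in lt.
have tr : transitive heavier by move=> x y z h1 h2; apply: leq_trans h2 h1.
have : sorted heavier Kseq by apply: sort_sorted => x y; apply: leq_total.
rewrite e => /cat_sorted2[_] /=.
move/(order_path_min tr)/allP/(_ t' t2); rewrite /heavier leqNgt lt //.
Qed.

Variable Y : hmodule n V.
Hypothesis hY : is_Y Y.

Lemma qchar_Y_perm (M : hmodule n V) (g : 'I_n.-1 -> 'I_n.-1) (eps : I -> nat -> bool) :
    (forall i, M (hecke_gen F i) = Y (hecke_gen F (g i))) ->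
    (forall t (i : 'I_n.-1), eps t i.+1 = DesL (val t) (g i)) ->
  qchar M (fun m => \sum_(t <- Kseq) fundamental (fixed_comp n eps t) m).
Proof.
move=> hM heps; apply: (@qchar_triangular F n I eps Kseq V M coordinate).
- move=> l1 t l2 i v e /allP l10; rewrite hM !coordinateE heps.
  rewrite {1}[v]Yvec_sum linear_sum sum_ffunE.
  have term t' : (Y (hecke_gen F (g i)) (v t' *: vec (val t'))) t =
      v t' * (val t == hecke_act (g i) (val t'))%:R.
    by rewrite linearZ /= (is_Y_act _ hY (valP t')) !ffunE.
  rewrite (eq_bigr _ (fun t' _ => term t')) (bigD1 t) //= big1 ?addr0 => [|t' ne].
    have [d|d] := boolP (DesL (val t) (g i)); first by rewrite /hecke_act d eqxx mulr1 mul1r.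
    rewrite mul0r (_ : val t == _ = false) ?mulr0 //.
    by apply: contraNF d => /eqP ->; apply: hecke_act_des.
  have [e1|] := eqVneq (val t) (hecke_act (g i) (val t')); last by rewrite mulr0.
  suff t'l : t' \in l1 by have := l10 _ t'l; rewrite coordinateE => /eqP ->; rewrite mul0r.
  apply: (Kseq_before e); move: e1; rewrite /hecke_act; case: ifP => [_ /val_inj tt|/negbT nd e1].
    by rewrite tt eqxx in ne.
  rewrite -[X in (_ < inversion_weight X)%N](simpleK _ (g i)) -e1.
  by apply: inversion_weight_simple; rewrite e1 DesL_simple.
- move=> v /allP h; apply/ffunP => t; rewrite ffunE.
  by have := h t (mem_Kseq t); rewrite coordinateE => /eqP.
move=> l1 t l2 e; exists (vec (val t)); split; last first.
  by rewrite coordinateE ffunE eqxx oner_neq0.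
apply/allP => s sl1; rewrite coordinateE ffunE.
case: (val s =P val t) => [/val_inj st|_]; last by rewrite eqxx.
have := Kseq_uniq.
by rewrite e cat_uniq -st => /and3P[_ /hasPn/(_ s (mem_head _ _))]; rewrite sl1.
Qed.

Definition K_SYCT (t : I) : filling := insP (wd (val t)).

Lemma perm_Kseq : perm_eq [seq K_SYCT t | t <- Kseq] (SYCT alpha).
Proof.
have pw (s : 'S_n) : perm_eq (wd s) (iota 1 (sumn alpha)) by rewrite an perm_wd.
have gw (t : I) : good alpha (wd (val t)) by apply/(mem_Kset halpha)/valP.
apply: uniq_perm; last 1 first.
- move=> T; apply/mapP/idP => [[t _ ->]|]; first exact: word_SYCT.
  move=> /(SYCT_word al0)[w [pww gdw <-]]; rewrite an in pww; have [s sw] := wd_surj pww.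
  have sK : s \in K by apply/(mem_Kset halpha); rewrite sw.
  by exists (exist _ s sK); rewrite ?mem_Kseq // /K_SYCT /= sw.
- rewrite map_inj_uniq ?Kseq_uniq // => t t' e; apply/val_inj/wd_inj.
  exact: (good_insP_inj al0).
exact: SYCT_uniq.
Qed.

Lemma column_desn (t : I) k : (0 < k < n)%N ->
  (column (K_SYCT t) k.+1 <= column (K_SYCT t) k)%N = ~~ desn (val t) k.
Proof.
move=> hk; rewrite leqNgt /desn insP_desc ?wd_uniq // (perm_mem (perm_wd _)) mem_iota; move: hk; lia.
Qed.

Lemma qchar_Y : qchar Y (young_qschur alpha).
Proof.
have := @qchar_Y_perm Y id (fun t k => desn (val t) k) (fun=> erefl) (fun t i => esym (DesL_desn _ _)).
congr (qchar _ _); apply/funext => m; rewrite /young_qschur -(perm_big _ perm_Kseq) big_map.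
apply: eq_bigr => t _; rewrite an /fixed_comp; congr (fundamental (comp_of_set _ _) _).
apply: eq_in_filter => k; rewrite mem_iota => hk.
by rewrite -column_desn //; move: hk; lia.
Qed.

Lemma twist_gen i : twist Y (hecke_gen F i) = Y (hecke_gen F (rev_ord i)).
Proof. by rewrite /= /twist_act hecke_phi_gen. Qed.

Lemma qchar_twist : qchar (twist Y) (qschur (rev alpha)).
Proof.
(* Under the twist the generator of index k acts as that of index n - k, so descents are reflected
   in the same way as by complementing the entries. *)
have E (t : I) (i : 'I_n.-1) : desn (val t) (n - i.+1)%N = DesL (val t) (rev_ord i).
  by rewrite DesL_desn /=; congr desn; have := ltn_ord i; lia.
have := @qchar_Y_perm (twist Y) (@rev_ord _) (fun t k => desn (val t) (n - k)%N) twist_gen E.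
congr (qchar _ _); apply/funext => m; rewrite /qschur revK sumn_rev an.
rewrite -(perm_big _ (perm_complement_SYCT al0)) big_map -(perm_big _ perm_Kseq) big_map.
apply: eq_bigr => t _; rewrite /fixed_comp; congr (fundamental (comp_of_set _ _) _).
rewrite an DesC_complement; last first.
  have tS : K_SYCT t \in SYCT alpha by rewrite -(perm_mem perm_Kseq) map_f ?mem_Kseq.
  by have [] := (mem_SYCT _ al0).1 tS; rewrite an.
apply: eq_in_filter => k; rewrite mem_iota => hk.
by rewrite -column_desn //; move: hk; lia.
Qed.

End Characteristic.

Theorem theorem5p1 (R : realType) (n : nat) (alpha : seq nat)
    (halpha : is_comp n alpha) :
  (exists Y : hmodule n (Yspace R[i] n alpha), is_Y Y) /\
  (forall Y : hmodule n (Yspace R[i] n alpha), is_Y Y ->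
     (indecomposable Y /\ qchar Y (young_qschur alpha)) /\
     (indecomposable (twist Y) /\ qchar (twist Y) (qschur (rev alpha)))).
Proof.
split; first exact: Y_exists.
move=> Y hY; have [s0 s0K s0c] := Kset_source halpha.
split; (split; [|by [apply: qchar_Y | apply: qchar_twist]]);
  apply: (Y_indecomposable halpha hY s0K s0c) => i.
  by exists i.
by exists (rev_ord i); rewrite twist_gen rev_ordK.
Qed.
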